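(* Let $\Omega\subset\mathbb{R}^N$ ($N\ge1$) be a bounded convex domain with smooth boundary, and let $p(\cdot):\Omega\to]1,+\infty[$ be measurable with $1<p^-\le p(x)\le p^+<+\infty$, where $p^-=\operatorname{ess\,inf}p$ and $p^+=\operatorname{ess\,sup}p$. Put $\alpha=\frac{p^-}{p^+}$. Then there is a constant $C>0$, independent of $\rho_0,\rho_1$, such that for all $\rho_0,\rho_1\in P(\Omega)$ $$W_{p(\cdot)}(\rho_0,\rho_1)\le d_{F_{p(\cdot)}}(\rho_0,\rho_1)\le C\,W_{p(\cdot)}(\rho_0,\rho_1)^{\alpha}.$$
   Context: $P(\Omega)$ is the set of probability measures on $\Omega$; integration against $\rho\in P(\Omega)$ is written $\rho(x)dx$. Wasserstein distance: for $\rho_0,\rho_1\in P(\Omega)$, $$W_{p(\cdot)}(\rho_0,\rho_1):=\inf\Big\{\|v\|_{L^{p(\cdot)}_{\rho}([0,1]\times\Omega)}: \partial_t\rho+\mathrm{div}_x(\rho v)=0,\ \rho(0)=\rho_0,\ \rho(1)=\rho_1\Big\},$$ over curves $t\in[0,1]\mapsto\rho(t,\cdot)\in P(\Omega)$ and velocity fields $v$, with $\|v\|_{L^{p(\cdot)}_{\rho}([0,1]\times\Omega)}:=\inf\{\lambda>0:\int_{[0,1]\times\Omega}|v(t,x)/\lambda|^{p(x)}\rho(t,x)\,dt\,dx\le1\}$. Finsler metric: for $\rho\in P(\Omega)$, $L^{p(\cdot)}_\rho(\Omega)$ is the space of ($\mathbb{R}^N$-valued) fields $v$ on $\Omega$ with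 finite norm $\|v\|_{L^{p(\cdot)}_\rho(\Omega)}=\inf\{\lambda>0:\int_\Omega|v(x)/\lambda|^{p(x)}\rho(x)dx\le1\}$. The tangent space at $\rho$ is $T_\rho P_{p(\cdot)}(\Omega):=\{\nu=-\mathrm{div}(\rho v): v\in L^{p(\cdot)}_\rho(\Omega)\}$ (divergence in the distributional sense), with norm $$\|\nu\|_X:=\inf\{\|v+w\|_{L^{p(\cdot)}_\rho(\Omega)}: w\in L^{p(\cdot)}_\rho(\Omega),\ \mathrm{div}(\rho w)=0\}\quad\text{for }\nu=-\mathrm{div}(\rho v),$$ and $F_{p(\cdot)}(\rho,\nu):=\|\nu\|_X$. Induced distance: the length of a curve $\rho(t,\cdot):[0,1]\to P(\Omega)$ is $L_{F_{p(\cdot)}}(\rho(t,\cdot)):=\int_0^1F_{p(\cdot)}(\rho(t,\cdot),\dot\rho(t))\,dt$ with $\dot\rho(t)=\partial_t\rho(t,\cdot)$, and $d_{F_{p(\cdot)}}(\rho_0,\rho_1)$ is the infimum of $L_{F_{p(\cdot)}}(\rho(t,\cdot))$ over curves in $P(\Omega)$ with $\rho(0)=\rho_0$, $\rho(1)=\rho_1$. *)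

(* Defs.v *)
From HB Require Import structures.
From mathcomp Require Import all_boot all_order all_algebra.
From mathcomp Require Import all_classical all_reals all_analysis.
From mathcomp Require Import ess_sup_inf.

Set Implicit Arguments.
Unset Strict Implicit.
Unset Printing Implicit Defensive.
Import Order.TTheory GRing.Theory Num.Theory.
Import numFieldNormedType.Exports.
Local Open Scope classical_set_scope.
Local Open Scope ring_scope.

(* R^n is the type of row vectors 'rV[R]_n, with its library topology and the
   Borel sigma-algebra. *)
HB.instance Definition _ (R : realType) (m n : nat) :=
  @isMeasurable.Build (sigma_display (@open 'M[R]_(m, n))) 'M[R]_(m, n)
    <<s @open 'M[R]_(m, n) >> (@sigma_algebra0 _ setT _)
    (@sigma_algebraC 'M[R]_(m, n) _) (@sigma_algebra_bigcup _ setT _).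

Lemma measurable_fun_row (R : realType) (d : measure_display)
    (T : measurableType d) (n : nat) (f : T -> 'rV[R]_n) :
  (forall i, measurable_fun setT (fun x => f x 0 i)) -> measurable_fun setT f.
Proof.
move=> mf; apply: (@measurability _ _ _ _ _ _ (@open 'rV[R]_n)) => //.
move=> _ [U oU <-]; rewrite setTI.
pose box (ab : 'rV[rat]_n * 'rV[rat]_n) : set 'rV[R]_n :=
  [set y | forall i, ratr (ab.1 0 i) < y 0 i < ratr (ab.2 0 i)].
have -> : U = \bigcup_ab (if `[< box ab `<=` U >] then box ab else set0).
  apply/seteqP; split => [y Uy|y [ab _]]; last first.
    by case: asboolP => // + bo; exact.
  move: (oU); rewrite openE => /(_ _ Uy)/nbhs_ballP[e /= e0 eU].
  have lo i : exists q : rat, y 0 i - e < ratr q < y 0 i.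
    have /rat_in_itvoo[q] : y 0 i - e < y 0 i by rewrite ltrBlDr ltrDl.
    by rewrite in_itv/= => qP; exists q.
  have hi i : exists q : rat, y 0 i < ratr q < y 0 i + e.
    have /rat_in_itvoo[q] : y 0 i < y 0 i + e by rewrite ltrDl.
    by rewrite in_itv/= => qP; exists q.
  have [a aP] := choice lo; have [b bP] := choice hi.
  have sub : box (\row_i a i, \row_i b i) `<=` U.
    move=> z zP; apply: eU; split => // i j; rewrite ord1.
    have := zP j; rewrite !mxE/= => /andP[az zb].
    have /andP[a1 a2] := aP j; have /andP[b1 b2] := bP j.
    rewrite -ball_normE/= ltr_distlC; apply/andP; split.
      exact: lt_trans az.
    exact: lt_trans b2.
  exists (\row_i a i, \row_i b i) => //; case: asboolP => // _ i.
  by rewrite !mxE/=; have /andP[_ ->] := aP i; have /andP[-> _] := bP i.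
rewrite preimage_bigcup.
apply: countable_bigcupT_measurable => [|ab]; first exact: countableP.
case: asboolP => _; last by rewrite preimage_set0.
have -> : f @^-1` box ab = \bigcap_(i in [set: 'I_n])
    (fun x => f x 0 i) @^-1` `]ratr (ab.1 0 i), ratr (ab.2 0 i)[.
  apply/seteqP; split => x /= bx i.
    by move=> _ /=; rewrite in_itv/=; exact: bx.
  by have := bx i I; rewrite /= in_itv.
apply: fin_bigcap_measurable => // i _.
by rewrite -[X in measurable X]setTI; exact: mf.
Qed.

Section lebesgue.
Context (R : realType).

Definition cons_row (n : nat) (z : 'rV[R]_n * measurableTypeR R) :
    'rV[R]_n.+1 :=
  \row_i oapp (fun j => z.1 0 j) z.2 (unlift ord0 i).

Lemma measurable_cons_row n : measurable_fun setT (@cons_row n).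
Proof.
apply: measurable_fun_row => i; rewrite /cons_row.
case: (unliftP ord0 i) => [j|] ->.
  rewrite (_ : (fun x => _) = (fun v : 'rV[R]_n => v 0 j) \o fst); last first.
    by apply/funext => z; rewrite /= mxE liftK.
  apply: measurableT_comp => //.
  apply: (@measurability _ _ _ _ _ _ (@measurable_realfun.RGenOpens.G R)).
    exact: measurable_realfun.RGenOpens.measurableE.
  move=> _ [_ [a [b ->]] <-]; rewrite setTI; apply: sub_sigma_algebra.
  by apply: open_comp => // v _; exact: coord_continuous.
rewrite (_ : (fun x => _) = snd) //.
by apply/funext => z; rewrite /= mxE unlift_none.
Qed.

Definition lebesgue_cons (n : nat) (mu : {measure set 'rV[R]_n -> \bar R}) :=
  pushforward (mu \x @lebesgue_measure R)%E (@cons_row n).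

HB.instance Definition _ n (mu : {measure set 'rV[R]_n -> \bar R}) :=
  Measure.copy (lebesgue_cons mu)
    (measure_function_pushforward__canonical__measure_function_Measure
       (mu \x @lebesgue_measure R)%E (@measurable_cons_row n)).

Fixpoint lebesgue_row (n : nat) : {measure set 'rV[R]_n -> \bar R} :=
  if n is k.+1 then lebesgue_cons (lebesgue_row k) else \d_(0 : 'rV[R]_0).

End lebesgue.

Section euclidean.
Context (R : realType) (n : nat).
Implicit Types (u v : 'rV[R]_n) (phi : 'rV[R]_n -> R).

Definition dot u v : R := \sum_i u 0 i * v 0 i.

(* The library norm of 'rV[R]_n is the sup norm. *)
Definition enorm v : R := Num.sqrt (dot v v).

Definition gradient phi (x : 'rV[R]_n) : 'rV[R]_n :=
  \row_i 'D_(delta_mx 0 i) phi x.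

End euclidean.

(* All iterated directional derivatives exist and are continuous; in finite
   dimension this is C^oo. *)
Definition smooth (R : realType) (V : normedModType R) (f : V -> R) :=
  forall s : seq V, let g := foldr (fun v h => 'D_v h) f s in
    continuous g /\ forall x v, derivable g x v.

Definition test_function (R : realType) (V : normedModType R) (U : set V)
    (phi : V -> R) :=
  let supp := closure [set x | phi x != 0] in
  [/\ smooth phi, compact supp & supp `<=` U].

Definition smooth_boundary (R : realType) (n : nat) (Omega : set 'rV[R]_n) :=
  forall x0, (closure Omega `\` Omega°) x0 ->
    exists (U : set 'rV[R]_n) (g : 'rV[R]_n -> R),
      [/\ open U, U x0, smooth g, gradient g x0 != 0 &
          Omega `&` U = [set x | U x /\ g x < 0]].

Section wasserstein.
Context (R : realType) (n : nat).
Variables (Omega : set 'rV[R]_n) (p : 'rV[R]_n -> R).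

Local Notation E := ('rV[R]_n).
Local Notation mu := (@lebesgue_measure R).
Local Notation I01 := (`[0, 1]%classic : set R).

(* essential bounds of p on Omega for the Lebesgue measure: outside Omega, p is
   replaced by the neutral element of the infimum, resp. supremum *)
Definition p_minus : \bar R :=
  ess_inf (lebesgue_row R n) (patch (cst +oo%E) Omega (EFin \o p)).
Definition p_plus : \bar R :=
  ess_sup (lebesgue_row R n) (patch (cst -oo%E) Omega (EFin \o p)).

(* P(Omega): Borel probability measures on R^n carried by Omega *)
Definition prob_on (rho : probability E R) : Prop := rho Omega = 1%E.

(* Luxemburg norms; +oo when no lambda is admissible *)
Definition lux_norm (rho : probability E R) (v : E -> E) : \bar R :=
  ereal_inf [set l%:E | l in [set l : R | 0 < l /\
    (\int[rho]_(x in Omega) ((enorm (v x) / l) `^ p x)%:E <= 1)%E]].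

Definition lux_norm_time (rho : R -> probability E R) (v : R -> E -> E) :
    \bar R :=
  ereal_inf [set l%:E | l in [set l : R | 0 < l /\
    (\int[mu]_(t in I01) \int[rho t]_(x in Omega)
       ((enorm (v t x) / l) `^ p x)%:E <= 1)%E]].

Definition lp_field (rho : probability E R) (v : E -> E) : Prop :=
  measurable_fun Omega v /\ (lux_norm rho v < +oo)%E.

(* A curve in P(Omega) is indexed by R, but only its values on [0, 1] matter.
   It is continuous for the narrow topology, without which the endpoint
   conditions would carry no information. *)
Definition curve (rho : R -> probability E R) : Prop :=
  (forall t, I01 t -> prob_on (rho t)) /\
  (forall f : E -> R, continuous f -> (exists M, forall x, `|f x| <= M) ->
     {within I01, continuous (fun t => \int[rho t]_x f x)}).

Definition curve_between (rho0 rho1 : probability E R)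
    (rho : R -> probability E R) : Prop :=
  [/\ curve rho, forall A, measurable A -> rho 0 A = rho0 A &
      forall A, measurable A -> rho 1 A = rho1 A].

(* test functions on ]0, 1[ x R^n; no condition at the boundary of Omega, so
   that the continuity equation contains the no-flux boundary condition *)
Definition spacetime_test (phi : R * E -> R) : Prop :=
  test_function [set z : R * E | 0 < z.1 < 1] phi.

Definition dt (phi : R * E -> R) (t : R) (x : E) : R := 'D_(1, 0) phi (t, x).

(* d_t rho + div_x (rho v) = 0, tested against phi *)
Definition continuity_equation (rho : R -> probability E R)
    (v : R -> E -> E) : Prop :=
  forall phi, spacetime_test phi ->
    (\int[mu]_(t in I01) \int[rho t]_(x in Omega)
      (dt phi t x + dot (gradient (fun y => phi (t, y)) x) (v t x))%:E = 0)%E.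

Definition wasserstein (rho0 rho1 : probability E R) : \bar R :=
  ereal_inf [set lux_norm_time c.1 c.2 |
    c in [set c : (R -> probability E R) * (R -> E -> E) |
      [/\ curve_between rho0 rho1 c.1,
          measurable_fun (I01 `*` Omega)
            (fun z : measurableTypeR R * E => c.2 z.1 z.2) &
          continuity_equation c.1 c.2]]].

(* Distributions on R^n are represented by their action on functions; only the
   values on test functions matter. *)
Definition functional := (E -> R) -> R.

Definition eq_distributions (nu nu' : functional) : Prop :=
  forall phi, test_function [set: E] phi -> nu phi = nu' phi.

(* - div (rho v), that is, minus the divergence moved onto the test function *)
Definition neg_div (rho : probability E R) (v : E -> E) : functional :=
  fun phi => \int[rho]_(x in Omega) dot (gradient phi x) (v x).

Definition div_free (rho : probability E R) (w : E -> E) : Prop :=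
  eq_distributions (neg_div rho w) (fun _ => 0).

Definition represents (rho : probability E R) (nu : functional)
    (v : E -> E) : Prop :=
  lp_field rho v /\ eq_distributions nu (neg_div rho v).

Definition tangent (rho : probability E R) (nu : functional) : Prop :=
  exists v, represents rho nu v.

Definition quotient_norm (rho : probability E R) (v : E -> E) : \bar R :=
  ereal_inf [set lux_norm rho (fun x => v x + w x) |
    w in [set w | lp_field rho w /\ div_free rho w]].

(* The quotient norm is the same for all v that represent nu, so the infimum
   over v only selects a representative; it is +oo if nu is not tangent. *)
Definition finsler (rho : probability E R) (nu : functional) : \bar R :=
  ereal_inf [set quotient_norm rho v | v in [set v | represents rho nu v]].

(* nu = d_t rho in the distributional sense on ]0, 1[ x R^n. In particular t
   |-> rho t is absolutely continuous as a distribution-valued map: a.e.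
   pointwise differentiability in t would allow curves of Cantor type, with zero
   length and distinct endpoints. *)
Definition time_derivative (rho : R -> probability E R)
    (nu : R -> functional) : Prop :=
  forall phi, spacetime_test phi ->
    mu.-integrable I01 (fun t => (nu t (fun x => phi (t, x)))%:E) /\
    (\int[mu]_(t in I01) \int[rho t]_(x in Omega) (dt phi t x)%:E =
     - \int[mu]_(t in I01) (nu t (fun x => phi (t, x)))%:E)%E.

Definition finsler_length (rho : R -> probability E R)
    (nu : R -> functional) : \bar R :=
  (\int[mu]_(t in I01) finsler (rho t) (nu t))%E.

Definition finsler_distance (rho0 rho1 : probability E R) : \bar R :=
  ereal_inf [set finsler_length c.1 c.2 |
    c in [set c : (R -> probability E R) * (R -> functional) |
      [/\ curve_between rho0 rho1 c.1,
          time_derivative c.1 c.2 &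
          {ae mu, forall t, I01 t -> tangent (c.1 t) (c.2 t)}]]].

End wasserstein.

(* Main.v *)
(* Upper bound. Let the curve rho be driven by v with space-time modular at most 1
   at level l, and let m(t) be the modular of v_t at level l. As p >= 1, the
   Luxemburg norm of v_t is at most l (1 + m(t)), and so is F(rho_t, d_t rho);
   hence d_F <= 2 W. Contracting rho0 onto a point of Omega along segments, then
   expanding that point into rho1, costs at most D := 2 diam Omega. So W <= D, and
   W <= (1 + D) W^alpha because 0 < alpha <= 1.

   Lower bound. Let d_t rho = nu. Young's inequality with the conjugate Phi* of
   |z|^p(x) gives, for every space-time test function phi,
     nu_t(phi_t) <= F(rho_t, nu_t) (1 + int Phi*(x, grad phi_t) drho_t).
   An essential supremum over phi replaces t |-> F(rho_t, nu_t), which need not be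
   measurable, by a measurable lam with int lam <= length. Put
   Lam := int (lam + e) and f := (lam + e) / Lam. After integration, Fenchel duality
   for the measure f(t) dt rho_t(dx) yields a field J of modular at most 1 with
     - int int d_t phi drho_t dt = Lam int int J . grad phi drho_t f dt.
   In the time s = int_0^t f this is the continuity equation for the velocity
   Lam J, so W <= Lam. As (t, x) |-> psi(s(t), x) is not smooth, f is approximated
   in L^1 by squares of polynomials. *)
From HB Require Import structures.
Require Import Defs.
From mathcomp Require Import all_boot all_order all_algebra.
From mathcomp Require Import all_classical all_reals all_analysis.
From mathcomp Require Import measurable_realfun giry ess_sup_inf ring lra.
Import Order.TTheory GRing.Theory Num.Theory.
Import numFieldNormedType.Exports.
Local Open Scope classical_set_scope.
Local Open Scope ring_scope.

(** * Euclidean norm and convex conjugates *)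

(** A curve in [finsler_distance] comes with tangent vectors, not with a velocity field. Each time t
    has near-optimal fields, but picking one measurably in t is a selection problem. The lower bound
    selects nothing: scalar inequalities against test functions are integrated first, and the
    duality then yields one field [J] on all of space-time. The [e] added to [lam] keeps f above e /
    Lam > 0, so that elapsed time is strictly increasing even where the curve stands still, and can
    be inverted. As f has mass 1, the weight 1 + int Phi* integrates to 1 plus the conjugate
    modular; this 1 becomes the modular bound on [J]. Squares of polynomials serve because the
    primitive S of a nonnegative polynomial is nondecreasing: psi(S(t), x) is then smooth and, when
    S is close enough to elapsed time, supported in ]0, 1[. All estimates in the exponent are
    uniform for p(x) between pm and pp. To integrate over the whole space, p is replaced by an
    extension [q] with the same bounds. *)

Section Euclidean.
Context {R : realType} {n : nat}.
Implicit Types (u v w : 'rV[R]_n).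

Lemma dotC u v : dot u v = dot v u.
Proof. by apply: eq_bigr => i _; rewrite mulrC. Qed.

Lemma dotDl u v w : dot (u + v) w = dot u w + dot v w.
Proof. by rewrite -big_split; apply: eq_bigr => i _; rewrite mxE mulrDl. Qed.

Lemma dotZl a u v : dot (a *: u) v = a * dot u v.
Proof. by rewrite /dot mulr_sumr; apply: eq_bigr => i _; rewrite mxE mulrA. Qed.

Lemma dotDr u v w : dot u (v + w) = dot u v + dot u w.
Proof. by rewrite dotC dotDl !(dotC u). Qed.

Lemma dotZr a u v : dot u (a *: v) = a * dot u v.
Proof. by rewrite dotC dotZl dotC. Qed.

Lemma dotNl u v : dot (- u) v = - dot u v.
Proof. by rewrite -scaleN1r dotZl mulN1r. Qed.

Lemma dotNr u v : dot u (- v) = - dot u v.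
Proof. by rewrite -scaleN1r dotZr mulN1r. Qed.

Lemma dot0l u : dot 0 u = 0.
Proof. by rewrite -(scale0r u) dotZl mul0r. Qed.

Lemma dot0r u : dot u 0 = 0.
Proof. by rewrite dotC dot0l. Qed.

Lemma dot_ge0 u : 0 <= dot u u.
Proof. by apply: sumr_ge0 => i _; rewrite -expr2 sqr_ge0. Qed.

Lemma sqr_enorm u : enorm u ^+ 2 = dot u u.
Proof. by rewrite sqr_sqrtr ?dot_ge0. Qed.

Lemma enorm_ge0 u : 0 <= enorm u.
Proof. exact: sqrtr_ge0. Qed.

Lemma enorm0 : enorm (0 : 'rV[R]_n) = 0.
Proof. by rewrite /enorm dot0l sqrtr0. Qed.

Lemma enorm_eq0 u : (enorm u == 0) = (u == 0).
Proof.
apply/idP/eqP => [|->]; last by rewrite enorm0.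
rewrite sqrtr_eq0 => du; have /eqP : dot u u = 0.
  by apply/eqP; rewrite eq_le du dot_ge0.
rewrite psumr_eq0; last by move=> i _; rewrite -expr2 sqr_ge0.
move=> /allP u0; apply/rowP => i; rewrite mxE.
have := u0 i (mem_index_enum i); rewrite /= -expr2 sqrf_eq0.
by move/eqP.
Qed.

Lemma enormZ a u : enorm (a *: u) = `|a| * enorm u.
Proof.
by rewrite /enorm dotZl dotZr mulrA -expr2 sqrtrM ?sqr_ge0// sqrtr_sqr.
Qed.

Lemma enormN u : enorm (- u) = enorm u.
Proof. by rewrite -scaleN1r enormZ normrN1 mul1r. Qed.

Lemma dot_le u v : dot u v <= enorm u * enorm v.
Proof.
have [->|u0] := eqVneq u 0; first by rewrite dot0l enorm0 mul0r.
have [->|v0] := eqVneq v 0; first by rewrite dot0r enorm0 mulr0.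
have eu : 0 < enorm u by rewrite lt_def enorm_eq0 u0 enorm_ge0.
have ev : 0 < enorm v by rewrite lt_def enorm_eq0 v0 enorm_ge0.
have := dot_ge0 (enorm v *: u - enorm u *: v).
rewrite !(dotDl, dotDr, dotNl, dotNr, dotZl, dotZr) -!sqr_enorm (dotC v u) => h.
rewrite -(ler_pM2l (mulr_gt0 eu ev)); nra.
Qed.

Lemma normr_dot_le u v : `|dot u v| <= enorm u * enorm v.
Proof.
by rewrite ler_norml dot_le andbT lerNl -dotNl (le_trans (dot_le _ _))// enormN.
Qed.

Lemma enormD u v : enorm (u + v) <= enorm u + enorm v.
Proof.
rewrite -(@ler_pXn2r _ 2)// ?nnegrE ?addr_ge0 ?enorm_ge0//.
rewrite sqr_enorm !(dotDl, dotDr) -!sqr_enorm (dotC v u).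
have := dot_le u v; nra.
Qed.

Lemma coord_le_enorm u i : `|u 0 i| <= enorm u.
Proof.
rewrite -(@ler_pXn2r _ 2)// ?nnegrE ?enorm_ge0// sqr_enorm -normrX.
rewrite ger0_norm ?sqr_ge0// /dot (bigD1 i)//= -expr2 lerDl.
by apply: sumr_ge0 => j _; rewrite -expr2 sqr_ge0.
Qed.

Lemma enorm_le_sum u : enorm u <= \sum_i `|u 0 i|.
Proof.
have s0 : 0 <= \sum_i `|u 0 i| by exact: sumr_ge0.
rewrite -(@ler_pXn2r _ 2)// ?nnegrE ?enorm_ge0// sqr_enorm expr2 mulr_suml.
apply: ler_sum => i _; rewrite (le_trans (ler_norm _))// normrM ler_wpM2l// (bigD1 i)//= lerDl.
exact: sumr_ge0.
Qed.

(** Radial power: directions are kept and norms are raised to the power s. For s > 0 these maps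
    compose by multiplying exponents ([pwM]), so that those of exponents s and 1/s are inverse to
    each other. *)
Definition pw (s : R) v := enorm v `^ (s - 1) *: v.

Lemma enorm_pw s v : 0 < s -> enorm (pw s v) = enorm v `^ s.
Proof.
move=> s0; rewrite enormZ ger0_norm ?powR_ge0// mulrC mulr_powRB1//.
exact: enorm_ge0.
Qed.

Lemma pw0 s : pw s 0 = 0.
Proof. by rewrite /pw scaler0. Qed.

Lemma pw1 v : pw 1 v = v.
Proof. by rewrite /pw subrr powRr0 scale1r. Qed.

Lemma pwM s r v : 0 < s -> 0 < r -> pw s (pw r v) = pw (s * r) v.
Proof.
move=> s0 r0; have [->|v0] := eqVneq v 0; first by rewrite !pw0.
rewrite {1}/pw enorm_pw// /pw scalerA -powRrM -powRD; last first.
  by rewrite enorm_eq0 v0 implybT.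
by congr (_ `^ _ *: _); ring.
Qed.

Lemma dot_pwl s u v : dot (pw s u) v = enorm u `^ (s - 1) * dot u v.
Proof. by rewrite /pw dotZl. Qed.

Lemma dot_pwr s u v : dot u (pw s v) = enorm v `^ (s - 1) * dot u v.
Proof. by rewrite /pw dotZr. Qed.

End Euclidean.

Section conjugate.
Context {R : realType} {n : nat}.
Implicit Types (p : R) (u v : 'rV[R]_n).

Lemma weighted_AGM (s x y : R) : 0 <= s <= 1 -> 0 <= x -> 0 <= y ->
  x `^ s * y `^ (1 - s) <= s * x + (1 - s) * y.
Proof.
move=> /andP[s0 s1] x0 y0.
have [->|sn0] := eqVneq s 0.
  by rewrite powRr0 mul1r subr0 mul0r add0r mul1r powRr1.
have [->|sn1] := eqVneq s 1.
  by rewrite subrr powRr0 mulr1 mul0r addr0 mul1r powRr1.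
have sp : 0 < s by rewrite lt_def sn0.
have sq : 0 < 1 - s by rewrite subr_gt0 lt_def eq_sym sn1.
have := @conjugate_powR R (x `^ s) (y `^ (1 - s)) s^-1 (1 - s)^-1.
rewrite !invr_gt0 !invrK -!powRrM !divff ?gt_eqF// !powRr1// => h.
by rewrite (mulrC s) (mulrC (1 - s)); apply: h; rewrite ?powR_ge0//; ring.
Qed.

Lemma powR_sqr (x r : R) : 0 <= x -> (x ^+ 2) `^ r = x `^ (2 * r).
Proof. by move=> x0; rewrite -powR_mulrn// -powRrM. Qed.

(* Kittaneh and Manasrah's refinement of the weighted AM-GM inequality. *)
Lemma refined_AGM (s a b : R) : 0 < s < 1 -> 0 <= a -> 0 <= b ->
  Num.min s (1 - s) * (a - b) ^+ 2 <=
    s * a ^+ 2 + (1 - s) * b ^+ 2 - a `^ (2 * s) * b `^ (2 * (1 - s)).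
Proof.
wlog s12 : s a b / s <= 2^-1.
  move=> wl s01 a0 b0; have [/wl|s2] := leP s 2^-1; first exact.
  have := wl (1 - s) b a; rewrite (_ : 1 - (1 - s) = s); last by ring.
  rewrite minC -sqrrN opprB [_ * b ^+ 2 + _]addrC (mulrC (b `^ _)) => h.
  by apply: h => //; [lra|move: s01 => /andP[? ?]; apply/andP; split; lra].
move=> /andP[s0 s1] a0 b0.
rewrite min_l; last by lra.
(* Subtracting s (a - b)^2 from s a^2 + (1 - s) b^2 leaves (1 - 2s) b^2 + 2s ab, and the weighted
   inequality bounds this below by the same product of powers. *)
have := @weighted_AGM (1 - 2 * s) (b ^+ 2) (a * b).
rewrite powRM// powR_sqr// subKr.
have -> : b `^ (2 * (1 - 2 * s)) * (a `^ (2 * s) * b `^ (2 * s)) =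
          a `^ (2 * s) * b `^ (2 * (1 - s)).
  have [->|bn0] := eqVneq b 0.
    by rewrite (@powR0 _ (2 * s)) ?(@powR0 _ (2 * (1 - s))) ?mulr0//;
      apply/eqP; lra.
  rewrite mulrCA; congr (_ * _); rewrite -powRD ?bn0 ?implybT//.
  by congr (_ `^ _); ring.
move=> h; have {}h := h _ (sqr_ge0 _) (mulr_ge0 a0 b0).
by have : 0 <= 1 - 2 * s <= 1 by [apply/andP; split; lra] => /h; nra.
Qed.

(* The maximiser of [z |-> dot z u - enorm z `^ p]. *)
Definition legendre p u := pw (p - 1)^-1 (p^-1 *: u).

(** The maximiser in the variable that turns |z|^p into a square: its squared norm is the p-th power
    of the norm of [legendre p u]. *)
Definition half_power p u := pw (p / 2) (legendre p u).

(** Legendre conjugate of |z|^p: at the maximiser z the product dot z u equals p |z|^p, which leaves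
    (p - 1) |z|^p. *)
Definition conj_power p u := (p - 1) * enorm (legendre p u) `^ p.

Lemma sqr_enorm_half_power p u : 1 < p ->
  enorm (half_power p u) ^+ 2 = enorm (legendre p u) `^ p.
Proof.
move=> p1; rewrite enorm_pw; last lra.
by rewrite -powR_mulrn ?powR_ge0// -powRrM; congr (_ `^ _); field.
Qed.

Lemma legendre_half_power p u : 1 < p ->
  legendre p u = pw (2 / p) (half_power p u).
Proof.
move=> p1; rewrite pwM; [|by rewrite divr_gt0//; lra|lra].
by rewrite (_ : _ * _ = 1) ?pw1//; field; lra.
Qed.

(** First-order condition: u is the gradient p |z|^(p-2) z of |z|^p at the maximiser z. *)
Lemma legendreK p u : 1 < p -> u = p *: pw (p - 1) (legendre p u).
Proof.
move=> p1; rewrite pwM ?invr_gt0; [|lra|lra].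
by rewrite divff ?pw1 ?scalerA ?divff ?scale1r//; apply/eqP; lra.
Qed.

Lemma legendre_surj p v : 1 < p -> legendre p (p *: pw (p - 1) v) = v.
Proof.
move=> p1; rewrite /legendre scalerA mulVf ?scale1r; last by apply/eqP; lra.
rewrite pwM ?invr_gt0; [|lra|lra].
by rewrite mulVf ?pw1//; apply/eqP; lra.
Qed.

Lemma dot_legendre p u : 1 < p ->
  dot (legendre p u) u = p * enorm (legendre p u) `^ p.
Proof.
move=> p1; rewrite {2}(legendreK p u p1) dotZr dot_pwr -sqr_enorm.
congr (_ * _); rewrite -powR_mulrn ?enorm_ge0//.
have [e0|e0] := eqVneq (enorm (legendre p u)) 0.
  by rewrite e0 !(@powR0 _ p, @powR0 _ 2) ?mulr0//; apply/eqP; lra.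
by rewrite -powRD ?e0 ?implybT//; congr (_ `^ _); ring.
Qed.

Lemma half_powerK p u : 1 < p ->
  u = p *: pw (2 * ((p - 1) / p)) (half_power p u).
Proof.
move=> p1; rewrite {1}(legendreK p u p1) legendre_half_power// pwM; last 2 first.
- by lra.
- by rewrite divr_gt0//; lra.
by congr (_ *: pw _ _); field; lra.
Qed.

(** Put s = (p - 1) / p and k = c / p. Divided by p, the claim is k (x^2 + y^2 - 2d) <= s x^2 + (1 -
    s) y^2 - K d, where K x y = x^(2s) y^(2(1-s)). It is affine in d, so only d = xy and d = -xy
    matter: the first case is [refined_AGM], the second follows from 2k <= s and 2k <= 1 - s. *)
Lemma bregman_scalar p (c x y d : R) : 1 < p ->
  0 <= c -> 2 * c <= 1 -> 2 * c <= p - 1 ->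
  0 <= x -> 0 <= y -> - (x * y) <= d <= x * y ->
  c * (x ^+ 2 + y ^+ 2 - 2 * d) <= y ^+ 2 + (p - 1) * x ^+ 2 -
    p * (x `^ (2 * ((p - 1) / p) - 1) * (y `^ (2 / p - 1) * d)).
Proof.
move=> p1 c0 c1 cp x0 y0 /andP[dl dr].
set s := (p - 1) / p; set k := c / p.
have p0 : 0 < p by lra.
have s01 : 0 < s < 1.
  by rewrite /s divr_gt0/= ?ltr_pdivrMr ?mul1r//; lra.
have /andP[s0 s1] := s01.
have -> : 2 / p - 1 = 2 * (1 - s) - 1 by rewrite /s; field; lra.
have ks : 2 * k <= s by rewrite /k /s mulrA ler_pM2r ?invr_gt0.
have k1s : 2 * k <= 1 - s.
  rewrite (_ : 1 - s = 1 / p); last by rewrite /s; field; lra.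
  by rewrite /k mulrA ler_pM2r ?invr_gt0.
have k0 : 0 <= k by rewrite divr_ge0// ltW.
have cE : c = p * k by rewrite /k; field; lra.
have pE : p - 1 = p * s by rewrite /s; field; lra.
have pE' : 1 = p * (1 - s) by rewrite /s; field; lra.
have Kxy : x `^ (2 * s) * y `^ (2 * (1 - s)) =
           (x `^ (2 * s - 1) * y `^ (2 * (1 - s) - 1)) * (x * y).
  have /(mulr_powRB1 x0) <- : 0 < 2 * s by lra.
  have /(mulr_powRB1 y0) <- : 0 < 2 * (1 - s) by lra.
  by move: (x `^ _) (y `^ _) => X Y; ring.
have K0 : 0 <= x `^ (2 * s - 1) * y `^ (2 * (1 - s) - 1).
  by rewrite mulr_ge0 ?powR_ge0.
have AGM P : x `^ (2 * s) * y `^ (2 * (1 - s)) = P ->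
    Num.min s (1 - s) * (x - y) ^+ 2 <= s * x ^+ 2 + (1 - s) * y ^+ 2 - P.
  by move=> <-; exact: refined_AGM.
have {AGM Kxy} := AGM _ Kxy; rewrite (mulrA (x `^ _) (y `^ _) d).
move: K0; set K := x `^ _ * y `^ _; move: K => K K0.
have : 2 * k <= Num.min s (1 - s) by rewrite le_min ks k1s.
set m := Num.min _ _; move: m => m mk H.
have {H mk}H : 2 * k * (x - y) ^+ 2 <=
    s * x ^+ 2 + (1 - s) * y ^+ 2 - K * (x * y).
  by apply: le_trans H; rewrite ler_wpM2r// sqr_ge0.
suff : k * (x ^+ 2 + y ^+ 2 - 2 * d) <= (1 - s) * y ^+ 2 + s * x ^+ 2 - K * d.
  rewrite -(ler_pM2l p0) => h.
  rewrite cE pE -[y ^+ 2 in leRHS]mul1r {2}pE'.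
  by lra.
have kxy : 0 <= k * (x - y) ^+ 2 by rewrite mulr_ge0 ?sqr_ge0.
(* The sign of K - 2k tells which end of the range of d is the worst. *)
have [kK|Kk] := leP (2 * k) K.
  have : (K - 2 * k) * d <= (K - 2 * k) * (x * y) by rewrite ler_wpM2l// subr_ge0.
  by lra.
have : (2 * k - K) * - (x * y) <= (2 * k - K) * d.
  by rewrite ler_wpM2l// subr_ge0 ltW.
have : 0 <= (s - 2 * k) * x ^+ 2 by rewrite mulr_ge0 ?sqr_ge0// subr_ge0.
have : 0 <= (1 - s - 2 * k) * y ^+ 2 by rewrite mulr_ge0 ?sqr_ge0// subr_ge0.
have : 0 <= K * (x * y) by rewrite !mulr_ge0.
by lra.
Qed.

(** The right side is the gap in the Fenchel-Young inequality. In the variable [half_power] both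
    powers are squares and the product is a multiple of one inner product, so only two norms and
    that inner product enter. The constant c is the same for all p with p - 1 >= 2c. *)
Lemma bregman_ge p (c : R) u v :
  1 < p -> 0 <= c -> 2 * c <= 1 -> 2 * c <= p - 1 ->
  c * enorm (half_power p u - half_power p v) ^+ 2 <=
    enorm (legendre p v) `^ p + conj_power p u - dot (legendre p v) u.
Proof.
move=> p1 c0 c1 cp; rewrite /conj_power -!sqr_enorm_half_power//.
rewrite {3}(half_powerK p u p1) legendre_half_power//.
move: (half_power p u) (half_power p v) => a b.
rewrite dotZr dot_pwl dot_pwr (dotC b a) (mulrCA (_ `^ _)).
rewrite (sqr_enorm (a - b)) !(dotDl, dotDr, dotNl, dotNr) -!sqr_enorm (dotC b a).
have := normr_dot_le a b; rewrite ler_norml => dle.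
have := bregman_scalar p c _ _ _ p1 c0 c1 cp (enorm_ge0 a) (enorm_ge0 b) dle.
apply: le_trans; rewrite le_eqVlt; apply/orP; left; apply/eqP; congr (_ * _).
by ring.
Qed.

(** The case c = 0 of [bregman_ge], since every v is a value of [legendre]. *)
Lemma fenchel_young p u v : 1 < p ->
  dot v u <= enorm v `^ p + conj_power p u.
Proof.
move=> p1; have := @bregman_ge p 0 u (p *: pw (p - 1) v) p1 (lexx _).
by rewrite legendre_surj// mul0r subr_ge0 mulr0 ler01 subr_ge0 (ltW p1); exact.
Qed.

Lemma conj_power_ge0 p u : 1 < p -> 0 <= conj_power p u.
Proof. by move=> p1; rewrite mulr_ge0 ?powR_ge0// subr_ge0 ltW. Qed.

End conjugate.

Set Implicit Arguments.
Unset Strict Implicit.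
Unset Printing Implicit Defensive.

Section vector_calculus.
Context {R : realType} {n : nat}.
Implicit Types (u v : 'rV[R]_n).

Lemma mx_norm_le_enorm v : `|v| <= enorm v.
Proof.
rewrite /Num.Def.normr/= mx_normrE; apply: bigmax_le => [|i _].
  exact: enorm_ge0.
by rewrite (ord1 i.1) coord_le_enorm.
Qed.

Lemma enorm_le_mx_norm v : enorm v <= n%:R * `|v|.
Proof.
apply: (le_trans (enorm_le_sum v)).
rewrite mulr_natl -[X in _ *+ X]card_ord -sumr_const; apply: ler_sum => i _.
rewrite /Num.Def.normr/= mx_normrE.
exact: (le_bigmax _ (fun i : 'I_1 * 'I_n => `|v i.1 i.2|) (0, i)).
Qed.

Lemma coordB u v i : (u - v) 0 i = u 0 i - v 0 i.
Proof. by rewrite !mxE. Qed.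

Lemma cvg_dot (T : Type) (F : set_system T) (FF : Filter F)
    (f g : T -> 'rV[R]_n) u v :
  f @ F --> u -> g @ F --> v -> dot (f x) (g x) @[x --> F] --> dot u v.
Proof.
move=> fu gv; rewrite /dot.
apply: cvg_big => [|i _]; first exact: add_continuous.
apply: cvgM.
  exact: (continuous_cvg _ (@coord_continuous R 1 n 0 i u) fu).
exact: (continuous_cvg _ (@coord_continuous R 1 n 0 i v) gv).
Qed.

Lemma cvg_row (T : Type) (F : set_system T) (FF : Filter F)
    (f : T -> 'rV[R]_n) v :
  (forall i, f x 0 i @[x --> F] --> v 0 i) -> f @ F --> v.
Proof.
move=> fv; apply/subr_cvg0; apply: norm_cvg0.
apply: (@squeeze_cvgr _ _ _ _ (cst 0) (fun x => \sum_i `|(f x - v) 0 i|)).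
- by apply: nearW => x; rewrite normr_ge0/= (le_trans (mx_norm_le_enorm _))// enorm_le_sum.
- exact: cvg_cst.
rewrite [X in _ --> X](_ : (0 : R) = \sum_(i < n) 0); last by rewrite big1.
apply: (@cvg_big _ _ +%R 0 xpredT (@add_continuous _)) => i _.
rewrite -(@normr0 _ R); apply: cvg_norm; under eq_cvg do rewrite !mxE.
by apply/subr_cvg0; exact: fv.
Qed.

Lemma continuous_enorm : continuous (@enorm R n).
Proof.
move=> v.
apply: (@continuous_cvg _ _ _ (nbhs v) _ (fun u => dot u u) (@Num.sqrt R)).
  exact: sqrt_continuous.
by apply: cvg_dot; exact: cvg_id.
Qed.

Lemma continuous_pw (s : R) : 0 < s -> continuous (@pw R n s).
Proof.
move=> s0 v; have [->|v0] := eqVneq v 0.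
  suff : pw s x @[x --> nbhs (0 : 'rV[R]_n)] --> (0 : 'rV[R]_n).
    by rewrite /continuous_at pw0.
  apply/cvgr0Pnorm_lt => e e0.
  have d0 : 0 < e `^ s^-1 by rewrite powR_gt0.
  have : enorm u @[u --> nbhs (0 : 'rV[R]_n)] --> (0 : R).
    by rewrite -[X in _ --> X](@enorm0 R n); exact: continuous_enorm.
  move=> /cvgr0Pnorm_lt/(_ _ d0).
  apply: filterS => u; rewrite (ger0_norm (enorm_ge0 u)) => ud.
  apply: (le_lt_trans (mx_norm_le_enorm _)); rewrite enorm_pw//.
  have -> : e = (e `^ s^-1) `^ s.
    by rewrite -powRrM mulVf ?lt0r_neq0// powRr1// ltW.
  by apply: gt0_ltr_powR; rewrite ?nnegrE ?enorm_ge0 ?powR_ge0.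
have ev : 0 < enorm v by rewrite lt_def enorm_eq0 v0 enorm_ge0.
apply: (@cvgZ _ _ _ (nbhs v) _ (fun u => enorm u `^ (s - 1)) id) => //.
have cp : {for enorm v, continuous (fun a : R => a `^ (s - 1))}.
  apply/differentiable_continuous/derivable1_diffP/derivable_powR.
  by rewrite in_itv/= ev.
exact: (cvg_comp _ _ (@continuous_enorm v) cp).
Qed.

Lemma continuous_legendre (p : R) : 1 < p -> continuous (@legendre R n p).
Proof.
move=> p1 v.
apply: (@continuous_cvg _ _ _ (nbhs v) _ (fun u => p^-1 *: u) (pw _)).
  by apply: continuous_pw; rewrite invr_gt0 subr_gt0.
exact: scaler_continuous.
Qed.

End vector_calculus.

(** * Measurability and integration *)

Section measurability.
Context {R : realType} {n : nat} d {T : measurableType d}.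

Definition measurable_field (D : set T) (f : T -> 'rV[R]_n) :=
  forall i, measurable_fun D (fun x => f x 0 i).

Lemma measurable_field_dot D (f g : T -> 'rV[R]_n) :
  measurable_field D f -> measurable_field D g ->
  measurable_fun D (fun x => dot (f x) (g x)).
Proof.
by move=> mf mg; apply: measurable_sum => i; exact: measurable_funM.
Qed.

Lemma measurable_fun_powR D (f g : T -> R) : measurable D ->
  measurable_fun D f -> measurable_fun D g ->
  measurable_fun D (fun x => f x `^ g x).
Proof.
move=> mD mf mg; rewrite /powR; apply: measurable_fun_if => //.
- by apply: measurable_fun_eqr.
- apply: (@measurableT_comp _ _ _ _ _ _ (fun b : bool => b%:R : R)) => //.
  apply: measurable_fun_eqr => //.
  by apply: (measurable_funS mD _ mg); exact: subIsetl.
- apply: (measurable_funS mD (@subIsetl _ _ _)).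
  apply: measurableT_comp => //; apply: measurable_funM => //.
  exact: measurableT_comp.
Qed.

Lemma measurable_enorm D (f : T -> 'rV[R]_n) : measurable D ->
  measurable_field D f -> measurable_fun D (fun x => enorm (f x)).
Proof.
move=> mD mf; apply: (eq_measurable_fun (fun x => dot (f x) (f x) `^ 2^-1)).
  by move=> x _; rewrite powR12_sqrt// dot_ge0.
by apply: measurable_fun_powR => //; exact: measurable_field_dot.
Qed.

Lemma measurable_fieldZ D (c : T -> R) (f : T -> 'rV[R]_n) :
  measurable_fun D c -> measurable_field D f ->
  measurable_field D (fun x => c x *: f x).
Proof.
move=> mc mf i; apply: (eq_measurable_fun (fun x => c x * f x 0 i)).
  by move=> x _; rewrite mxE.
exact: measurable_funM.
Qed.

Lemma measurable_fieldD D (f g : T -> 'rV[R]_n) :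
  measurable_field D f -> measurable_field D g ->
  measurable_field D (fun x => f x + g x).
Proof.
move=> mf mg i; apply: (eq_measurable_fun (fun x => f x 0 i + g x 0 i)).
  by move=> x _; rewrite mxE.
exact: measurable_funD.
Qed.

Lemma measurable_fun_inv D (f : T -> R) : measurable D ->
  (forall x, D x -> 0 < f x) -> measurable_fun D f ->
  measurable_fun D (fun x => (f x)^-1).
Proof.
move=> mD f0 mf; apply: (eq_measurable_fun (fun x => f x `^ -1)).
  by move=> x; rewrite inE => Dx; rewrite powR_inv1// ltW// f0.
exact: measurable_fun_powR.
Qed.

Lemma measurable_field_pw D (s : T -> R) (f : T -> 'rV[R]_n) : measurable D ->
  measurable_fun D s -> measurable_field D f ->
  measurable_field D (fun x => pw (s x) (f x)).
Proof.
move=> mD ms mf; apply: measurable_fieldZ => //.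
apply: measurable_fun_powR => //; first exact: measurable_enorm.
exact: measurable_funB.
Qed.

Lemma measurable_field_legendre D (p : T -> R) (f : T -> 'rV[R]_n) :
  measurable D -> (forall x, D x -> 1 < p x) ->
  measurable_fun D p -> measurable_field D f ->
  measurable_field D (fun x => legendre (p x) (f x)).
Proof.
move=> mD p1 mp mf; apply: measurable_field_pw => //.
  apply: measurable_fun_inv => // [x Dx|]; first by rewrite subr_gt0 p1.
  exact: measurable_funB.
apply: measurable_fieldZ => //; apply: measurable_fun_inv => // x Dx.
exact: lt_trans (p1 _ Dx).
Qed.

Lemma measurable_conj_power D (p : T -> R) (f : T -> 'rV[R]_n) :
  measurable D -> (forall x, D x -> 1 < p x) ->
  measurable_fun D p -> measurable_field D f ->
  measurable_fun D (fun x => conj_power (p x) (f x)).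
Proof.
move=> mD p1 mp mf; apply: measurable_funM; first exact: measurable_funB.
apply: measurable_fun_powR => //; apply: measurable_enorm => //.
exact: measurable_field_legendre.
Qed.

End measurability.

Section integration.
Context {R : realType} d {X : measurableType d}.
Variable M : {finite_measure set X -> \bar R}.

Lemma bounded_integrable (f : X -> R) (B : R) :
  measurable_fun setT f -> (forall x, `|f x| <= B) ->
  M.-integrable setT (EFin \o f).
Proof.
move=> mf fB; apply: measurable_bounded_integrable => //.
  by rewrite ltey_eq fin_num_measure.
by exists B; split; [exact: num_real|move=> y By x _; exact: le_trans (fB x) (ltW By)].
Qed.

Lemma le_integrable_EFin (f g : X -> R) : measurable_fun setT f ->
  (forall x, `|f x| <= g x) -> M.-integrable setT (EFin \o g) ->
  M.-integrable setT (EFin \o f).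
Proof.
move=> mf fg; apply: le_integrable => //; first exact/measurable_EFinP.
by move=> x _; rewrite /= lee_fin (le_trans (fg x))// ler_norm.
Qed.

Lemma integrableD_EFin (f g : X -> R) : M.-integrable setT (EFin \o f) ->
  M.-integrable setT (EFin \o g) -> M.-integrable setT (EFin \o (fun x => f x + g x)).
Proof. by move=> fi gi; exact: (integrableD _ fi gi). Qed.

Lemma integrableZ_EFin (a : R) (f : X -> R) : M.-integrable setT (EFin \o f) ->
  M.-integrable setT (EFin \o (fun x => a * f x)).
Proof. by move=> fi; exact: (integrableZl _ a fi). Qed.

Lemma dominated_Rintegral_cvg (f_ : nat -> X -> R) (f g : X -> R) :
  (forall k, measurable_fun setT (f_ k)) -> measurable_fun setT f ->
  {ae M, forall x, f_ ^~ x @ \oo --> f x} ->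
  M.-integrable setT (EFin \o g) ->
  {ae M, forall x k, `|f_ k x| <= g x} ->
  M.-integrable setT (EFin \o f) /\
  \int[M]_x f_ k x @[k --> \oo] --> \int[M]_x f x.
Proof.
move=> mf_ mf ff gi fg.
have [] := @dominated_convergence _ _ _ M _ measurableT
  (fun k => EFin \o f_ k) (EFin \o f) (EFin \o g).
- by move=> k; exact/measurable_EFinP.
- exact/measurable_EFinP.
- by apply: filterS ff => x fx _; apply: cvg_EFin => //; exact: nearW.
- exact: gi.
- by apply: filterS fg => x fx k _; rewrite /= lee_fin.
move=> fi _ cv; split => //.
apply: fine_cvg; rewrite fineK//; exact: integrable_fin_num.
Qed.

End integration.

Lemma lebesgue_measure01 (R : realType) :
  (lebesgue_measure (`[0%R, 1%R]%classic : set R) = 1)%E.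
Proof.
apply: etrans; first exact: lebesgue_measure_itv.
by rewrite /= lte_fin ltr01 oppr0 adde0.
Qed.

(** Linear arithmetic kept apart from integrals, here and in the next two lemmas. In this one t is
    the size of a perturbation, e the p-th power of the norm of [legendre] at the perturbed point,
    and w the conjugate at the unperturbed one. *)
Lemma gradient_arith (R : realFieldType) (P t a b e w : R) :
  t * a + b = P * e -> b <= e + w -> (P - 1) * e <= t * a + w.
Proof. lra. Qed.

Lemma maximality_arith (R : realFieldType) (K e t a b P Q F : R) :
  K - e < b - Q -> t * a + b - P <= K -> P <= t * F + Q -> t * a <= e + t * F.
Proof. lra. Qed.

Lemma midpoint_arith (R : realFieldType) (X P1 P0 Pm T1 T0 K e1 e0 : R) :
  X <= P1 + P0 + (- 2) * Pm -> 2^-1 * (T1 + T0) - Pm <= K ->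
  K - e1 < T1 - P1 -> K - e0 < T0 - P0 -> e1 <= e0 -> X <= 2 * e0.
Proof. lra. Qed.

(** * Fenchel duality *)

(* The minimum of the integral of Phi(x, J x), Phi(x, z) := |z|^p(x), under the
   constraints that [dot (G i) J] has integral [T i]. A maximising sequence of the
   dual problem is Cauchy in the variable [half_power], by the Bregman inequality. *)
Section duality.
Context {R : realType} {n : nat} d {X : measurableType d}.
Variable M : {finite_measure set X -> \bar R}.
Variables (p : X -> R) (pm pp : R).
Hypotheses (pm1 : 1 < pm) (mp : measurable_fun setT p)
  (p_bnd : forall x, pm <= p x <= pp).
Variables (I : Type) (i0 : I) (G : I -> X -> 'rV[R]_n) (T : I -> R) (c : R).
Hypotheses (mG : forall i, measurable_field setT (G i))
  (bG : forall i, exists B, forall x, enorm (G i x) <= B)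
  (linG : forall i j a, exists k,
     (forall x, G k x = a *: G i x + G j x) /\ T k = a * T i + T j).

Let p1 x : 1 < p x.
Proof. by have /andP[+ _] := p_bnd x; exact: lt_le_trans. Qed.

Let pm0 : 0 < pm. Proof. exact: lt_trans pm1. Qed.

Let Phi i x := conj_power (p x) (G i x).
Let A i x := half_power (p x) (G i x).

Let mA i : measurable_field setT (A i).
Proof.
apply: measurable_field_pw => //.
  by apply: measurable_funM => //; exact: measurable_cst.
exact: measurable_field_legendre.
Qed.

Let mPhi i : measurable_fun setT (Phi i).
Proof. exact: measurable_conj_power. Qed.

(** * Growth of the conjugate integrand, uniformly in the exponent *)

Let q := pm / (pm - 1).

Let q0 : 0 < q.
Proof. by rewrite divr_gt0 ?subr_gt0. Qed.

(** p / (p - 1) decreases in p, so the conjugate exponent of pm dominates all others. *)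
Let qle x : p x / (p x - 1) <= q.
Proof.
have /andP[px _] := p_bnd x; have := p1 x => p1x.
rewrite /q ler_pdivrMr ?subr_gt0// mulrAC ler_pdivlMr ?subr_gt0//; nra.
Qed.

Let enorm_legendre x (u : 'rV[R]_n) :
  enorm (legendre (p x) u) `^ p x = (enorm u / p x) `^ (p x / (p x - 1)).
Proof.
rewrite /legendre enorm_pw ?invr_gt0 ?subr_gt0// enormZ ger0_norm; last first.
  by rewrite invr_ge0 ltW// (lt_trans _ (p1 x)).
by rewrite [_^-1 * enorm u]mulrC -powRrM [_^-1 * p x]mulrC.
Qed.

Let legendre_le x (u : 'rV[R]_n) B : enorm u <= B ->
  enorm (legendre (p x) u) `^ p x <= (1 + B) `^ q.
Proof.
move=> uB; rewrite enorm_legendre.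
have B0 : 0 <= B := le_trans (enorm_ge0 u) uB.
have e0 : 0 <= p x / (p x - 1).
  by rewrite divr_ge0 ?subr_ge0 ?ltW// (lt_trans _ (p1 x)).
apply: (@le_trans _ _ ((1 + B) `^ (p x / (p x - 1)))).
  apply: ge0_ler_powR => //.
  - by rewrite nnegrE divr_ge0 ?enorm_ge0// ltW// (lt_trans _ (p1 x)).
  - by rewrite nnegrE addr_ge0.
  - rewrite ler_pdivrMr ?(lt_trans _ (p1 x))//.
    by rewrite (le_trans uB)// (le_trans (_ : _ <= 1 + B)) ?lerDr// ler_peMr ?addr_ge0// ltW.
by apply: ler_powR => //; rewrite lerDl.
Qed.

(** Doubling: u + v is at most twice as long as the longer of the two vectors, and the factor 2
    costs 2^(p/(p-1)) <= 2^q. This dominates the perturbed sequence in [euler_le]. *)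
Let legendreD_le x (u v : 'rV[R]_n) :
  enorm (legendre (p x) (u + v)) `^ p x <=
  2 `^ q * (enorm (legendre (p x) u) `^ p x + enorm (legendre (p x) v) `^ p x).
Proof.
have px0 : 0 < p x := lt_trans ltr01 (p1 x).
have e0 : 0 <= p x / (p x - 1) by rewrite divr_ge0 ?subr_ge0 ?ltW.
wlog uv : u v / enorm v <= enorm u.
  move=> wl; have [/wl //|/ltW/wl] := leP (enorm v) (enorm u).
  rewrite (addrC v u); move: (2 `^ q) (enorm (legendre (p x) (u + v)) `^ p x).
  move: (enorm (legendre (p x) u) `^ p x) (enorm (legendre (p x) v) `^ p x).
  by move=> b e t a; rewrite (addrC e b).
apply: (@le_trans _ _ (2 `^ q * enorm (legendre (p x) u) `^ p x)); last first.
  by rewrite ler_wpM2l ?powR_ge0// lerDl powR_ge0.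
rewrite !enorm_legendre.
apply: (@le_trans _ _ ((2 * (enorm u / p x)) `^ (p x / (p x - 1)))).
  apply: ge0_ler_powR => //.
  - by rewrite nnegrE divr_ge0 ?enorm_ge0// ltW.
  - by rewrite nnegrE mulr_ge0// divr_ge0 ?enorm_ge0// ltW.
  - rewrite mulrA ler_pM2r ?invr_gt0// (le_trans (enormD _ _))//.
    by rewrite mulrDl mul1r lerD2l.
rewrite powRM//; last by rewrite divr_ge0 ?enorm_ge0// ltW.
by rewrite ler_wpM2r ?powR_ge0// ler_powR// ler1n.
Qed.

Let Phi_sqr i x : Phi i x = (p x - 1) * enorm (A i x) ^+ 2.
Proof. by rewrite /Phi /conj_power sqr_enorm_half_power. Qed.

Let Phi_ge0 i x : 0 <= Phi i x.
Proof. exact: conj_power_ge0. Qed.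

Lemma integrable_conj_power i : M.-integrable setT (EFin \o Phi i).
Proof.
have [B GB] := bG i; apply: (@bounded_integrable _ _ _ _ _ (pp * (1 + B) `^ q)) => //.
move=> x; rewrite ger0_norm//; have /andP[_ pxp] := p_bnd x.
apply: ler_pM; rewrite ?powR_ge0 ?legendre_le//.
  by rewrite subr_ge0 ltW.
by rewrite lerBlDr (le_trans pxp)// lerDl.
Qed.

Let iPhi i : M.-integrable setT (EFin \o Phi i).
Proof. exact: integrable_conj_power. Qed.

(** * The dual problem and a maximising sequence *)

Hypothesis T_le : forall i, T i <= c + \int[M]_x Phi i x.

(** The dual functional, concave along the combinations that [linG] allows and bounded above by c
    through [T_le]. *)
Let K i := T i - \int[M]_x Phi i x.

Let kstar := sup (range K).

Let has_supK : has_sup (range K).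
Proof.
split; first by exists (K i0), i0.
by exists c => _ [i _ <-]; rewrite lerBlDr.
Qed.

Let K_le i : K i <= kstar.
Proof. by apply: sup_upper_bound => //; exists i. Qed.

(** Half of min(1, pm - 1) is the largest constant that [bregman_ge] admits for every exponent at
    least pm. *)
Let cb := Num.min 1 (pm - 1) / 2.

Let cb0 : 0 < cb.
Proof. by rewrite divr_gt0// lt_min ltr01 subr_gt0. Qed.

Let bregmanA x (u v : 'rV[R]_n) :
  cb * enorm (half_power (p x) u - half_power (p x) v) ^+ 2 <=
    enorm (legendre (p x) v) `^ p x + conj_power (p x) u - dot (legendre (p x) v) u.
Proof.
apply: bregman_ge; rewrite ?p1 ?(ltW cb0)// /cb mulrCA divff// mulr1.
  by rewrite ge_min lexx.
have /andP[px _] := p_bnd x.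
by rewrite ge_min lerD2r px orbT.
Qed.

(** Uniform convexity: the Bregman inequalities of i and j relative to the midpoint are added. Their
    linear terms sum to 2 dot L (G k) = 2 p |L|^p, which leaves the second difference of Phi. The
    factor 1/2 comes from |a - b|^2 <= 2 (|a - m|^2 + |b - m|^2). *)
Let midpoint i j x k : (forall y, G k y = 2^-1 *: G i y + 2^-1 *: G j y) ->
  cb / 2 * enorm (A i x - A j x) ^+ 2 <= Phi i x + Phi j x - 2 * Phi k x.
Proof.
move=> Gk.
have := bregmanA x (G i x) (G k x); have := bregmanA x (G j x) (G k x).
rewrite -/(A i x) -/(A j x) -/(A k x) -/(Phi i x) -/(Phi j x).
set L := legendre _ _.
have LGk : dot L (G i x) + dot L (G j x) = 2 * (p x * enorm L `^ p x).
  rewrite -dot_legendre// -/L Gk dotDr !dotZr -mulrDr mulrA divff ?mul1r//.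
have PhiL : Phi k x = (p x - 1) * enorm L `^ p x by [].
have par : enorm (A i x - A j x) ^+ 2 <=
    2 * (enorm (A i x - A k x) ^+ 2 + enorm (A j x - A k x) ^+ 2).
  have -> : A i x - A j x = (A i x - A k x) - (A j x - A k x).
    by rewrite opprB addrA subrK.
  have := enormD (A i x - A k x) (- (A j x - A k x)); rewrite enormN.
  have := enorm_ge0 ((A i x - A k x) - (A j x - A k x)).
  set a := enorm _; set b := enorm _; set e := enorm _; move: a b e => a b e.
  by move=> a0 abe; have := sqr_ge0 (b - e); nra.
move: PhiL LGk par; move: (dot L _) (dot L _) => Li Lj.
move: (enorm L `^ _) (Phi k x) => l f ->.
move: (enorm (A i x - A j x) ^+ 2) (enorm (A i x - A k x) ^+ 2).
move: (enorm (A j x - A k x) ^+ 2) (Phi i x) (Phi j x).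
move=> e Fi Fj a b LE par bj bi.
have : cb * a <= cb * (2 * (b + e)) by rewrite ler_pM2l.
by move: (cb) bj bi LE => cb'; lra.
Qed.

(** The factor cb / 4 makes the integral of [D k] at most 8^-k. The rate 8 pays both for the weights
    4^k in [H] and for the division by a step 2^-k in [euler_le]. *)
Let eps (k : nat) : R := cb / 4 * 8 ^- k.

Let eps_gt0 k : 0 < eps k.
Proof. by apply: divr_gt0; [exact: divr_gt0|exact: exprn_gt0]. Qed.

Let ex_i k : exists i, kstar - eps k < K i.
Proof.
by have [_ [i _ <-] Ki] := sup_adherent (eps_gt0 k) has_supK; exists i.
Qed.

Let i_ k : I := projT1 (cid (ex_i k)).

Let i_P k : kstar - eps k < K (i_ k).
Proof. exact: projT2 (cid (ex_i k)). Qed.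

Let D k x := enorm (A (i_ k.+1) x - A (i_ k) x) ^+ 2.

Let mD k : measurable_fun setT (D k).
Proof.
apply: measurable_funX; apply: measurable_enorm => // i.
apply: (eq_measurable_fun (fun x => A (i_ k.+1) x 0 i - A (i_ k) x 0 i)).
  by move=> x _; rewrite !mxE.
by apply: measurable_funB; exact: mA.
Qed.

Let intD k : (\int[M]_x (D k x)%:E <= (8 ^- k)%:E)%E.
Proof.
(* [linG] only yields a G i + G j: here j indexes the sum, z the zero field and m the midpoint. *)
have [j [Gj Tj]] := linG (i_ k.+1) (i_ k) 1.
have [z [Gz Tz]] := linG (i_ k) (i_ k) (-1).
have [m [Gm Tm]] := linG j z (2^-1).
have Gm' y : G m y = 2^-1 *: G (i_ k.+1) y + 2^-1 *: G (i_ k) y.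
  by rewrite Gm Gj Gz scale1r scaleN1r addNr addr0 scalerDr.
have Tm' : T m = 2^-1 * (T (i_ k.+1) + T (i_ k)).
  by rewrite Tm Tj Tz mul1r mulN1r addNr addr0.
have le1 x : cb / 2 * D k x <= Phi (i_ k.+1) x + Phi (i_ k) x - 2 * Phi m x.
  exact: midpoint.
have i1 := integrableD_EFin (iPhi (i_ k.+1)) (iPhi (i_ k)).
have i2 : M.-integrable setT
    (EFin \o (fun x => Phi (i_ k.+1) x + Phi (i_ k) x + (- 2) * Phi m x)).
  exact: (integrableD_EFin i1 (integrableZ_EFin (- 2) (iPhi m))).
have i3 : M.-integrable setT (EFin \o (fun x => cb / 2 * D k x)).
  apply: le_integrable_EFin i2; first by apply: measurable_funM.
  move=> x; rewrite ger0_norm; last by rewrite mulr_ge0 ?sqr_ge0// ltW// divr_gt0.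
  by rewrite mulNr; exact: le1.
have iD : M.-integrable setT (EFin \o D k).
  have := integrableZ_EFin (2 / cb) i3; apply: eq_integrable => // x _ /=.
  by rewrite mulrA; congr (_%:E); field; rewrite gt_eqF.
have : \int[M]_x (cb / 2 * D k x) <=
    \int[M]_x (Phi (i_ k.+1) x + Phi (i_ k) x + (- 2) * Phi m x).
  by apply: le_Rintegral => // x _; rewrite mulNr; exact: le1.
have rE : \int[M]_x (Phi (i_ k.+1) x + Phi (i_ k) x + (- 2) * Phi m x) =
    \int[M]_x Phi (i_ k.+1) x + \int[M]_x Phi (i_ k) x + (- 2) * \int[M]_x Phi m x.
  rewrite (RintegralD measurableT i1 (integrableZ_EFin (- 2) (iPhi m))).
  congr (_ + _); last exact: (RintegralZl (- 2) measurableT (iPhi m)).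
  exact: (RintegralD measurableT (iPhi (i_ k.+1)) (iPhi (i_ k))).
rewrite (RintegralZl (cb / 2) measurableT iD) [X in _ <= X]rE => le2.
have := i_P k; have := i_P k.+1; have := K_le m; rewrite /K Tm' => h1 h2 h3.
have e1 : eps k.+1 <= eps k.
  rewrite /eps -!exprVn exprS; apply: ler_wpM2l; first by rewrite ltW// divr_gt0.
  by rewrite ler_piMl ?exprn_ge0 ?invr_ge0// invf_le1// ler1n.
have : \int[M]_x D k x <= 8 ^- k.
  have : cb / 2 * \int[M]_x D k x <= 2 * eps k.
    exact: (midpoint_arith le2 h1 h2 h3 e1).
  rewrite /eps mulrA (_ : 2 * (cb / 4) = cb / 2); last by field.
  by rewrite ler_pM2l// divr_gt0.
by rewrite -lee_fin fineK// integrable_fin_num.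
Qed.

(** The weights 4^k are summable against 8^-k, so H is integrable. Where it is finite, consecutive
    terms differ by at most sqrt(H) 2^-k: the whole sequence converges there, without passing to a
    subsequence, and H provides the dominating function as well. *)
Let H x : \bar R := (\sum_(0 <= k <oo) (4 ^+ k * D k x)%:E)%E.

Let HT0 k x : (0 <= (4 ^+ k * D k x)%:E)%E.
Proof.
rewrite lee_fin; apply: mulr_ge0; [exact: exprn_ge0|exact: sqr_ge0].
Qed.

Let mHT k : measurable_fun setT (fun x => (4 ^+ k * D k x)%:E).
Proof. by apply/measurable_EFinP; exact: measurable_funM. Qed.

Let mH : measurable_fun setT H.
Proof. exact: (@ge0_emeasurable_sum _ _ _ _ (fun k x => (4 ^+ k * D k x)%:E) xpredT). Qed.

Let H0 x : (0 <= H x)%E.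
Proof. by apply: nneseries_ge0 => k _ _; exact: HT0. Qed.

Let intH : (\int[M]_x H x <= 2%:E)%E.
Proof.
rewrite /H integral_nneseries//.
apply: lime_le; first by apply: is_cvg_nneseries => k _ _; apply: integral_ge0 => x _; exact: HT0.
apply: nearW => m; rewrite big_mkord.
(* A finite geometric sum together with its remainder, which keeps every partial sum below 2. *)
suff -> : (2 : R)%:E = (((2 : R) * 2 ^- m)%:E + \sum_(k < m) ((2 : R) ^- k)%:E)%E.
  rewrite -[leLHS]add0e; apply: leeD; first by rewrite lee_fin mulr_ge0 ?invr_ge0 ?exprn_ge0.
  apply: lee_sum => k _; under eq_integral do rewrite EFinM.
  rewrite ge0_integralZl//; last 2 first.
  - exact/measurable_EFinP.
  - by move=> x _; rewrite lee_fin sqr_ge0.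
  apply: (@le_trans _ _ ((4 ^+ k)%:E * (8 ^- k)%:E)%E).
    by apply: lee_wpmul2l; [rewrite lee_fin exprn_ge0|exact: intD].
  rewrite -EFinM lee_fin (_ : 8 = 4 * 2 :> R); last by ring.
  by rewrite exprMn invfM mulrA divff ?mul1r// expf_neq0.
elim: m => [|m IH]; first by rewrite big_ord0 adde0 expr0 invr1 mulr1.
rewrite big_ord_recr/= [X in (_ + X)%E]addeC addeA -EFinD {1}IH.
by congr (_%:E + _)%E; rewrite exprS invfM mulrA divff// mul1r mulr_natl mulr2n.
Qed.

Let iH : M.-integrable setT H.
Proof.
apply/integrableP; split => //; under eq_integral do rewrite gee0_abs//.
by rewrite (le_lt_trans intH)// ltry.
Qed.

Let h x : R := fine (H x).

Let h0 x : 0 <= h x.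
Proof. exact: fine_ge0. Qed.

Let ih : M.-integrable setT (EFin \o h).
Proof.
apply: le_integrable iH => //; first by apply/measurable_EFinP; exact: measurableT_comp.
move=> x _ /=; rewrite ger0_norm// gee0_abs// /h.
by have := H0 x; case: (H x) => //= r _; rewrite leey.
Qed.

Let Good := [set x | (H x < +oo)%E].

Let mGood : measurable Good.
Proof. by rewrite -[Good]setTI; exact: emeasurable_fun_infty_o. Qed.

Let aeGood : {ae M, forall x, Good x}.
Proof.
have := integrable_ae measurableT iH; apply: filterS => x /(_ Logic.I).
by rewrite /Good/= fin_num_abs gee0_abs.
Qed.

Let D_le k x : Good x -> D k x <= h x * 4 ^- k.
Proof.
move=> gx; rewrite ler_pdivlMr ?exprn_gt0// mulrC -lee_fin fineK; last first.
  by rewrite ge0_fin_numE.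
apply: le_trans (nneseries_lim_ge k.+1 (fun m _ _ => HT0 m x)).
by rewrite big_nat_recr//= leeDr// sume_ge0// => m _.
Qed.

Let step_le k x : Good x ->
  enorm (A (i_ k.+1) x - A (i_ k) x) <= Num.sqrt (h x) * 2 ^- k.
Proof.
move=> gx; have s0 : 0 <= Num.sqrt (h x) * 2 ^- k.
  by apply: mulr_ge0; rewrite ?sqrtr_ge0 ?invr_ge0 ?exprn_ge0.
rewrite -(@ler_pXn2r _ 2) ?nnegrE ?enorm_ge0//.
have -> : (Num.sqrt (h x) * 2 ^- k) ^+ 2 = h x * 4 ^- k.
  rewrite exprMn sqr_sqrtr//; congr (_ * _).
  by rewrite -!exprVn exprAC; congr (_ ^+ _); rewrite exprVn -natrX.
exact: D_le.
Qed.

(** Summing the steps gives |A (i_ k)| <= |A (i_ 0)| + 2 sqrt(h); the square of a sum is at most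
    twice the sum of squares. *)
Let A_le k x : Good x -> enorm (A (i_ k) x) ^+ 2 <=
  2 * enorm (A (i_ 0) x) ^+ 2 + 8 * h x.
Proof.
move=> gx.
have le1 : enorm (A (i_ k) x) <=
    enorm (A (i_ 0) x) + Num.sqrt (h x) * (2 - 2 * 2 ^- k).
  elim: k => [|k IH]; first by rewrite expr0 invr1 mulr1 subrr mulr0 addr0.
  rewrite -[A (i_ k.+1) x](subrK (A (i_ k) x)) (le_trans (enormD _ _))//.
  rewrite (le_trans (lerD (step_le k gx) IH))// addrCA lerD2l -mulrDr.
  rewrite ler_wpM2l ?sqrtr_ge0// exprS invfM mulrA divff// mul1r.
  by move: (2 ^- k) => y; lra.
have le2 : enorm (A (i_ k) x) <= enorm (A (i_ 0) x) + 2 * Num.sqrt (h x).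
  rewrite (le_trans le1)// lerD2l mulrC ler_wpM2r ?sqrtr_ge0//.
  by rewrite gerBl mulr_ge0 ?invr_ge0 ?exprn_ge0.
have -> : 8 * h x = 2 * (2 * Num.sqrt (h x)) ^+ 2.
  by rewrite exprMn sqr_sqrtr// ; ring.
have := enorm_ge0 (A (i_ k) x); move: le2.
move: (enorm _) (enorm _) (2 * Num.sqrt _) => a b e abe a0.
have := sqr_ge0 (a - e); nra.
Qed.

(** Cut to zero off [Good], so that the limit exists everywhere and is measurable. *)
Let A' k x := \1_Good x *: A (i_ k) x.

Let A'_Good k x : Good x -> A' k x = A (i_ k) x.
Proof. by move=> gx; rewrite /A' indicE mem_set// scale1r. Qed.

Let cvgA' x j : cvgn (fun k => A' k x 0 j).
Proof.
have [gx|ngx] := pselect (Good x); last first.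
  rewrite (_ : (fun k => _) = cst 0); first exact: is_cvg_cst.
  by apply/funext => k; rewrite /A' indicE memNset// scale0r mxE.
rewrite (_ : (fun k => _) = (fun k => A (i_ k) x 0 j)); last first.
  by apply/funext => k; rewrite A'_Good.
pose u k := A (i_ k.+1) x 0 j - A (i_ k) x 0 j.
have : cvgn (series u).
  apply: normed_cvg.
  apply: (@series_le_cvg _ _ (geometric (Num.sqrt (h x)) 2^-1)) => //.
  - by move=> k /=.
  - move=> k /=; apply: mulr_ge0; first exact: sqrtr_ge0.
    by apply: exprn_ge0; rewrite invr_ge0.
  - move=> k /=; rewrite exprVn (le_trans _ (step_le k gx))//.
    by rewrite /u -coordB; exact: coord_le_enorm.
  - by apply: is_cvg_geometric_series; rewrite ger0_norm// invf_lt1// ltr1n.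
have -> : (fun k => A (i_ k) x 0 j) = (fun k => series u k + A (i_ 0) x 0 j).
  apply/funext => k; rewrite seriesEnat/= telescope_sumr// subrK//.
by move=> cu; apply: is_cvgD => //; exact: is_cvg_cst.
Qed.

Let AA x : 'rV[R]_n := \row_j limn (fun k => A' k x 0 j).

Let mAA : measurable_field setT AA.
Proof.
move=> j; apply: (measurable_fun_cvg (h := fun k x => A' k x 0 j)).
  by move=> k; apply: measurable_fieldZ; [exact: measurable_indic|exact: mA].
by move=> x _; rewrite mxE; exact: cvgA'.
Qed.

Let cvgA x : Good x -> A (i_ k) x @[k --> \oo] --> AA x.
Proof.
move=> gx; apply: cvg_row => j; rewrite mxE.
by under eq_cvg do rewrite -A'_Good//; exact: cvgA'.
Qed.

(** Limit of the fields G (i_ k), recovered from the limit of [A] by inverting [half_power]. The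
    dual supremum need not be attained, so g need not be one of the G i, and optimality has to be
    obtained in the limit. *)
Let g x := p x *: pw (2 * ((p x - 1) / p x)) (AA x).

Let g_pos x : 0 < 2 * ((p x - 1) / p x).
Proof. by rewrite mulr_gt0// divr_gt0 ?subr_gt0// (lt_trans _ (p1 x)). Qed.

Let cvgG x : Good x -> G (i_ k) x @[k --> \oo] --> g x.
Proof.
move=> gx.
rewrite (_ : (fun k => _) =
    (fun k => p x *: pw (2 * ((p x - 1) / p x)) (A (i_ k) x))); last first.
  by apply/funext => k; rewrite -half_powerK.
apply: cvgZl_tmp.
exact: (cvg_comp _ _ (cvgA gx) (@continuous_pw _ _ _ (g_pos x) (AA x))).
Qed.

Let J x := legendre (p x) (g x).

Let sqrAA x : enorm (J x) `^ p x = enorm (AA x) ^+ 2.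
Proof.
rewrite -sqr_enorm_half_power//; congr (enorm _ ^+ 2).
rewrite /half_power /J /legendre pwM ?divr_gt0 ?invr_gt0 ?subr_gt0//; last 1 first.
  by rewrite (lt_trans _ (p1 x)).
rewrite /g scalerA mulVf ?scale1r ?gt_eqF ?(lt_trans _ (p1 x))// pwM//.
  rewrite (_ : _ * _ = 1) ?pw1//; field.
  by rewrite !gt_eqF// ?subr_gt0 ?p1// (lt_trans _ (p1 x)).
by rewrite divr_gt0 ?subr_gt0// divr_gt0// (lt_trans _ (p1 x)).
Qed.

Let mg : measurable_field setT g.
Proof.
apply: measurable_fieldZ => //; apply: measurable_field_pw => //.
apply: measurable_funM => //; apply: measurable_funM; first exact: measurable_funB.
by apply: measurable_fun_inv => // x _; rewrite (lt_trans _ (p1 x)).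
Qed.

Let mJ : measurable_field setT J.
Proof. exact: measurable_field_legendre. Qed.

Let dom x := 2 * enorm (A (i_ 0) x) ^+ 2 + 8 * h x.

Let dom0 x : 0 <= dom x.
Proof. by apply: addr_ge0; apply: mulr_ge0; rewrite ?sqr_ge0. Qed.

Let idom : M.-integrable setT (EFin \o dom).
Proof.
apply: integrableD_EFin; apply: integrableZ_EFin => //.
have [B GB] := bG (i_ 0).
apply: (@bounded_integrable _ _ _ M _ ((1 + B) `^ q)).
  by apply: measurable_funX; exact: measurable_enorm.
move=> x; rewrite ger0_norm ?sqr_ge0// sqr_enorm_half_power//.
exact: legendre_le.
Qed.

Let AA_le x : Good x -> enorm (AA x) ^+ 2 <= dom x.
Proof.
move=> gx.
have cv : enorm (A (i_ k) x) ^+ 2 @[k --> \oo] --> enorm (AA x) ^+ 2.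
  have ce := cvg_comp _ _ (cvgA gx) (@continuous_enorm _ _ (AA x)).
  exact: (cvgM ce ce).
rewrite -(cvg_lim _ cv)//; apply: limr_le; first exact: cvgP cv.
by apply: nearW => k; exact: A_le.
Qed.

(** * Optimality conditions *)

Let le_1powR x a : 0 <= a -> a <= 1 + a `^ p x.
Proof.
move=> a0; have [a1|a1] := leP a 1; first by rewrite (le_trans a1)// lerDl powR_ge0.
by rewrite (le_trans (le1r_powR (ltW a1) (ltW (p1 x))))// lerDr.
Qed.

(** The near-maximiser i_ k is perturbed by 2^-k G i. Maximality up to eps k and convexity of Phi
    give 2^-k T i <= eps k + 2^-k int f k. After division by 2^-k the error is (cb / 4) 4^-k, which
    tends to 0. *)
Let euler_le i : M.-integrable setT (EFin \o (fun x => dot (J x) (G i x))) /\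
  T i <= \int[M]_x dot (J x) (G i x).
Proof.
have [B GB] := bG i.
(* [legendre] is evaluated at the perturbed field: by convexity the slope there bounds the increase
   of Phi from above. *)
pose f k x := dot (legendre (p x) (2 ^- k *: G i x + G (i_ k) x)) (G i x).
have B0 x : 0 <= B := le_trans (enorm_ge0 _) (GB x).
have mleg k : measurable_field setT
    (fun x => legendre (p x) (2 ^- k *: G i x + G (i_ k) x)).
  apply: measurable_field_legendre => //; apply: measurable_fieldD => //.
  exact: measurable_fieldZ.
have e1 k x : enorm (2 ^- k *: G i x) <= B.
  rewrite enormZ ger0_norm ?invr_ge0 ?exprn_ge0//.
  rewrite (le_trans _ (GB x))// ler_piMl ?enorm_ge0//.
  by rewrite invf_le1 ?exprn_gt0// exprn_ege1// ler1n.
pose F x := B * (1 + 2 `^ q * ((1 + B) `^ q + dom x)).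
have f_le k x : Good x -> `|f k x| <= F x.
  move=> gx; rewrite (le_trans (normr_dot_le _ _))// mulrC.
  apply: ler_pM; rewrite ?enorm_ge0// (le_trans (le_1powR x (enorm_ge0 _)))//.
  rewrite lerD2l (le_trans (legendreD_le _ _ _))// ler_wpM2l ?powR_ge0// lerD//.
    exact: legendre_le.
  by rewrite -sqr_enorm_half_power//; exact: A_le.
have iF : M.-integrable setT (EFin \o F).
  apply: integrableZ_EFin; apply: integrableD_EFin.
    exact: (finite_measure_integrable_cst M 1).
  apply: integrableZ_EFin; apply: integrableD_EFin => //.
  exact: (finite_measure_integrable_cst M _).
have cvf x : Good x -> f k x @[k --> \oo] --> dot (J x) (G i x).
  move=> gx; apply: cvg_dot; last exact: cvg_cst.
  apply: (cvg_comp (fun k => 2 ^- k *: G i x + G (i_ k) x) (legendre (p x))); last first.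
    exact: (@continuous_legendre _ _ _ (p1 x) (g x)).
  rewrite -[g x]add0r; apply: cvgD; last exact: cvgG.
  rewrite -(scale0r (G i x)); apply: cvgZr_tmp.
  rewrite (_ : (fun k => _) = geometric 1 2^-1); last first.
    by apply/funext => k; rewrite /= mul1r exprVn.
  by apply: cvg_geometric; rewrite ger0_norm// invf_lt1// ltr1n.
have [|||||iJ cv] := @dominated_Rintegral_cvg _ _ _ M f
    (fun x => dot (J x) (G i x)) F.
- by move=> k; exact: measurable_field_dot.
- exact: measurable_field_dot.
- by apply: filterS aeGood => x; exact: cvf.
- exact: iF.
- by apply: filterS aeGood => x gx k; exact: f_le.
split => //.
have Tf k : T i <= cb / 4 * 4 ^- k + \int[M]_x f k x.
  have [m [Gm Tm]] := linG i (i_ k) (2 ^- k).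
  have ifk : M.-integrable setT (EFin \o f k).
    have [Bk GBk] := bG (i_ k).
    apply: (@bounded_integrable _ _ _ M _ ((1 + (1 + (B + Bk)) `^ q) * B)).
      exact: measurable_field_dot.
    move=> x; rewrite (le_trans (normr_dot_le _ _))//.
    apply: ler_pM; rewrite ?enorm_ge0// (le_trans (le_1powR x (enorm_ge0 _)))//.
    by rewrite lerD2l; apply: legendre_le; rewrite (le_trans (enormD _ _))// lerD.
  have le1 x : Phi m x <= 2 ^- k * f k x + Phi (i_ k) x.
    have := fenchel_young (p x) (G (i_ k) x) (legendre (p x) (G m x)) (p1 x).
    have := dot_legendre (p x) (G m x) (p1 x).
    rewrite {2}Gm dotDr dotZr /f -Gm /Phi {2}/conj_power.
    exact: gradient_arith.
  have := K_le m; have := i_P k; rewrite /K Tm => Kk Km.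
  have : \int[M]_x Phi m x <= 2 ^- k * \int[M]_x f k x + \int[M]_x Phi (i_ k) x.
    rewrite -RintegralZl// -RintegralD//; last exact: integrableZ_EFin.
    by apply: le_Rintegral => //; apply: integrableD_EFin => //; exact: integrableZ_EFin.
  move=> le2.
  have : 2 ^- k * T i <= 2 ^- k * (cb / 4 * 4 ^- k + \int[M]_x f k x).
    rewrite mulrDr; have -> : 2 ^- k * (cb / 4 * 4 ^- k) = eps k.
      rewrite mulrCA -invfM -exprMn /eps; congr (_ * (_ ^- _)).
      by rewrite -natrM.
    exact: (maximality_arith Kk Km le2).
  by rewrite ler_pM2l// invr_gt0 exprn_gt0.
have cvT : cb / 4 * 4 ^- k + \int[M]_x f k x @[k --> \oo] -->
    0 + \int[M]_x dot (J x) (G i x).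
  apply: cvgD => //.
  rewrite (_ : (fun k => _) = geometric (cb / 4) 4^-1); last first.
    by apply/funext => k; rewrite /= exprVn.
  by apply: cvg_geometric; rewrite ger0_norm// invf_lt1// ltr1n.
rewrite -[leRHS]add0r -(cvg_lim _ cvT)//; apply: limr_ge.
  exact: cvgP cvT.
exact: nearW.
Qed.

(** - G i is again one of the fields, with value - T i, so the one-sided inequality holds for both
    signs. *)
Let euler i : T i = \int[M]_x dot (J x) (G i x).
Proof.
apply/eqP; rewrite eq_le (euler_le i).2/=.
have [z [Gz Tz]] := linG i i (-1).
have [m [Gm Tm]] := linG i z (-1).
have [im Tm'] := euler_le m.
have Gm' x : G m x = - G i x by rewrite Gm Gz !scaleN1r addNr addr0.
have Tm0 : T m = - T i by rewrite Tm Tz; ring.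
rewrite -lerN2 -Tm0 (le_trans Tm')// -mulN1r -RintegralZl//; last exact: (euler_le i).1.
rewrite le_eqVlt; apply/orP; left; apply/eqP; apply: eq_Rintegral => x _.
by rewrite Gm' dotNr mulN1r.
Qed.

Lemma fenchel_duality : exists J : X -> 'rV[R]_n,
  [/\ measurable_field setT J,
      (\int[M]_x (enorm (J x) `^ p x)%:E <= c%:E)%E &
      forall i, M.-integrable setT (EFin \o (fun x => dot (J x) (G i x))) /\
        T i = \int[M]_x dot (J x) (G i x)].
Proof.
exists J; split => //; last first.
  by move=> i; split; [exact: (euler_le i).1|exact: euler].
(* Equality in Fenchel-Young at g makes |J|^p the limit of [f k], whose integral is T (i_ k) - int
   Phi (i_ k) by [euler], hence at most c. *)
pose f k x := dot (J x) (G (i_ k) x) - Phi (i_ k) x.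
have conjg x : conj_power (p x) (g x) = (p x - 1) * enorm (J x) `^ p x by [].
have cvf x : Good x -> f k x @[k --> \oo] --> enorm (J x) `^ p x.
  move=> gx; have -> : enorm (J x) `^ p x = dot (J x) (g x) -
      (p x - 1) * enorm (AA x) ^+ 2.
    by rewrite -sqrAA dot_legendre//; rewrite -/(J x); ring.
  apply: cvgB; first by apply: cvg_dot; [exact: cvg_cst|exact: cvgG].
  under eq_cvg do rewrite Phi_sqr.
  apply: (@cvgM _ _ _ _ (cst (p x - 1)) (fun k => enorm (A (i_ k) x) ^+ 2)).
    exact: cvg_cst.
  have ce := cvg_comp _ _ (cvgA gx) (@continuous_enorm _ _ (AA x)).
  exact: (cvgM ce ce).
pose F x := (1 + 2 * pp) * dom x.
have f_le k x : Good x -> `|f k x| <= F x.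
  move=> gx; have /andP[_ pxp] := p_bnd x.
  have Jd : enorm (J x) `^ p x <= dom x by rewrite sqrAA AA_le.
  have Pd : Phi (i_ k) x <= pp * dom x.
    rewrite Phi_sqr; apply: ler_pM; rewrite ?sqr_ge0 ?A_le//.
      by rewrite subr_ge0 ltW.
    by rewrite lerBlDr (le_trans pxp)// lerDl.
  have P0 := Phi_ge0 (i_ k) x.
  have fy1 := fenchel_young (p x) (G (i_ k) x) (J x) (p1 x).
  (* Used for J and for - J, the inequality bounds the inner product on both sides. *)
  have := fenchel_young (p x) (G (i_ k) x) (- J x) (p1 x).
  rewrite dotNl enormN -/(Phi (i_ k) x) => fy2; move: fy1.
  rewrite -/(Phi (i_ k) x) => fy1.
  rewrite /F /f ler_norml mulrDl mul1r -mulrA.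
  by apply/andP; split; lra.
have mf k : measurable_fun setT (f k).
  by apply: measurable_funB => //; exact: measurable_field_dot.
have mJp : measurable_fun setT (fun x => enorm (J x) `^ p x).
  by apply: measurable_fun_powR => //; exact: measurable_enorm.
have [|||||iJ cv] := @dominated_Rintegral_cvg _ _ _ M f
    (fun x => enorm (J x) `^ p x) F => //.
- by apply: filterS aeGood => x; exact: cvf.
- exact: integrableZ_EFin.
- by apply: filterS aeGood => x gx k; exact: f_le.
suff Jc : \int[M]_x (enorm (J x) `^ p x) <= c.
  by rewrite -[leLHS]fineK ?lee_fin// integrable_fin_num.
rewrite -(cvg_lim _ cv)//; apply: limr_le; first exact: cvgP cv.
apply: nearW => k; rewrite RintegralB// -?euler ?lerBlDr//.
exact: (euler_le _).1.
Qed.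

End duality.

(** * Measurability of narrowly continuous curves *)

Section distance_to_complement.
Context {R : realType} {V : normedModType R}.
Variable (U : set V).
Hypotheses (oU : open U) (cU : ~` U !=set0).

Let S x := [set `|x - y| | y in ~` U].

Definition compl_dist (x : V) : R := inf (S x).

Let has_infS x : has_inf (S x).
Proof.
split; first by have [y Uy] := cU; exists `|x - y|, y.
by exists 0 => _ [y _ <-].
Qed.

Lemma compl_dist_ge0 x : 0 <= compl_dist x.
Proof. by apply: lb_le_inf; [exact: (has_infS x).1|move=> _ [y _ <-]]. Qed.

Lemma compl_dist_le x y : ~ U y -> compl_dist x <= `|x - y|.
Proof. by move=> Uy; apply: ge_inf; [exact: (has_infS x).2|exists y]. Qed.

Lemma compl_dist_lipschitz x z : `|compl_dist x - compl_dist z| <= `|x - z|.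
Proof.
have le1 a b : compl_dist a - compl_dist b <= `|a - b|.
  rewrite lerBlDr -lerBlDl; apply: lb_le_inf; first exact: (has_infS b).1.
  move=> _ [y Uy <-]; rewrite lerBlDr (le_trans (compl_dist_le a Uy))//.
  by rewrite [leRHS]addrC; exact: ler_distD.
by rewrite ler_norml le1 andbT lerNl opprB distrC le1.
Qed.

Lemma continuous_compl_dist : continuous compl_dist.
Proof.
move=> x; apply/cvgrPdist_lt => e e0.
have : \forall y \near x, `|x - y| < e by exact: cvgr_dist_lt.
by apply: filterS => y; apply: le_lt_trans; exact: compl_dist_lipschitz.
Qed.

Lemma continuous_compl_dist_min (k : R) :
  continuous (fun x => Num.min 1 (k * compl_dist x)).
Proof.
move=> x.
have h : {for x, continuous ((cst 1 : V -> R^o) \min (fun x => k * compl_dist x))}.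
  apply: continuous_min; first exact: cst_continuous.
  exact: (cvgM (cvg_cst k) (@continuous_compl_dist x)).
exact: h.
Qed.

Lemma compl_dist_gt0 x : U x -> 0 < compl_dist x.
Proof.
move=> Ux; move: oU; rewrite openE => /(_ _ Ux)/nbhs_ballP[e /= e0 eU].
rewrite (lt_le_trans e0)//; apply: lb_le_inf; first exact: (has_infS x).1.
move=> _ [y Uy <-]; rewrite leNgt; apply/negP => xy.
by apply: Uy; apply: eU; rewrite -ball_normE.
Qed.

Lemma compl_dist_eq0 x : ~ U x -> compl_dist x = 0.
Proof.
move=> Ux; apply/eqP; rewrite eq_le compl_dist_ge0 andbT.
by rewrite (le_trans (compl_dist_le x Ux))// subrr normr0.
Qed.

(** On the open set U the distance to the complement is positive, so its multiples by k eventually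
    exceed 1; off U it is 0. *)
Lemma cvg_compl_dist_indic x :
  Num.min 1 (k%:R * compl_dist x) @[k --> \oo] --> (\1_U x : R).
Proof.
have [Ux|Ux] := pselect (U x); last first.
  rewrite indicE memNset// compl_dist_eq0//.
  under eq_cvg do rewrite mulr0.
  by rewrite min_r//; exact: cvg_cst.
rewrite indicE mem_set//; apply: cvg_near_cst.
exists (Num.trunc (compl_dist x)^-1).+1 => //= k /= kx.
apply: min_l; rewrite -ler_pdivrMr ?compl_dist_gt0// mul1r.
rewrite (le_trans (ltW (truncnS_gt _)))// ler_nat//.
Qed.

End distance_to_complement.

Section narrow_continuity.
Context {R : realType} {n : nat}.
Local Notation E := ('rV[R]_n).

Lemma continuous_measurable_rV (f : E -> R) : continuous f ->
  measurable_fun setT f.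
Proof.
move=> cf; apply: (@measurability _ _ _ _ _ _ (@measurable_realfun.RGenOpens.G R)).
  exact: measurable_realfun.RGenOpens.measurableE.
move=> _ [_ [a [b ->]] <-]; rewrite setTI; apply: sub_sigma_algebra.
by apply: open_comp => // v _; exact: cf.
Qed.

(** Dynkin's argument from the open sets: the indicator of an open set is the limit of the bounded
    continuous functions min(1, k dist), whose integrals are continuous in t. *)
Lemma narrow_continuous_measurable (rho : R -> probability E R) :
  (forall f : E -> R, continuous f -> (exists M, forall x, `|f x| <= M) ->
     continuous (fun t => \int[rho t]_x f x)) ->
  forall A, measurable A ->
    measurable_fun (setT : set (measurableTypeR R)) (fun t => rho t A).
Proof.
move=> crho.
have mT : measurable_fun (setT : set (measurableTypeR R)) (fun t => rho t setT).
  under eq_fun do rewrite probability_setT; exact: measurable_cst.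
apply: (@dynkin_induction _ E (@open E)) => //=.
- by move=> A B; exact: openI.
(* The whole space is treated apart, its complement being empty. *)
- move=> U oU; have [cU|/set0P/negP/negPn/eqP cU] := pselect (~` U !=set0); last first.
    by rewrite -[U]setCK cU setC0.
  pose f (k : nat) x := Num.min 1 (k%:R * compl_dist U x).
  have cf k : continuous (f k) by exact: continuous_compl_dist_min.
  have f0 k x : 0 <= f k x by rewrite le_min ler01 mulr_ge0// compl_dist_ge0.
  have f1 k x : `|f k x| <= 1 by rewrite ger0_norm// ge_min lexx.
  apply: (@emeasurable_fun_cvg _ _ _ _ (fun k t => (\int[rho t]_x f k x)%:E)).
    move=> k; apply/measurable_EFinP; apply: continuous_measurable_fun.
    by apply: crho => //; exists 1.
  move=> t _.
  have -> : rho t U = (\int[rho t]_x (\1_U x)%:E)%E.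
    by rewrite integral_indic ?setIT//; exact: sub_sigma_algebra.
  have [] := @dominated_convergence _ _ _ (rho t) _ measurableT
     (fun k => EFin \o f k) (fun x => (\1_U x)%:E) (cst 1%:E).
  - by move=> k; apply/measurable_EFinP; exact: continuous_measurable_rV.
  - apply/measurable_EFinP; apply: measurable_indic; exact: sub_sigma_algebra.
  - apply: aeW => x _; apply: cvg_EFin; first exact: nearW.
    exact: cvg_compl_dist_indic.
  - exact: (finite_measure_integrable_cst (rho t) 1).
  - by apply: aeW => x k _; rewrite /= lee_fin.
  move=> _ _; apply: cvg_trans; apply: near_eq_cvg; apply: nearW => k /=.
  rewrite fineK//; apply: integrable_fin_num => //.
  apply: measurable_bounded_integrable => //.
  + by rewrite ltey_eq fin_num_measure.
  + exact: continuous_measurable_rV.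
  + by exists 1; split; [exact: num_real|move=> y y1 x _; exact: le_trans (f1 k x) (ltW y1)].
- move=> A mA mrA.
  apply: (eq_measurable_fun (fun t => 1 - rho t A)%E).
    by move=> t _; rewrite probability_setC.
  exact: emeasurable_funB.
- move=> F mF tF mrF.
  apply: (eq_measurable_fun (fun t => \sum_(0 <= k <oo) rho t (F k))%E).
    by move=> t _; rewrite measure_semi_bigcup//; exact: bigcup_measurable.
  apply: (@ge0_emeasurable_sum _ _ _ _ (fun k t => rho t (F k)) xpredT) => //.
  by move=> k _; exact: mrF.
Qed.

(** Retraction of the line onto [0, 1]. A curve is controlled only there, and composition with the
    retraction turns it into a kernel on the whole line. *)
Definition clamp01 (t : R) := Num.max 0 (Num.min t 1).

Lemma clamp01_in t : `[0, 1]%classic (clamp01 t).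
Proof.
by rewrite /= in_itv/= le_max lexx/= ge_max ler01 ge_min lexx orbT.
Qed.

Lemma clamp01_id t : `[0, 1]%classic t -> clamp01 t = t.
Proof. by rewrite /= in_itv/= => /andP[t0 t1]; rewrite /clamp01 min_l// max_r. Qed.

Lemma continuous_clamp01 : continuous clamp01.
Proof.
move=> t.
have h1 : {for t, continuous ((id : R -> R^o) \min cst 1)}.
  by apply: continuous_min; [exact: cvg_id|exact: cst_continuous].
have h2 : {for t, continuous ((cst 0 : R -> R^o) \max (id \min cst 1))}.
  by apply: continuous_max => //; exact: cst_continuous.
exact: h2.
Qed.

Lemma continuous_comp_clamp01 (g : R -> R) :
  {within `[0, 1], continuous g} -> continuous (g \o clamp01).
Proof.
move=> cg t A /= Ag.
have : within `[0, 1]%classic (nbhs (clamp01 t)) (g @^-1` A).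
  by rewrite (nbhs_subspace_in (clamp01_in t)); exact: (cg (clamp01 t) A Ag).
rewrite /within/= => /continuous_clamp01; rewrite nbhs_simpl/=.
by apply: filterS => s /(_ (clamp01_in s)).
Qed.

Lemma curve_measurable (Omega : set E) (rho : R -> probability E R) :
  curve Omega rho -> forall A, measurable A ->
    measurable_fun (setT : set (measurableTypeR R)) (fun t => rho (clamp01 t) A).
Proof.
move=> [_ crho]; apply: (@narrow_continuous_measurable (rho \o clamp01)) => f cf bf.
exact: (continuous_comp_clamp01 (crho f cf bf)).
Qed.

End narrow_continuity.

(** * Weighted disintegrations *)

Section density.
Context d (T : measurableType d) (R : realType).
Variables (mu : {measure set T -> \bar R}) (f : T -> R).

(** The proofs [mf] and [f0] are parameters so that the measure structure can be attached to the set
    function itself. *)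
Definition density (mf : measurable_fun setT f) (f0 : forall x, 0 <= f x)
  (A : set T) : \bar R := (\int[mu]_(x in A) (f x)%:E)%E.

Hypotheses (mf : measurable_fun setT f) (f0 : forall x, 0 <= f x).

Let density0 : density mf f0 set0 = 0%E.
Proof. exact: integral_set0. Qed.

Let density_ge0 A : (0 <= density mf f0 A)%E.
Proof. by apply: integral_ge0 => x _; rewrite lee_fin. Qed.

Let density_sigma_additive : semi_sigma_additive (density mf f0).
Proof.
move=> F mF tF mUF; rewrite /density; apply: cvg_toP.
  apply: ereal_nondecreasing_is_cvgn => m n mn.
  by apply: lee_sum_nneg_natr => // k _ _; apply: integral_ge0 => x _; rewrite lee_fin.
rewrite ge0_integral_bigcup//= => [|x _]; last by rewrite lee_fin.
by apply: measurable_funTS; exact/measurable_EFinP.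
Qed.

HB.instance Definition _ := isMeasure.Build _ _ _ (density mf f0)
  density0 density_ge0 density_sigma_additive.

Import HBNNSimple.

Let integral_nnsfun_density (h : {nnsfun T >-> R}) :
  (\int[density mf f0]_x (h x)%:E = \int[mu]_x ((h x)%:E * (f x)%:E))%E.
Proof.
rewrite integralT_nnsfun sintegralE.
have -> : (\int[mu]_x ((h x)%:E * (f x)%:E) =
    \int[mu]_x (\sum_(r \in range h) (r * (\1_(h @^-1` [set r]) x * f x))%:E))%E.
  apply: eq_integral => x _; rewrite fsumEFin// -EFinM; congr (_%:E).
  rewrite fimfunE mulr_fsuml//.
  by apply: eq_fsbigr => r _; rewrite mulrA.
rewrite ge0_integral_fsum//; last 2 first.
- move=> r; apply/measurable_EFinP; apply: measurable_funM => //.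
  exact: measurable_funM.
- move=> r x _; rewrite lee_fin mulrA mulr_ge0//.
  by have := nnfun_muleindic_ge0 h r x; rewrite lee_fin.
apply: eq_fsbigr => r; rewrite inE => -[x _ hxr].
under eq_integral do rewrite EFinM.
rewrite ge0_integralZl_EFin//; last 3 first.
- by move=> y _; rewrite lee_fin mulr_ge0.
- by apply/measurable_EFinP; exact: measurable_funM.
- by rewrite -hxr.
congr (_ * _)%E; rewrite /density [LHS]integral_mkcond; apply: eq_integral => y _.
by rewrite patchE indicE; case: ifP => _; rewrite ?mul1r ?mul0r.
Qed.

Lemma ge0_integral_density (h : T -> \bar R) : measurable_fun setT h ->
  (forall x, 0 <= h x)%E ->
  (\int[density mf f0]_x h x = \int[mu]_x (h x * (f x)%:E))%E.
Proof.
move=> mh h0; pose g := nnsfun_approx measurableT mh.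
transitivity (\int[density mf f0]_x limn (fun n => (g n x)%:E))%E.
  by apply: eq_integral => x _; apply/esym/cvg_lim => //; exact: cvg_nnsfun_approx.
rewrite monotone_convergence//; last 3 first.
- by move=> n; exact/measurable_EFinP.
- by move=> n x _; rewrite lee_fin.
- by move=> x _ m n mn; rewrite lee_fin; exact/lefP/nd_nnsfun_approx.
under eq_fun do rewrite integral_nnsfun_density.
rewrite -monotone_convergence//; last 3 first.
- by move=> n; apply: emeasurable_funM; exact/measurable_EFinP.
- by move=> n x _; rewrite mule_ge0 ?lee_fin.
- move=> x _ m n mn; apply: lee_wpmul2r; rewrite ?lee_fin//.
  exact/lefP/nd_nnsfun_approx.
apply: eq_integral => x _; apply/cvg_lim => //.
by apply: cvgeZr => //; exact: cvg_nnsfun_approx.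
Qed.

End density.

Section probability_density.
Context d (T : measurableType d) (R : realType).
Variables (mu : {measure set T -> \bar R}) (f : T -> R).
Hypotheses (mf : measurable_fun setT f) (f0 : forall x, 0 <= f x).

Definition prob_density (f1 : (\int[mu]_x (f x)%:E = 1)%E) : set T -> \bar R :=
  density mu mf f0.

Hypothesis f1 : (\int[mu]_x (f x)%:E = 1)%E.

HB.instance Definition _ := Measure.on (prob_density f1).

Let prob_densityT : prob_density f1 setT = 1%E.
Proof. exact: f1. Qed.

HB.instance Definition _ := Measure_isProbability.Build _ _ R
  (prob_density f1) prob_densityT.

End probability_density.

Section disintegration.
Context {R : realType} d1 d2 (T : measurableType d1) (E : measurableType d2).
Variables (m : probability T R) (kap : T -> probability E R).
Hypothesis mkap : forall A, measurable A -> measurable_fun setT (fun t => kap t A).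

(** The Dirac mass at t times [kap t]; its average over m is the measure m(dt) kap_t(dx). *)
Let fiber (t : T) : giry (T * E)%type R :=
  giry_prod (giry_ret t, kap t : giry E R).

Let mfiber : measurable_fun setT fiber.
Proof.
have mk : measurable_fun setT (fun t => kap t : giry E R).
  by apply: measurable_giry_codensity => // B; exact: mkap.
have -> : fiber = giry_prod \o (fun t => (giry_ret t, kap t : giry E R)) by [].
apply: measurableT_comp; first exact: measurable_giry_prod.
by apply: measurable_fun_pair => //; exact: measurable_giry_ret.
Qed.

Definition fibered : {finite_measure set (T * E)%type -> \bar R} :=
  giry_bind (m : giry T R) mfiber.

Lemma ge0_integral_fibered (h : T * E -> \bar R) : measurable_fun setT h ->
  (forall z, 0 <= h z)%E ->
  (\int[fibered]_z h z = \int[m]_t \int[kap t]_x h (t, x))%E.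
Proof.
move=> mh h0; rewrite [LHS](@giry_int_bind _ _ _ _ R m fiber mfiber h mh h0).
apply: eq_integral => t _; rewrite giry_int_prod1// giry_int_ret//.
apply: measurable_fun_fubini_tonelli_F => //.
Qed.

Lemma measurable_fibered (h : T * E -> \bar R) : measurable_fun setT h ->
  (forall z, 0 <= h z)%E ->
  measurable_fun setT (fun t => \int[kap t]_x h (t, x))%E.
Proof.
move=> mh h0.
have -> : (fun t => \int[kap t]_x h (t, x))%E = (giry_int ^~ h) \o fiber.
  apply/funext => t /=; rewrite giry_int_prod1// giry_int_ret//.
  apply: measurable_fun_fubini_tonelli_F => //.
apply: measurableT_comp mfiber; exact: measurable_giry_int.
Qed.

End disintegration.

(** Where the weight c vanishes, a and b may both be infinite, but the products are 0 there.
    Elsewhere finiteness of the products makes a and b finite. *)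
Lemma muleBl_fin (R : realType) (a b : \bar R) (c : R) :
  (0 <= a)%E -> (0 <= b)%E -> 0 <= c ->
  (a * c%:E)%E \is a fin_num -> (b * c%:E)%E \is a fin_num ->
  ((a * c%:E - b * c%:E)%E = (a - b) * c%:E /\
   a * c%:E - b * c%:E = (c * fine (a - b))%:E)%E.
Proof.
move=> a0 b0; rewrite le_eqVlt => /predU1P[<-|c0]; first by rewrite !mule0 mul0r sube0.
case: a a0 => [a| |]; case: b b0 => [b| |] //= _ _; rewrite ?gt0_mulye ?lte_fin//.
by move=> _ _; rewrite -[(a%:E * _ + _)%E]/((a * c - b * c)%:E)
  -[((a%:E + _) * _)%E]/(((a - b) * c)%:E) [c * _]mulrC mulrBl.
Qed.

Section weighted_fibration.
Context {R : realType} d1 d2 (T : measurableType d1) (E : measurableType d2).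
Variables (mu : {measure set T -> \bar R}) (f : T -> R).
Hypotheses (mf : measurable_fun setT f) (f0 : forall x, 0 <= f x)
  (f1 : (\int[mu]_x (f x)%:E = 1)%E).
Variable kap : T -> probability E R.
Hypothesis mkap : forall A, measurable A -> measurable_fun setT (fun t => kap t A).

Let M := fibered (prob_density mf f0 f1) mkap.

Lemma ge0_integral_weighted_fibered (h : T * E -> \bar R) :
  measurable_fun setT h -> (forall z, 0 <= h z)%E ->
  (\int[M]_z h z = \int[mu]_t ((\int[kap t]_x h (t, x)) * (f t)%:E))%E.
Proof.
move=> mh h0; rewrite ge0_integral_fibered//.
rewrite [LHS](@ge0_integral_density _ _ _ mu f mf f0 (fun t => \int[kap t]_x h (t, x))%E)//.
  exact: measurable_fibered.
by move=> t; apply: integral_ge0.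
Qed.

(** The positive and negative parts of h have inner integrals that, weighted by f, are finite for
    almost every t; there [muleBl_fin] applies. The inner integral is given in its real and in its
    extended form, since both occur in the definitions of the equations. *)
Lemma integral_weighted_fibered (h : T * E -> R) :
  M.-integrable setT (EFin \o h) ->
  [/\ mu.-integrable setT (EFin \o (fun t => f t * \int[kap t]_x h (t, x))),
   \int[M]_z h z = \int[mu]_t (f t * \int[kap t]_x h (t, x)) &
   (\int[M]_z (h z)%:E = \int[mu]_t ((\int[kap t]_x (h (t, x))%:E) * (f t)%:E))%E].
Proof.
move=> ih.
have mh : measurable_fun setT (EFin \o h) := measurable_int _ ih.
pose hp := (EFin \o h)^\+%E; pose hm := (EFin \o h)^\-%E.
have mhp : measurable_fun setT hp by exact: measurable_funepos.
have mhm : measurable_fun setT hm by exact: measurable_funeneg.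
have hp0 z : (0 <= hp z)%E by exact: funepos_ge0.
have hm0 z : (0 <= hm z)%E by exact: funeneg_ge0.
pose Hp t := (\int[kap t]_x hp (t, x))%E; pose Hm t := (\int[kap t]_x hm (t, x))%E.
have Hp0 t : (0 <= Hp t)%E by apply: integral_ge0.
have Hm0 t : (0 <= Hm t)%E by apply: integral_ge0.
have mHp : measurable_fun setT Hp by exact: (measurable_fibered mkap).
have mHm : measurable_fun setT Hm by exact: (measurable_fibered mkap).
have EP : (\int[M]_z hp z = \int[mu]_t (Hp t * (f t)%:E))%E.
  exact: ge0_integral_weighted_fibered.
have EM : (\int[M]_z hm z = \int[mu]_t (Hm t * (f t)%:E))%E.
  exact: ge0_integral_weighted_fibered.
have mfE : measurable_fun setT (EFin \o f) by exact/measurable_EFinP.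
have fE0 t : (0 <= (f t)%:E)%E by rewrite lee_fin.
have iP : mu.-integrable setT (fun t => Hp t * (f t)%:E)%E.
  apply/integrableP; split; first exact: emeasurable_funM.
  under eq_integral do rewrite gee0_abs ?mule_ge0//.
  by rewrite -EP; exact: integral_funepos_lt_pinfty.
have iM : mu.-integrable setT (fun t => Hm t * (f t)%:E)%E.
  apply/integrableP; split; first exact: emeasurable_funM.
  under eq_integral do rewrite gee0_abs ?mule_ge0//.
  by rewrite -EM; exact: integral_funeneg_lt_pinfty.
have RE t : \int[kap t]_x h (t, x) = fine (Hp t - Hm t)%E.
  rewrite /Rintegral integralE; congr (fine (_ - _)); apply: eq_integral => x _.
    by rewrite /hp !funeposE.
  by rewrite /hm !funenegE.
have mI : measurable_fun setT (fun t => f t * \int[kap t]_x h (t, x)).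
  apply: measurable_funM => //; under eq_fun do rewrite RE.
  by apply: measurableT_comp => //; exact: emeasurable_funB.
have iB := integrableB measurableT iP iM.
have aeI : {ae mu, forall t, setT t ->
    (Hp t * (f t)%:E - Hm t * (f t)%:E)%E = (f t * \int[kap t]_x h (t, x))%:E}.
  have := integrable_ae measurableT iP; have := integrable_ae measurableT iM.
  apply: filterS2 => t /(_ Logic.I) ft1 /(_ Logic.I) ft2 _; rewrite RE.
  exact: (muleBl_fin (Hp0 t) (Hm0 t) (f0 t) ft2 ft1).2.
have iI : mu.-integrable setT (EFin \o (fun t => f t * \int[kap t]_x h (t, x))).
  apply/integrableP; split; first exact/measurable_EFinP.
  rewrite (ae_eq_integral (fun t => `|Hp t * (f t)%:E - Hm t * (f t)%:E|)%E) //.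
  - by have /integrableP[] := iB.
  - by apply: measurableT_comp => //; exact/measurable_EFinP.
  - by apply: measurableT_comp => //; exact: (measurable_int _ iB).
  - by apply: filterS aeI => t /(_ Logic.I) /= -> _.
have EI : (\int[M]_z (h z)%:E =
    \int[mu]_t (Hp t * (f t)%:E - Hm t * (f t)%:E))%E.
  by rewrite integralB// -EP -EM integralE; congr (_ - _)%E; apply: eq_integral.
have KE t : (\int[kap t]_x (h (t, x))%:E = Hp t - Hm t)%E.
  rewrite integralE; congr (_ - _)%E; apply: eq_integral => x _.
    by rewrite /hp !funeposE.
  by rewrite /hm !funenegE.
split => //.
  rewrite /Rintegral; congr fine; rewrite EI.
  apply: ae_eq_integral => //; first exact: (measurable_int _ iB).
  exact/measurable_EFinP.
rewrite EI; apply: ae_eq_integral => //; first exact: (measurable_int _ iB).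
  apply: emeasurable_funM => //; under eq_fun do rewrite KE; exact: emeasurable_funB.
have := integrable_ae measurableT iP; have := integrable_ae measurableT iM.
apply: filterS2 => t /(_ Logic.I) ft1 /(_ Logic.I) ft2 _; rewrite KE.
exact: (muleBl_fin (Hp0 t) (Hm0 t) (f0 t) ft2 ft1).1.
Qed.

End weighted_fibration.

(** * Smooth functions and space-time tests *)

Section directional_derivative.
Context {R : realType} {V : normedModType R}.
Implicit Types (f : V -> R) (x u v : V).

Lemma is_derive_line f y v (r : R) : derivable f (y + r *: v) v ->
  is_derive r (1 : R) (fun s : R => f (y + s *: v)) ('D_v f (y + r *: v)).
Proof.
move=> df.
have E : (fun h : R => h^-1 *:
      (((fun s : R => f (y + s *: v)) \o shift r) (h *: (1 : R)) - f (y + r *: v))) =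
   (fun h : R => h^-1 *: ((f \o shift (y + r *: v)) (h *: v) - f (y + r *: v))).
  apply/funext => h /=; congr (_ *: (f _ - _)).
  by rewrite [_ *: 1]mulr1 scalerDl addrCA.
apply: DeriveDef; first by rewrite /derivable E.
by rewrite /derive E.
Qed.

Lemma mean_value_direction f y v (c : R) : (forall x, derivable f x v) ->
  exists2 r : R, `|r| <= `|c| & f (y + c *: v) - f y = c * 'D_v f (y + r *: v).
Proof.
move=> df; pose g (s : R) := f (y + s *: v).
have dg (s : R) : is_derive s (1 : R) g ('D_v f (y + s *: v)).
  exact: is_derive_line.
have cg (A : set R) : {within A, continuous g}.
  apply: continuous_subspaceT => s; apply: differentiable_continuous.
  by apply/derivable1_diffP; case: (dg s).
have g0 : f y = g 0 by rewrite /g scale0r addr0.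
have [c0|c0] := leP 0 c.
  have [r rc E] := MVT_segment c0 (fun s _ => dg s) (cg _).
  exists r; last by rewrite g0 -/(g c) E subr0 mulrC.
  by move: rc; rewrite in_itv/= => /andP[r0 rc]; rewrite !ger0_norm.
have [r rc E] := MVT_segment (ltW c0) (fun s _ => dg s) (cg _).
exists r; last by rewrite g0 -/(g c) -opprB E sub0r mulrN opprK mulrC.
move: rc; rewrite in_itv/= => /andP[rc r0].
by rewrite !ler0_norm ?(ltW c0)// lerN2.
Qed.

(** By the mean value theorem the increment is c h times the derivative at a point near y h, and
    this point tends to x. With a moving base point and a free step, the lemma serves for sums and
    multiples of directions and for the chain rule. *)
Lemma cvg_difference_quotient f v x (F : set_system R) (FF : ProperFilter F)
    (y : R -> V) (c : R -> R) (c' : R) :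
  (forall x, derivable f x v) -> continuous ('D_v f) ->
  y @ F --> x -> c @ F --> 0 -> h^-1 * c h @[h --> F] --> c' ->
  h^-1 * (f (y h + c h *: v) - f (y h)) @[h --> F] --> c' * 'D_v f x.
Proof.
move=> df cdf yx c0 cc'.
have /choice[r rP] : forall h, exists r : R, `|r| <= `|c h| /\
    f (y h + c h *: v) - f (y h) = c h * 'D_v f (y h + r *: v).
  by move=> h; have [r] := mean_value_direction (y h) (c h) df; exists r.
under eq_cvg do rewrite (rP _).2 mulrA.
apply: cvgM => //.
have r0 : r @ F --> 0.
  apply: norm_cvg0; apply: (@squeeze_cvgr _ _ _ _ (cst 0) (fun h => `|c h|)).
  - by apply: nearW => h; rewrite normr_ge0 (rP h).1.
  - exact: cvg_cst.
  - by rewrite -(@normr0 _ R); exact: cvg_norm.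
have yrx : y h + r h *: v @[h --> F] --> x + 0 *: v.
  by apply: cvgD => //; exact: cvgZr_tmp.
rewrite scale0r addr0 in yrx.
exact: (cvg_comp _ _ yrx (cdf x)).
Qed.

Lemma cvg_id_dnbhs0 : (fun h : R => h) @ 0^' --> (0 : R).
Proof. exact: (cvg_trans _ (@nbhs_dnbhs _ _)). Qed.

Lemma cvg_mulVr_dnbhs0 (a : R) : h^-1 * (a * h) @[h --> (0 : R)^'] --> a.
Proof.
apply: cvg_near_cst; near=> h; rewrite mulrC mulfK//.
by near: h; exact: nbhs_dnbhs_neq.
Unshelve. all: by end_near. Qed.

(** The step h (u + v) is made in two legs; the second starts at the moving point x + h u, which is
    where the continuity of ['D_v f] enters. *)
Lemma deriveDdir f x u v : (forall x w, derivable f x w) ->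
  continuous ('D_v f) -> 'D_(u + v) f x = 'D_u f x + 'D_v f x.
Proof.
move=> df cdf; apply: cvg_lim => //.
have cv := @cvg_difference_quotient f v x 0^' _ (fun h : R => x + h *: u) id 1
  (df ^~ v) cdf.
have {}cv : h^-1 * (f (x + h *: u + h *: v) - f (x + h *: u)) @[h --> (0 : R)^']
    --> 'D_v f x.
  rewrite -[X in _ --> X]mul1r; apply: cv.
  - rewrite -[X in _ --> X]addr0 -(scale0r u); apply: cvgD; first exact: cvg_cst.
    by apply: cvgZr_tmp; exact: cvg_id_dnbhs0.
  - exact: cvg_id_dnbhs0.
  - by under eq_cvg do rewrite -[X in _ * X]mul1r; exact: cvg_mulVr_dnbhs0.
have cu : h^-1 * (f (x + h *: u) - f x) @[h --> (0 : R)^'] --> 'D_u f x.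
  have E : (fun h : R => h^-1 * (f (x + h *: u) - f x)) =
      (fun h : R => h^-1 *: ((f \o shift x) (h *: u) - f x)).
    by apply/funext => h /=; rewrite (addrC x).
  by rewrite E; exact: (df x u).
have := @cvgD _ _ _ (0 : R)^' _ _ _ _ _ cu cv.
have E : (fun h : R => h^-1 * (f (x + h *: u) - f x)) +
    (fun h : R => h^-1 * (f (x + h *: u + h *: v) - f (x + h *: u))) =
    (fun h : R => h^-1 *: ((f \o shift x) (h *: (u + v)) - f x)).
  apply/funext => h; transitivity (h^-1 * (f (x + h *: u) - f x) +
    h^-1 * (f (x + h *: u + h *: v) - f (x + h *: u))); first by [].
  rewrite -mulrDr -[RHS]/(h^-1 * _); congr (_ * _).
  by rewrite /= (scalerDr h) (addrC _ x) (addrA x) [LHS]addrC subrKA.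
by rewrite E; apply.
Qed.

Lemma deriveZdir f x (a : R) v : (forall x w, derivable f x w) ->
  continuous ('D_v f) -> 'D_(a *: v) f x = a * 'D_v f x.
Proof.
move=> df cdf; apply: cvg_lim => //.
have cv := @cvg_difference_quotient f v x 0^' _ (cst x) (fun h => a * h) a
  (df ^~ v) cdf.
have {}cv : h^-1 * (f (x + (a * h) *: v) - f x) @[h --> (0 : R)^'] --> a * 'D_v f x.
  apply: cv; [exact: cvg_cst| |exact: cvg_mulVr_dnbhs0].
  rewrite -[X in _ --> X](mulr0 a); apply: cvgMl_tmp; exact: cvg_id_dnbhs0.
have E : (fun h => h^-1 * (f (x + (a * h) *: v) - f x)) =
    (fun h : R => h^-1 *: ((f \o shift x) (h *: (a *: v)) - f x)).
  by apply/funext => h /=; rewrite scalerA (mulrC h) (addrC x).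
by rewrite E in cv.
Qed.

End directional_derivative.

Section smooth_functions.
Context {R : realType} {V : normedModType R}.
Implicit Types (f g : V -> R).

Lemma smooth_continuous f : smooth f -> continuous f.
Proof. by move=> /(_ [::])[]. Qed.

Lemma smooth_derivable f : smooth f -> forall x v, derivable f x v.
Proof. by move=> /(_ [::])[]. Qed.

Lemma smooth_derive f v : smooth f -> smooth ('D_v f).
Proof.
move=> sf s; have := sf (rcons s v).
by rewrite foldr_rcons.
Qed.

Lemma smooth_continuous_derive f v : smooth f -> continuous ('D_v f).
Proof. by move=> /(smooth_derive v)/smooth_continuous. Qed.

(** Coinduction: a class of continuous derivable functions that is stable under directional
    derivatives consists of smooth functions. The induction removes the last direction of the list,
    which [foldr] applies first. *)
Lemma smooth_intro (P : (V -> R) -> Prop) :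
  (forall f, P f -> continuous f /\ forall x v, derivable f x v) ->
  (forall f v, P f -> P ('D_v f)) -> forall f, P f -> smooth f.
Proof.
move=> P0 PD f Pf s; apply: P0; elim/last_ind: s f Pf => [//|s v IH] f Pf.
by rewrite foldr_rcons; apply: IH; exact: PD.
Qed.

Lemma smoothDZ f g (a : R) : smooth f -> smooth g ->
  smooth (fun x => a * f x + g x).
Proof.
move=> sf sg; apply: (@smooth_intro (fun h => exists f g, [/\ smooth f, smooth g &
    h = (fun x => a * f x + g x)])); last by exists f, g.
  move=> _ [{}f [{}g [{}sf {}sg ->]]]; split.
    move=> x; apply: cvgD; last exact: smooth_continuous.
    by apply: cvgMl_tmp; exact: smooth_continuous.
  move=> x v; apply: (@derivableD _ _ _ (a *: f) g); last exact: smooth_derivable.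
  by apply: derivableZ; exact: smooth_derivable.
move=> _ v [{}f [{}g [{}sf {}sg ->]]]; exists ('D_v f), ('D_v g).
split; [exact: smooth_derive|exact: smooth_derive|].
apply/funext => x; rewrite (@deriveD _ _ _ (a *: f) g).
- by rewrite deriveZ//; exact: smooth_derivable.
- by apply: derivableZ; exact: smooth_derivable.
- exact: smooth_derivable.
Qed.

Definition supp f := closure [set x | f x != 0].

Lemma derive_eq0_supp f v x : ~ supp f x -> 'D_v f x = 0.
Proof.
move=> fx; have oC : open (~` supp f) by apply: closed_openC; exact: closed_closure.
rewrite (@near_eq_derive _ _ _ f (cst 0)); first exact: derive_cst.
have : nbhs x (~` supp f) by apply: open_nbhs_nbhs.
apply: filterS => y fy; apply/eqP/negPn/negP => fy0.
by apply: fy; exact: subset_closure.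
Qed.

Lemma compact_supp_bounded (f g : V -> R) : compact (supp f) -> continuous g ->
  (forall x, ~ supp f x -> g x = 0) -> exists B, forall x, `|g x| <= B.
Proof.
move=> cf cg g0.
have /compact_bounded[B [_ BP]] : compact (g @` supp f).
  by apply: continuous_compact => //; exact: continuous_subspaceT.
exists `|B + 1| => x; have [fx|fx] := pselect (supp f x); last by rewrite g0 ?normr0.
rewrite (le_trans _ (ler_norm _))// ?normr_id.
by apply: (BP (B + 1)); [rewrite ltrDl|exists x].
Qed.

Lemma derive_bounded f v : smooth f -> compact (supp f) ->
  exists B, forall x, `|'D_v f x| <= B.
Proof.
move=> sf cf; apply: (compact_supp_bounded cf); last exact: derive_eq0_supp.
exact: smooth_continuous_derive.
Qed.

End smooth_functions.

Lemma continuous_pairing (U V W : topologicalType) (f : U -> V) (g : U -> W) :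
  continuous f -> continuous g -> continuous (fun x => (f x, g x)).
Proof. by move=> cf cg x; apply: cvg_pair; [exact: cf|exact: cg]. Qed.

Lemma continuous_row (R : realType) (n : nat) (U : topologicalType) (f : U -> 'rV[R]_n) :
  (forall j, continuous (fun x => f x 0 j)) -> continuous f.
Proof. by move=> cf x; apply: cvg_row => j; exact: cf. Qed.

Section spacetime.
Context {R : realType} {n : nat}.
Local Notation E := ('rV[R]_n).
Implicit Types (phi psi : R * E -> R).

Let quotient_section phi t x v :
  (fun h : R => h^-1 *: (((fun y => phi (t, y)) \o shift x) (h *: v) - phi (t, x))) =
  (fun h : R => h^-1 *: ((phi \o shift (t, x)) (h *: ((0 : R), v)) - phi (t, x))).
Proof.
apply/funext => h /=; congr (_ *: (phi _ - _)).
by rewrite -[RHS]/(h * 0 + t, h *: v + x) mulr0 add0r.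
Qed.

Lemma derivable_section phi t x v : derivable phi (t, x) ((0 : R), v) ->
  derivable (fun y => phi (t, y)) x v.
Proof. by rewrite /derivable quotient_section. Qed.

Lemma derive_section phi t x v :
  'D_v (fun y => phi (t, y)) x = 'D_((0 : R), v) phi (t, x).
Proof. by rewrite /derive quotient_section. Qed.

Lemma continuous_section phi t : continuous phi -> continuous (fun y => phi (t, y)).
Proof.
move=> cphi y; apply: (cvg_comp (fun y => (t, y)) phi); last exact: cphi.
apply: (@continuous_pairing _ _ _ (cst t) id); last by move=> z; exact: cvg_id.
by move=> z; exact: cst_continuous.
Qed.

Lemma smooth_section phi t : smooth phi -> smooth (fun y => phi (t, y)).
Proof.
move=> sphi; apply: (@smooth_intro _ _ (fun f => exists2 phi, smooth phi &
    f = (fun y => phi (t, y)))); last by exists phi.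
  move=> _ [{}phi {}sphi ->]; split.
    exact: continuous_section (smooth_continuous sphi).
  by move=> x v; apply: derivable_section; exact: smooth_derivable.
move=> _ v [{}phi {}sphi ->]; exists ('D_((0 : R), v) phi); first exact: smooth_derive.
by apply/funext => y; rewrite derive_section.
Qed.

Lemma supp_section phi t : supp (fun y => phi (t, y)) `<=` [set y | supp phi (t, y)].
Proof.
have c : closed [set y | supp phi (t, y)].
  apply: (@preimage_closed _ _ (fun y => (t, y)) (supp phi)).
    move=> y _; apply: (@continuous_pairing _ _ _ (cst t) id).
      by move=> z; exact: cst_continuous.
    by move=> z; exact: cvg_id.
  exact: closed_closure.
rewrite [X in _ `<=` X](proj1 (closure_id _) c); apply: closureS => y /= py.
exact: subset_closure.
Qed.

Lemma compact_supp_section phi t : compact (supp phi) ->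
  compact (supp (fun y => phi (t, y))).
Proof.
move=> cphi; apply: (@subclosed_compact _ _ (snd @` supp phi)).
- exact: closed_closure.
- apply: continuous_compact => //; apply: continuous_subspaceT => z; exact: cvg_snd.
- by move=> y /supp_section py; exists (t, y).
Qed.

Lemma test_section phi t : spacetime_test phi ->
  test_function [set: E] (fun y => phi (t, y)).
Proof.
move=> [sphi cphi _]; split => //; first exact: smooth_section.
exact: compact_supp_section.
Qed.

Lemma derive_sumdir phi (I : Type) (r : seq I) (u : I -> R * E) z : smooth phi ->
  'D_(\sum_(i <- r) u i) phi z = \sum_(i <- r) 'D_(u i) phi z.
Proof.
move=> sphi; elim: r => [|i r IH].
  rewrite !big_nil -(scale0r (0 : R * E)) deriveZdir ?mul0r//.
    exact: smooth_derivable.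
  exact: smooth_continuous_derive.
rewrite !big_cons deriveDdir ?IH//.
  exact: smooth_derivable.
exact: smooth_continuous_derive.
Qed.

Lemma gradient_section phi t x i :
  gradient (fun y => phi (t, y)) x 0 i = 'D_((0 : R), delta_mx 0 i) phi (t, x).
Proof. by rewrite mxE derive_section. Qed.

Lemma derive_spacetime phi t x (a : R) (w : E) : smooth phi ->
  'D_(a, w) phi (t, x) = a * dt phi t x + dot (gradient (fun y => phi (t, y)) x) w.
Proof.
move=> sphi; have dphi := smooth_derivable sphi.
have cphi v : continuous ('D_v phi) by exact: smooth_continuous_derive.
have aux (r : seq 'I_n) : \sum_(i <- r) (w 0 i *: ((0 : R), delta_mx 0 i : E)) =
    (0, \sum_(i <- r) w 0 i *: delta_mx 0 i).
  elim: r => [|i r IH]; first by rewrite !big_nil.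
  rewrite !big_cons IH.
  by rewrite -[LHS]/(w 0 i * 0 + 0, w 0 i *: delta_mx 0 i + _) mulr0 addr0.
have -> : (a, w) = a *: ((1 : R), 0 : E) + \sum_i (w 0 i *: ((0 : R), delta_mx 0 i : E)).
  rewrite aux -row_sum_delta.
  by rewrite -[RHS]/(a * 1 + 0, a *: 0 + w) mulr1 addr0 scaler0 add0r.
rewrite deriveDdir// deriveZdir// derive_sumdir//; congr (_ + _).
by apply: eq_bigr => i _; rewrite deriveZdir// gradient_section mulrC.
Qed.

Lemma spacetime_test_lin phi psi (a : R) : spacetime_test phi ->
  spacetime_test psi -> spacetime_test (fun z => a * phi z + psi z).
Proof.
move=> [sp cp Up] [sq cq Uq].
have sub : supp (fun z => a * phi z + psi z) `<=` supp phi `|` supp psi.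
  rewrite /supp -closureU; apply: closureS => z /=.
  have [->|] := eqVneq (phi z) 0; last by left.
  by rewrite mulr0 add0r => ?; right.
split; first exact: smoothDZ.
- apply: (@subclosed_compact _ _ (supp phi `|` supp psi)) => //.
    exact: closed_closure.
  exact: compactU.
- by move=> z /sub[/Up|/Uq].
Qed.

Lemma dt_lin phi psi (a : R) t x : smooth phi -> smooth psi ->
  dt (fun z => a * phi z + psi z) t x = a * dt phi t x + dt psi t x.
Proof.
move=> sp sq; rewrite /dt (@deriveD _ _ _ (a *: phi) psi).
- by rewrite deriveZ//; exact: smooth_derivable.
- by apply: derivableZ; exact: smooth_derivable.
- exact: smooth_derivable.
Qed.

Lemma gradient_lin phi psi (a : R) t x : smooth phi -> smooth psi ->
  gradient (fun y => a * phi (t, y) + psi (t, y)) x =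
  a *: gradient (fun y => phi (t, y)) x + gradient (fun y => psi (t, y)) x.
Proof.
move=> sp sq; apply/rowP => i; rewrite !mxE.
rewrite (@deriveD _ _ _ (a *: (fun y => phi (t, y))) (fun y => psi (t, y))).
- by rewrite deriveZ//; apply: derivable_section; exact: smooth_derivable.
- by apply: derivableZ; apply: derivable_section; exact: smooth_derivable.
- by apply: derivable_section; exact: smooth_derivable.
Qed.

Lemma spacetime_test0 : spacetime_test (fun _ : R * E => 0).
Proof.
have s0 : supp (fun _ : R * E => 0 : R) = set0.
  rewrite /supp (_ : [set _ | _] = set0) ?closure0//.
  by apply/seteqP; split => // z /=; rewrite eqxx.
split; last by rewrite -/(supp _) s0.
  apply: (@smooth_intro _ _ (fun f => f = cst 0)) => //.
    move=> _ ->; split; first by move=> x; exact: cst_continuous.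
    by move=> x v; exact: derivable_cst.
  by move=> _ v ->; apply/funext => x; exact: derive_cst.
by rewrite -/(supp _) s0; exact: compact0.
Qed.

Lemma spacetime_test_eq0 phi t x : spacetime_test phi -> ~~ (0 < t < 1) -> phi (t, x) = 0.
Proof.
move=> [_ _ U] t01; apply/eqP/negPn/negP => p0; move/negP : t01; apply.
by apply: (U (t, x)); exact: subset_closure.
Qed.

Lemma dt_bounded phi : spacetime_test phi ->
  exists B, forall t x, `|dt phi t x| <= B.
Proof.
move=> [sphi cphi _].
have [B BP] := derive_bounded ((1 : R), 0 : E) sphi cphi.
by exists B => t x; exact: BP.
Qed.

Lemma gradient_bounded phi : spacetime_test phi ->
  exists B, forall t x, enorm (gradient (fun y => phi (t, y)) x) <= B.
Proof.
move=> [sphi cphi _].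
have /choice[B BP] : forall i : 'I_n, exists B, forall z,
    `|'D_((0 : R), delta_mx 0 i) phi z| <= B.
  by move=> i; exact: derive_bounded.
exists (\sum_i B i) => t x; apply: (le_trans (enorm_le_sum _)).
by apply: ler_sum => i _; rewrite gradient_section.
Qed.

(** The domain carries the product sigma-algebra, whereas continuity speaks of open sets of the
    product. Reading (t, x) as a row of length n + 1 through the measurable map [cons_row] reduces
    the claim to a continuous function of one row vector. *)
Lemma continuous_measurable_spacetime phi : continuous phi ->
  measurable_fun setT (phi : measurableTypeR R * E -> R).
Proof.
move=> cphi; pose psi (y : 'rV[R]_n.+1) := phi (y 0 0, \row_j y 0 (lift ord0 j)).
have cpsi : continuous psi.
  move=> y; apply: (cvg_comp
    (fun y : 'rV[R]_n.+1 => (y 0 0, \row_j y 0 (lift ord0 j))) phi); last exact: cphi.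
  apply: (@continuous_pairing _ _ _ (fun y : 'rV[R]_n.+1 => y 0 0)).
    exact: coord_continuous.
  apply: continuous_row => j; under eq_fun do rewrite mxE; exact: coord_continuous.
have -> : phi = psi \o (@cons_row R n) \o (fun z => (z.2, z.1)).
  apply/funext => -[t x] /=; rewrite /psi; congr (phi (_, _)).
    by rewrite mxE unlift_none.
  by apply/rowP => j; rewrite !mxE liftK.
apply: measurableT_comp; first apply: measurableT_comp.
- exact: continuous_measurable_rV.
- exact: measurable_cons_row.
- exact: measurable_fun_pair.
Qed.

Lemma measurable_dt phi : smooth phi ->
  measurable_fun setT (fun z : measurableTypeR R * E => dt phi z.1 z.2).
Proof.
move=> sphi.
have -> : (fun z : measurableTypeR R * E => dt phi z.1 z.2) = 'D_((1 : R), 0 : E) phi.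
  by apply/funext => -[].
by apply: continuous_measurable_spacetime; exact: smooth_continuous_derive.
Qed.

Lemma measurable_gradient phi : smooth phi ->
  measurable_field setT
    (fun z : measurableTypeR R * E => gradient (fun y => phi (z.1, y)) z.2).
Proof.
move=> sphi i.
have -> : (fun z : measurableTypeR R * E => gradient (fun y => phi (z.1, y)) z.2 0 i) =
    'D_((0 : R), delta_mx 0 i : E) phi.
  by apply/funext => -[t x]; rewrite gradient_section.
by apply: continuous_measurable_spacetime; exact: smooth_continuous_derive.
Qed.

End spacetime.

(** * Polynomial changes of time *)

Section time_change.
Context {R : realType} {n : nat}.
Local Notation E := ('rV[R]_n).
Implicit Types (f : R * E -> R) (S c : {poly R}).

Lemma cvg_horner_quotient S (t a : R) :
  h^-1 * (S.[t + h * a] - S.[t]) @[h --> (0 : R)^'] --> a * S^`().[t].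
Proof.
have E1 : 'D_1 (horner S) = horner S^`().
  by apply/funext => x; rewrite -derive1E derivE.
have H := @cvg_difference_quotient _ _ (horner S) (1 : R) t 0^' _ (cst t)
  (fun h => a * h) a.
rewrite E1 in H.
have {}H := H _ (fun x => @derivable_horner R S x) (@continuous_horner _ _) (cvg_cst _).
rewrite derivE derive1E; under eq_cvg do rewrite (mulrC _ a) -[a * _]mulr1.
apply: H; last exact: cvg_mulVr_dnbhs0.
rewrite -[X in _ --> X](mulr0 a); apply: cvgMl_tmp; exact: cvg_id_dnbhs0.
Qed.

(** The increment splits into a time step of length S(t + h a) - S(t) and a space step taken at the
    moved time; [cvg_difference_quotient] handles each. *)
Lemma is_derive_time_change f S (t : R) (x : E) (a : R) (w : E) : smooth f ->
  is_derive (t, x) (a, w) (fun z => f (S.[z.1], z.2))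
    (a * S^`().[t] * dt f S.[t] x + 'D_((0 : R), w) f (S.[t], x)).
Proof.
move=> sf; have df := smooth_derivable sf.
have cf v : continuous ('D_v f) by exact: smooth_continuous_derive.
have ch : S.[t + h * a] @[h --> (0 : R)^'] --> S.[t].
  apply: (cvg_comp (fun h => t + h * a) (horner S)); last exact: continuous_horner.
  rewrite -[X in _ `=>` nbhs X]addr0 -[X in _ `=>` nbhs (_ + X)](mul0r a).
  apply: cvgD; first exact: cvg_cst.
  by apply: cvgMr_tmp; exact: cvg_id_dnbhs0.
have ct : h^-1 * (f ((S.[t], x) + (S.[t + h * a] - S.[t]) *: ((1 : R), 0 : E)) - f (S.[t], x))
    @[h --> (0 : R)^'] --> a * S^`().[t] * dt f S.[t] x.
  apply: (@cvg_difference_quotient _ _ f ((1 : R), 0 : E) (S.[t], x) 0^' _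
    (cst (S.[t], x)) (fun h => S.[t + h * a] - S.[t]) (a * S^`().[t])).
  - by move=> z; exact: df.
  - exact: cf.
  - exact: cvg_cst.
  - rewrite -[X in _ --> X](subrr S.[t]); apply: (cvgB ch); exact: cvg_cst.
  - exact: cvg_horner_quotient.
have cx : h^-1 * (f ((S.[t + h * a], x) + h *: ((0 : R), w)) - f (S.[t + h * a], x))
    @[h --> (0 : R)^'] --> 'D_((0 : R), w) f (S.[t], x).
  rewrite -[X in _ --> X]mul1r.
  apply: (@cvg_difference_quotient _ _ f ((0 : R), w) (S.[t], x) 0^' _
    (fun h => (S.[t + h * a], x)) id 1).
  - by move=> z; exact: df.
  - exact: cf.
  - by apply: (@cvg_pair _ _ _ _ (nbhs S.[t]) (nbhs x)) => //; exact: cvg_cst.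
  - exact: cvg_id_dnbhs0.
  - by under eq_cvg do rewrite -[X in _ * X]mul1r; exact: cvg_mulVr_dnbhs0.
pose Q (h : R) : R := h^-1 *: (((fun z => f (S.[z.1], z.2)) \o shift (t, x)) (h *: (a, w)) -
     f (S.[t], x)).
have cQ : Q h @[h --> (0 : R)^'] -->
    a * S^`().[t] * dt f S.[t] x + 'D_((0 : R), w) f (S.[t], x).
  have QE h : Q h =
      h^-1 * (f ((S.[t], x) + (S.[t + h * a] - S.[t]) *: ((1 : R), 0 : E)) - f (S.[t], x)) +
      h^-1 * (f ((S.[t + h * a], x) + h *: ((0 : R), w)) - f (S.[t + h * a], x)).
    rewrite /Q -[LHS]/(h^-1 * (f (S.[h * a + t], h *: w + x) - f (S.[t], x))).
    rewrite -[RHS]/(h^-1 * (f (S.[t] + (S.[t + h * a] - S.[t]) * 1,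
        x + (S.[t + h * a] - S.[t]) *: 0) - f (S.[t], x)) +
      h^-1 * (f (S.[t + h * a] + h * 0, x + h *: w) - f (S.[t + h * a], x))).
    rewrite mulr1 mulr0 scaler0 !addr0 subrKC -mulrDr (addrC (h * a)) (addrC (h *: w)); congr (_ * _).
    by rewrite [RHS]addrC subrKA.
  under eq_cvg do rewrite QE; exact: cvgD ct cx.
apply: DeriveDef; first exact: cvgP cQ.
exact: cvg_lim cQ.
Qed.

(** Differentiating f(S(t), x) produces factors S'(t), hence the polynomial coefficients and the
    sums: this is a class stable under derivatives, as [smooth_intro] requires. *)
Inductive time_changed S : (R * E -> R) -> Prop :=
| time_changed_base c f : smooth f -> time_changed S (fun z => c.[z.1] * f (S.[z.1], z.2))
| time_changedD g h : time_changed S g -> time_changed S h -> time_changed S (fun z => g z + h z).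

Let is_derive_fst_horner c (t : R) (x : E) (a : R) (w : E) :
  is_derive (t, x) (a, w) (fun z => c.[z.1]) (a * c^`().[t]).
Proof.
have cF := @cvg_horner_quotient c t a.
have FE : (fun h : R => h^-1 * (c.[t + h * a] - c.[t])) =
    (fun h : R => h^-1 *: (((fun z : R * E => c.[z.1]) \o shift (t, x)) (h *: (a, w)) - c.[t])).
  by apply/funext => h; rewrite (addrC t).
rewrite FE in cF; apply: DeriveDef; first exact: cvgP cF.
exact: cvg_lim cF.
Qed.

Let is_derive_base c S f (t : R) (x : E) (a : R) (w : E) : smooth f ->
  is_derive (t, x) (a, w) (fun z => c.[z.1] * f (S.[z.1], z.2))
    ((a *: c^`()).[t] * f (S.[t], x) + ((a *: (c * S^`())).[t] * dt f S.[t] x +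
     c.[t] * 'D_((0 : R), w) f (S.[t], x))).
Proof.
move=> sf.
have := @is_deriveM _ _ (fun z => c.[z.1]) (fun z => f (S.[z.1], z.2)) (t, x) (a, w) _ _
  (is_derive_fst_horner c t x a w) (@is_derive_time_change f S t x a w sf).
move=> /(@is_derive_eq _ _ _ _ _ _ _); apply.
rewrite !hornerE /=.
rewrite -[c.[t] *: _]/(c.[t] * _) -[f (S.[t], x) *: _]/(f (S.[t], x) * _).
ring.
Qed.

Let time_changed_derivable S g : time_changed S g ->
  continuous g /\ forall x v, derivable g x v.
Proof.
elim=> [c f sf|{}g h _ [cg dg] _ [ch dh]]; split.
- move=> z; apply: cvgM.
    by apply: (cvg_comp fst (horner c)); [exact: cvg_fst|exact: continuous_horner].
  apply: (cvg_comp (fun z : R * E => (S.[z.1], z.2)) f); last exact: (smooth_continuous sf).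
  apply: (@cvg_pair _ _ _ _ (nbhs S.[z.1]) (nbhs z.2)); last exact: cvg_snd.
  by apply: (cvg_comp fst (horner S)); [exact: cvg_fst|exact: continuous_horner].
- move=> [t x] [a w]; exact: (@ex_derive _ _ _ _ _ _ _ (is_derive_base c S t x a w sf)).
- by move=> z; apply: cvgD; [exact: cg|exact: ch].
- by move=> x v; exact: (@derivableD _ _ _ g h).
Qed.

Lemma smooth_time_change f S : smooth f -> smooth (fun z => f (S.[z.1], z.2)).
Proof.
move=> sf; apply: (@smooth_intro _ _ (time_changed S)); last first.
- have -> : (fun z : R * E => f (S.[z.1], z.2)) = (fun z => (1 : {poly R}).[z.1] * f (S.[z.1], z.2)).
    by apply/funext => z; rewrite hornerC mul1r.
  exact: time_changed_base.
- move=> g v; elim=> [c {}f {}sf|{}g h Pg IHg Ph IHh].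
    case: v => a w.
    have -> : 'D_(a, w) (fun z => c.[z.1] * f (S.[z.1], z.2)) =
      (fun z => (a *: c^`()).[z.1] * f (S.[z.1], z.2) +
        ((a *: (c * S^`())).[z.1] * 'D_((1 : R), 0 : E) f (S.[z.1], z.2) +
         c.[z.1] * 'D_((0 : R), w) f (S.[z.1], z.2))).
      apply/funext => -[t x]; apply: derive_val; exact: is_derive_base.
    apply: time_changedD; first exact: time_changed_base.
    apply: time_changedD.
      by apply: (@time_changed_base S _ ('D_((1 : R), 0 : E) f)); exact: smooth_derive.
    by apply: (@time_changed_base S _ ('D_((0 : R), w) f)); exact: smooth_derive.
  have -> : 'D_v (fun z => g z + h z) = (fun z => 'D_v g z + 'D_v h z).
    apply/funext => z; apply: (@deriveD _ _ _ g h).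
      exact: (time_changed_derivable Pg).2.
    exact: (time_changed_derivable Ph).2.
  exact: time_changedD.
- exact: time_changed_derivable.
Qed.

End time_change.

(** * Polynomial approximation *)

Section weierstrass.
Context {R : realType}.
Implicit Types (g h : nat -> R) (x c : R) (f : R -> R).

(** Bernstein polynomial with respect to the values g 0, ..., g n: at x it is the mean of g(X) for a
    binomial variable X of parameters n and x. The recursion conditions on one trial. *)
Fixpoint bernstein (n : nat) g : {poly R} :=
  if n is k.+1 then 'X * bernstein k (g \o S) + (1 - 'X) * bernstein k g
  else (g 0)%:P.

Lemma le_bernstein n g h x : 0 <= x <= 1 -> (forall k, g k <= h k) ->
  (bernstein n g).[x] <= (bernstein n h).[x].
Proof.
move=> /andP[x0 x1]; elim: n g h => [|n IH] g h gh /=; first by rewrite !hornerE.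
rewrite !hornerE lerD// ler_wpM2l ?subr_ge0//; first exact: IH (fun k => gh k.+1).
exact: IH.
Qed.

(** Second moment of the binomial variable about c: its variance n x (1 - x) plus the squared
    distance of its mean to c. *)
Lemma bernstein_sqr_dist n x c a b :
  (bernstein n (fun k => a + b * (k%:R - c) ^+ 2)).[x] =
  a + b * (n%:R * x * (1 - x) + (n%:R * x - c) ^+ 2).
Proof.
elim: n c => [|n IH] c /=; first by rewrite !hornerE; ring.
rewrite !hornerE IH.
have -> : (fun k => a + b * (k%:R - c) ^+ 2) \o S =
    (fun k => a + b * (k%:R - (c - 1)) ^+ 2).
  by apply/funext => k /=; rewrite -natr1 opprB addrA addrAC.
rewrite IH -natr1; ring.
Qed.

(** The pairs on which f differs by at least e form a compact set; there |x - y| attains its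
    minimum, which is positive. *)
Lemma unif_continuous01 f (e : R) : continuous f -> 0 < e ->
  exists2 d, 0 < d & forall x y, 0 <= x <= 1 -> 0 <= y <= 1 -> `|x - y| < d ->
    `|f x - f y| < e.
Proof.
move=> cf e0.
pose A := [set z : R * R | [/\ 0 <= z.1 <= 1, 0 <= z.2 <= 1 & e <= `|f z.1 - f z.2|]].
have cA : compact A.
  pose g (z : R * R) := `|f z.1 - f z.2|.
  have cg : continuous g.
    move=> z; apply: cvg_norm; apply: cvgB.
      by apply: (cvg_comp fst f); [exact: cvg_fst|exact: cf].
    by apply: (cvg_comp snd f); [exact: cvg_snd|exact: cf].
  have -> : A = (`[0, 1] `*` `[0, 1]) `&` g @^-1` [set y | e <= y].
    apply/seteqP; split => [z [z1 z2 z3]|z [/= []]]; rewrite /= ?in_itv/=; first by [].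
    by move=> z1 z2 z3.
  apply: compact_closedI; first by apply: compact_setX; exact: segment_compact.
  by apply: preimage_closed => [z _|]; [exact: cg|exact: closed_ge].
have [A0|/set0P/negP/negPn/eqP A0] := pselect (A !=set0); last first.
  exists 1 => // x y x01 y01 _; rewrite ltNge; apply/negP => xy.
  suff : A (x, y) by rewrite A0.
  by [].
have cd : continuous (fun z : R * R => `|z.1 - z.2|).
  by move=> z; apply: cvg_norm; apply: cvgB; [exact: cvg_fst|exact: cvg_snd].
have [[a b]] := compact_EVT_min A0 cA (continuous_subspaceT cd).
rewrite inE => -[/= _ _ eab] mn; exists `|a - b|.
  rewrite normr_gt0 subr_eq0; apply/eqP => ab.
  by move: eab; rewrite ab subrr normr0 leNgt e0.
move=> x y x01 y01; rewrite !ltNge; apply: contra => xy.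
by apply: (mn (x, y)); rewrite inE.
Qed.

Lemma bounded01 f : continuous f -> exists2 M, 0 <= M & forall x, 0 <= x <= 1 -> `|f x| <= M.
Proof.
move=> cf; have cn : continuous (fun x => `|f x|) by move=> x; apply: cvg_norm; exact: cf.
have [c _ mx] := EVT_max ler01 (continuous_subspaceT cn).
by exists `|f c| => // x x01; apply: mx; rewrite in_itv.
Qed.

(** Chebyshev's argument: |f(k/n) - f(x)| <= e/2 + K (k/n - x)^2 with K = 2M / d^2, and the binomial
    mean of the last term is at most K / n. *)
Lemma weierstrass f (e : R) : continuous f -> 0 < e ->
  exists P : {poly R}, forall x, 0 <= x <= 1 -> `|P.[x] - f x| <= e.
Proof.
move=> cf e0; have e20 : 0 < e / 2 by rewrite divr_gt0.
have [d d0 dP] := unif_continuous01 cf e20.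
have [M M0 MP] := bounded01 cf.
(* Chosen so that K / n <= e / 2. *)
pose n := (Num.trunc (2 * M / (d ^+ 2 * (e / 2)))).+1.
have n0 : 0 < n%:R :> R by rewrite ltr0n.
(* [le_bernstein] compares values at all naturals k, also beyond n; clamping keeps the argument in
   [0, 1] and brings it no further from x. *)
exists (bernstein n (fun k => f (clamp01 (k%:R / n%:R)))) => x x01.
pose K := 2 * M / d ^+ 2.
have K0 : 0 <= K by rewrite divr_ge0 ?sqr_ge0// mulr_ge0.
have est k : `|f (clamp01 (k%:R / n%:R)) - f x| <= e / 2 + K / n%:R ^+ 2 * (k%:R - n%:R * x) ^+ 2.
  have y01 := clamp01_in (k%:R / n%:R : R); set y := clamp01 _ in y01 *.
  rewrite /= in_itv/= in y01.
  have -> : K / n%:R ^+ 2 * (k%:R - n%:R * x) ^+ 2 = K * (k%:R / n%:R - x) ^+ 2.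
    by field; rewrite gt_eqF.
  have [yx|yx] := ltP `|y - x| d.
    by rewrite (le_trans (ltW (dP y x y01 x01 yx)))// lerDl mulr_ge0 ?sqr_ge0.
  rewrite (le_trans (ler_normB _ _))// (le_trans (lerD (MP y y01) (MP x x01)))//.
  have : M + M <= K * (k%:R / n%:R - x) ^+ 2.
    have yx2 : `|y - x| <= `|k%:R / n%:R - x|.
      rewrite /y /clamp01; move: x01 => /andP[x0 x1].
      have kn0 : 0 <= k%:R / n%:R :> R by rewrite divr_ge0// ler0n.
      rewrite /Num.max /Num.min; case: ifPn => [_|]; case: ifPn => //.
      - rewrite -leNgt => k1; rewrite !ger0_norm ?subr_ge0//; last exact: le_trans k1.
        exact: lerB.
      - by move=> _; rewrite -leNgt => kn1; rewrite (@le_anti _ _ (k%:R / n%:R) 0)// kn1 kn0.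
      - by rewrite ltr01.
    have -> : M + M = 2 * M by ring.
    rewrite -(real_normK (num_real (_ - _))) /K mulrAC ler_pdivlMr ?exprn_gt0//.
    rewrite ler_wpM2l ?mulr_ge0// lerXn2r ?nnegrE// ?(ltW d0)//.
    exact: le_trans yx yx2.
  by move=> /le_trans; apply; rewrite lerDr ltW.
have tot a b : (bernstein n (fun k => a + b * (k%:R - n%:R * x) ^+ 2)).[x] =
    a + b * (n%:R * x * (1 - x)).
  by rewrite bernstein_sqr_dist subrr expr0n /= addr0.
have Kn : K / n%:R ^+ 2 * (n%:R * x * (1 - x)) <= e / 2.
  have -> : K / n%:R ^+ 2 * (n%:R * x * (1 - x)) = K / n%:R * (x * (1 - x)).
    by field; rewrite gt_eqF.
  have x1 : x * (1 - x) <= 1 by move: x01 => /andP[? ?]; nra.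
  have Kn0 : 0 <= K / n%:R by rewrite divr_ge0// ltW.
  rewrite (le_trans (ler_wpM2l Kn0 x1))// mulr1.
  rewrite ler_pdivrMr// mulrC -ler_pdivrMr// (le_trans _ (ltW (truncnS_gt _)))//.
  by rewrite /K [in leRHS]invfM mulrA.
rewrite ler_norml; apply/andP; split.
  have : (bernstein n (fun k => (f x - e / 2) + - (K / n%:R ^+ 2) * (k%:R - n%:R * x) ^+ 2)).[x]
      <= (bernstein n (fun k => f (clamp01 (k%:R / n%:R)))).[x].
    apply: le_bernstein => // k; have := est k; rewrite ler_norml => /andP[+ _]; lra.
  rewrite tot; lra.
have : (bernstein n (fun k => f (clamp01 (k%:R / n%:R)))).[x] <=
   (bernstein n (fun k => (f x + e / 2) + (K / n%:R ^+ 2) * (k%:R - n%:R * x) ^+ 2)).[x].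
  apply: le_bernstein => // k; have := est k; rewrite ler_norml => /andP[_]; lra.
rewrite tot; lra.
Qed.

(** For i = 0 the quotient by zero is 0, so this is the primitive that vanishes at 0. *)
Definition primitive (Q : {poly R}) : {poly R} :=
  \poly_(i < (size Q).+1) (Q`_i.-1 / i%:R).

Lemma deriv_primitive Q : (primitive Q)^`() = Q.
Proof.
apply/polyP => i; rewrite coef_deriv coef_poly ltnS.
have [iQ|iQ] := ltnP i (size Q); last by rewrite mul0rn nth_default.
by rewrite -[LHS]mulr_natr divfK// pnatr_eq0.
Qed.

Lemma primitive0 Q : (primitive Q).[0] = 0.
Proof. by rewrite horner_coef0 coef_poly /= invr0 mulr0. Qed.

Lemma primitive_nondecreasing Q : (forall x, 0 <= Q.[x]) ->
  {homo horner (primitive Q) : x y / x <= y}.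
Proof.
move=> Q0 x y xy; have dP z : is_derive z (1 : R) (horner (primitive Q)) Q.[z].
  by rewrite -[in Q.[z]](deriv_primitive Q); exact: is_derive_poly.
have [z _ E] := MVT_segment xy (fun z _ => dP z)
  (continuous_subspaceT (@continuous_horner _ (primitive Q))).
by rewrite -subr_ge0 E mulr_ge0// subr_ge0.
Qed.

Lemma integral_horner Q (t : R) : 0 <= t ->
  (\int[lebesgue_measure]_(x in `[0%R, t]%classic) (Q.[x])%:E = ((primitive Q).[t])%:E)%E.
Proof.
rewrite le_eqVlt => /predU1P[<-|t0].
  by rewrite set_itv1 integral_set1 primitive0.
rewrite (@continuous_FTC2 _ (horner Q) (horner (primitive Q)))//.
- by rewrite primitive0 sube0.
- exact/continuous_subspaceT/continuous_horner.
- split.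
  + by move=> x _; exact: derivable_horner.
  + by apply: cvg_at_right_filter; exact: continuous_horner.
  + by apply: cvg_at_left_filter; exact: continuous_horner.
- by move=> x _; rewrite -derivE deriv_primitive.
Qed.

(** A continuous g is close to f in L^1; the square root of max(0, g) is uniformly close to a
    polynomial P, and P^2 is the approximation. Truncation at 0 does not increase the distance to f,
    because f >= 0. *)
Lemma poly_sqr_approx (f : R -> R) (e : R) : 0 < e -> (forall x, 0 <= f x) ->
  lebesgue_measure.-integrable `[0, 1] (EFin \o f) ->
  exists2 Q : {poly R}, forall x, 0 <= Q.[x] &
    (\int[lebesgue_measure]_(x in `[0%R, 1%R]%classic) `|f x - Q.[x]|%:E <= e%:E)%E.
Proof.
move=> e0 f0 intf; have e20 : 0 < e / 2 by rewrite divr_gt0.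
have I01f : (lebesgue_measure (`[0%R, 1%R]%classic : set R) < +oo)%E.
  by rewrite [X in (X < _)%E]lebesgue_measure01 ltry.
have [g [cg ig]] := approximation_continuous_integrable (measurable_itv _) I01f intf.
move=> /fine_cvgP[fn /cvgrPdist_lt/(_ _ e20) lt].
have [k [fk ltk]] := @filter_ex _ _ _ _ (filterI fn lt).
have {}ltk : (\int[lebesgue_measure]_(x in `[0%R, 1%R]%classic) `|f x - g k x|%:E <= (e / 2)%:E)%E.
  rewrite -(fineK fk) lee_fin ltW// (le_lt_trans (ler_norm _))//.
  by move: ltk; rewrite sub0r normrN.
pose h x := Num.sqrt (Num.max 0 (g k x)).
have ch : continuous h.
  move=> x; apply: (cvg_comp (fun x => Num.max 0 (g k x)) Num.sqrt); last exact: sqrt_continuous.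
  have hm : {for x, continuous ((cst 0 : R -> R^o) \max g k)}.
    by apply: continuous_max; [exact: cst_continuous|exact: cg].
  exact: hm.
have [H H0 HP] := bounded01 ch.
(* d <= 1 gives |h + P| <= 2H + 1; the other bound then makes |h^2 - P^2| at most e / 2. *)
pose d := Num.min 1 (e / 2 / (2 * H + 1)).
have H1 : 0 < 2 * H + 1 by rewrite ltr_wpDl// mulr_ge0.
have d0 : 0 < d by rewrite lt_min ltr01 divr_gt0.
have [P PP] := weierstrass ch d0.
have PE x : (P ^+ 2).[x] = P.[x] ^+ 2 by rewrite !expr2 hornerM.
exists (P ^+ 2) => [x|]; first by rewrite PE sqr_ge0.
have le1 x : `[0, 1]%classic x -> `|f x - (P ^+ 2).[x]| <= `|f x - g k x| + e / 2.
  rewrite /= in_itv/= => x01; rewrite PE.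
  have h2 : h x ^+ 2 = Num.max 0 (g k x) by rewrite sqr_sqrtr// le_max lexx.
  have l1 : `|f x - h x ^+ 2| <= `|f x - g k x|.
    rewrite h2 /Num.max; case: ifPn => // /negP/negP; rewrite -leNgt => g0.
    by rewrite subr0 !ger0_norm ?subr_ge0// ?(le_trans g0)// lerDl oppr_ge0.
  have l2 : `|h x ^+ 2 - P.[x] ^+ 2| <= e / 2.
    rewrite subr_sqr normrM distrC.
    have a1 : `|h x + P.[x]| <= 2 * H + 1.
      have -> : h x + P.[x] = 2 * h x + (P.[x] - h x) by ring.
      rewrite (le_trans (ler_normD _ _))// lerD//.
        by rewrite normrM ger0_norm// ler_wpM2l// HP.
      by rewrite (le_trans (PP x x01))// ge_min lexx.
    have a2 : `|P.[x] - h x| <= e / 2 / (2 * H + 1).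
      by rewrite (le_trans (PP x x01))// ge_min lexx orbT.
    rewrite (le_trans (ler_pM _ _ a2 a1))//.
    by rewrite divfK// gt_eqF.
  have -> : f x - P.[x] ^+ 2 = (f x - h x ^+ 2) + (h x ^+ 2 - P.[x] ^+ 2) by ring.
  by rewrite (le_trans (ler_normD _ _))// lerD.
have mf : measurable_fun (`[0, 1]%classic : set R) f.
  by apply/measurable_EFinP; exact: measurable_int intf.
have mfg : measurable_fun (`[0, 1]%classic : set R) (fun x => `|f x - g k x|).
  apply: measurableT_comp => //; apply: measurable_funB => //.
  by apply/measurable_EFinP; exact: measurable_int (ig k).
apply: (@le_trans _ _ (\int[lebesgue_measure]_(x in `[0%R, 1%R]%classic)
  (`|f x - g k x|%:E + (e / 2)%:E))%E).
  apply: ge0_le_integral => //.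
  - apply/measurable_EFinP; apply: measurableT_comp => //; apply: measurable_funB => //.
    by apply: measurable_funTS; apply: continuous_measurable_fun; exact: continuous_horner.
  - by apply: emeasurable_funD => //; exact/measurable_EFinP.
rewrite ge0_integralD//; last 2 first.
- exact/measurable_EFinP.
- by move=> x _; rewrite lee_fin ltW.
rewrite [X in (_ + X)%E](_ : _ = (e / 2)%:E); last first.
  apply: etrans; first exact: integral_cst.
  by rewrite -[RHS]mule1; congr (_ * _)%E; exact: lebesgue_measure01.
have -> : (e%:E = (e / 2)%:E + (e / 2)%:E)%E by rewrite -EFinD -splitr.
by rewrite leeD2r.
Qed.

End weierstrass.

(** * Essential suprema *)

Section lower_integral.
Context d (T : measurableType d) (R : realType) (mu : {measure set T -> \bar R}).
Implicit Types (D : set T) (f g : T -> \bar R).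

(* The library integral of a nonnegative function is a supremum over simple
   functions below it, hence monotone without any measurability. *)
Lemma le_ge0_integral D f g : (forall x, D x -> 0 <= f x)%E ->
  (forall x, D x -> f x <= g x)%E ->
  (\int[mu]_(x in D) f x <= \int[mu]_(x in D) g x)%E.
Proof.
move=> f0 fg; have g0 x : D x -> (0 <= g x)%E by move=> Dx; exact: le_trans (f0 x Dx) (fg x Dx).
rewrite !ge0_integralE//; apply: le_ereal_sup => _ [h /= hf <-]; exists h => //= x.
rewrite (le_trans (hf x))// !patchE; case: ifPn => // xD; apply: fg; exact/set_mem.
Qed.

Lemma measurable_bigmax (I : Type) (s : seq I) (g : I -> T -> R) :
  (forall i, measurable_fun setT (g i)) ->
  measurable_fun setT (fun x => \big[Num.max/0]_(i <- s) g i x).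
Proof.
move=> mg; elim: s => [|i s IH].
  by under eq_fun do rewrite big_nil; exact: measurable_cst.
by under eq_fun do rewrite big_cons; exact: measurable_maxr.
Qed.

Lemma integral_nondecreasing_limit_le (u : nat -> T -> R) (m : \bar R) :
  (forall k, measurable_fun setT (u k)) -> (forall k x, 0 <= u k x) ->
  (forall x, {homo u ^~ x : k l / (k <= l)%N >-> k <= l}) ->
  (forall k, \int[mu]_x (u k x)%:E <= m)%E ->
  (\int[mu]_x limn (fun k => (u k x)%:E) <= m)%E.
Proof.
move=> mu0 u0 ndu um; rewrite monotone_convergence//; last 3 first.
- by move=> k; exact/measurable_EFinP.
- by move=> k x _; rewrite lee_fin.
- by move=> x _ k l kl; rewrite lee_fin; exact: ndu.
apply: lime_le; last exact: nearW.
apply: ereal_nondecreasing_is_cvgn => k l kl; apply: le_ge0_integral => x _.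
  by rewrite lee_fin.
by rewrite lee_fin; exact: ndu.
Qed.

(* Maximising the integral of a finite maximum replaces the separability
   argument usually needed for an essential supremum. *)
Lemma essential_upper_bound (I : Type) (g : I -> T -> R) (F : T -> \bar R) :
  (forall i, measurable_fun setT (g i)) -> (forall i x, (g i x)%:E <= F x)%E ->
  (forall x, 0 <= F x)%E -> (\int[mu]_x F x < +oo)%E ->
  exists lam : T -> R, [/\ measurable_fun setT lam, forall x, 0 <= lam x,
    (\int[mu]_x (lam x)%:E <= \int[mu]_x F x)%E &
    forall i, {ae mu, forall x, g i x <= lam x}].
Proof.
move=> mg gF F0 Foo; pose G (s : seq I) x := \big[Num.max/0]_(i <- s) g i x.
have mG s : measurable_fun setT (G s) by exact: measurable_bigmax.
have G0 s x : 0 <= G s x.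
  by rewrite /G; elim: s => [|i s IH]; rewrite ?big_nil// big_cons le_max IH orbT.
have GF s x : ((G s x)%:E <= F x)%E.
  rewrite /G; elim: s => [|i s IH]; first by rewrite big_nil.
  by rewrite big_cons /Num.max; case: ifP.
have Gcat s t x : G t x <= G (s ++ t) x.
  by rewrite /G; elim: s => //= i s IH; rewrite big_cons le_max IH orbT.
have Gcat' s t x : G s x <= G (s ++ t) x.
  rewrite /G; elim: s => [|i s IH]; first by rewrite big_nil; exact: G0.
  by rewrite /= !big_cons ge_max !le_max lexx IH orbT.
have Gcons i s t x : G s x <= G t x -> G (i :: s) x <= G (i :: t) x.
  by move=> st; rewrite /G !big_cons ge_max !le_max lexx -/(G t x) -/(G s x) st orbT.
pose A := [set \int[mu]_x (G s x)%:E | s in [set: seq I]]%E.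
pose m := ereal_sup A.
have mF : (m <= \int[mu]_x F x)%E.
  apply: ge_ereal_sup => _ [s _ <-]; apply: le_ge0_integral => x _ //.
  by rewrite lee_fin.
have Gm s : (\int[mu]_x (G s x)%:E <= m)%E by apply: ereal_sup_ubound; exists s.
have m0 : (0 <= m)%E by apply: le_trans (Gm [::]); apply: integral_ge0 => x _; rewrite lee_fin.
have mfin : m \is a fin_num by rewrite ge0_fin_numE// (le_lt_trans mF).
have /choice[s sP] : forall k : nat, exists s, (m - (k.+1%:R^-1)%:E <= \int[mu]_x (G s x)%:E)%E.
  move=> k; have k0 : 0 < k.+1%:R^-1 :> R by rewrite invr_gt0.
  have [_ [s _ <-] /ltW sk] := ub_ereal_sup_adherent k0 mfin.
  by exists s.
(* Concatenating near-optimal families makes the maxima nondecreasing, so that their limit H has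
   integral exactly m. *)
pose S := fix S k := if k is l.+1 then s l.+1 ++ S l else s 0.
have ndS x : {homo (fun k => G (S k) x) : k l / (k <= l)%N >-> k <= l}.
  apply: homo_leq => [y|y z w|k]; [exact: lexx|exact: le_trans|exact: Gcat].
have sS k x : G (s k) x <= G (S k) x by case: k => // k; exact: Gcat'.
pose H x := limn (fun k => (G (S k) x)%:E).
pose K i x := limn (fun k => (G (i :: S k) x)%:E).
have ndK i x : {homo (fun k => G (i :: S k) x) : k l / (k <= l)%N >-> k <= l}.
  by move=> k l kl; apply: Gcons; exact: ndS.
have cH x : cvgn (fun k => (G (S k) x)%:E).
  by apply: ereal_nondecreasing_is_cvgn => k l kl; rewrite lee_fin; exact: ndS.
have cK i x : cvgn (fun k => (G (i :: S k) x)%:E).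
  by apply: ereal_nondecreasing_is_cvgn => k l kl; rewrite lee_fin; exact: ndK.
have mH : measurable_fun setT H.
  apply: (@emeasurable_fun_cvg _ _ _ _ (fun k x => (G (S k) x)%:E)).
    by move=> k; exact/measurable_EFinP.
  by move=> x _; exact: cH.
have mK i : measurable_fun setT (K i).
  apply: (@emeasurable_fun_cvg _ _ _ _ (fun k x => (G (i :: S k) x)%:E)).
    by move=> k; exact/measurable_EFinP.
  by move=> x _; exact: cK.
have H0 x : (0 <= H x)%E.
  by apply: lime_ge => //; apply: nearW => k; rewrite lee_fin.
have HK i x : (H x <= K i x)%E.
  apply: lee_lim => //; apply: nearW => k; rewrite lee_fin.
  exact: (Gcat [:: i]).
have gK i x : ((g i x)%:E <= K i x)%E.
  apply: lime_ge => //; apply: nearW => k; rewrite lee_fin /G big_cons le_max lexx//.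
have K0 i x : (0 <= K i x)%E by exact: le_trans (HK i x).
have iHm : (\int[mu]_x H x <= m)%E by apply: integral_nondecreasing_limit_le.
have iKm i : (\int[mu]_x K i x <= m)%E by apply: integral_nondecreasing_limit_le.
have iH : (\int[mu]_x H x = m)%E.
  apply/eqP; rewrite eq_le iHm/=; apply/lee_addgt0Pr => e e0.
  pose k := Num.trunc e^-1.
  have ke : k.+1%:R^-1 <= e.
    by rewrite -[leRHS]invrK lef_pV2 ?posrE ?invr_gt0// ltW// truncnS_gt.
  rewrite -leeBlDr// (le_trans _ (le_trans (sP k) _))//.
    by apply: leeB => //; rewrite lee_fin.
  apply: le_ge0_integral => x _; first by rewrite lee_fin.
  apply: lime_ge => //; exists k => // l /= kl; rewrite lee_fin.
  by rewrite (le_trans (sS k x))//; exact: ndS.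
have integrH : mu.-integrable setT H.
  apply/integrableP; split => //; under eq_integral do rewrite gee0_abs//.
  by rewrite iH ltey_eq mfin.
have integrK i : mu.-integrable setT (K i).
  apply/integrableP; split => //; under eq_integral do rewrite gee0_abs//.
  by rewrite (le_lt_trans (iKm i))// ltey_eq mfin.
exists (fine \o H); split.
- exact: measurableT_comp.
- by move=> x; exact: fine_ge0.
- rewrite (le_trans _ mF)// -iH; apply: le_ge0_integral => x _.
    by rewrite lee_fin fine_ge0.
  by have := H0 x; rewrite /=; case: (H x) => // _; rewrite leey.
(* K i is the limit once g i has joined every family. It lies above H, yet its integral is at most
   m, the integral of H; so K i = H almost everywhere, while g i <= K i. *)
- move=> i; have iB := integrableB measurableT (integrK i) integrH.
  have B0 : (\int[mu]_x `|K i x - H x| = 0)%E.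
    have BE : {ae mu, forall x, setT x -> `|K i x - H x|%E = (K i x - H x)%E}.
      have := integrable_ae measurableT integrH.
      apply: filterS => x /(_ Logic.I) fH _; apply: gee0_abs.
      by rewrite sube_ge0 ?HK// fH.
    apply/eqP; rewrite eq_le; apply/andP; split; last exact: integral_ge0.
    rewrite (ae_eq_integral (fun x => K i x - H x)%E)//; last 2 first.
    + by apply: measurableT_comp => //; exact: measurable_int iB.
    + exact: measurable_int iB.
    by rewrite integralB// iH sube_le0 ?mfin//; exact: iKm.
  have /(ae_eq_integral_abs mu measurableT (measurable_int _ iB)) aeB := B0.
  have := integrable_ae measurableT (integrK i); have := integrable_ae measurableT integrH.
  move: aeB; apply: filterS3 => x /(_ Logic.I) + /(_ Logic.I) + /(_ Logic.I).
  have := gK i x; rewrite /=; case: (K i x) => // k; case: (H x) => // h.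
  by rewrite lee_fin => gk /eqP; rewrite -EFinB eqe subr_eq0 => /eqP <-.
Qed.

End lower_integral.

(** * Reparametrisation of time *)

Lemma eq_measure_ray (R : realType) (m1 m2 : {measure set (measurableTypeR R) -> \bar R}) :
  (m1 setT < +oo)%E -> (forall a : R, m1 `]-oo, a[%classic = m2 `]-oo, a[%classic) ->
  forall A, measurable A -> m1 A = m2 A.
Proof.
move=> m1T E; apply: (@measure_unique _ R (measurableTypeR R)
  (@measurable_realfun.RGenInftyO.G R) (fun k => `]-oo, k%:R[%classic)
  _ _ _ _ m1 m2).
- exact: measurable_realfun.RGenInftyO.measurableE.
- move=> _ _ [a ->] [b ->]; exists (Num.min a b); apply/seteqP.
  by split => x; rewrite /= !in_itv/= lt_min; [case=> -> ->|move/andP].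
- by move=> k; exists k%:R.
- apply/seteqP; split => // x _; exists (Num.trunc x).+1 => //=.
  by rewrite in_itv/= truncnS_gt.
- by move=> _ [a ->]; exact: E.
- by move=> k; rewrite (le_lt_trans _ m1T)// le_measure ?inE.
Qed.

Section reparametrisation.
Context {R : realType}.
Local Notation mu := (@lebesgue_measure R).
Local Notation I01 := (`[0%R, 1%R]%classic : set R).
Variables (f : R -> R) (c : R).
Hypotheses (mf : measurable_fun setT f) (f0 : forall t, 0 <= f t)
  (c0 : 0 < c) (fc : forall t, I01 t -> c <= f t)
  (fout : forall t, ~ I01 t -> f t = 0)
  (f1 : (\int[mu]_t (f t)%:E = 1)%E).

Let integr : mu.-integrable setT (EFin \o f).
Proof.
apply/integrableP; split; first exact/measurable_EFinP.
under eq_integral do rewrite gee0_abs ?lee_fin//.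
by rewrite f1 ltry.
Qed.

Let integr01 : mu.-integrable I01 (EFin \o f).
Proof. exact: integrableS integr. Qed.

Definition elapsed (t : R) : R := \int[mu]_(x in `[0, t]) f x.

Let elapsed0 : elapsed 0 = 0.
Proof. by rewrite /elapsed set_itv1 Rintegral_set1. Qed.

Lemma elapsed1 : elapsed 1 = 1.
Proof.
rewrite /elapsed /Rintegral (_ : integral _ _ _ = 1%E)// -f1 integral_mkcond.
apply: eq_integral => t _; rewrite patchE; case: ifPn => // /negP tI.
by rewrite fout// => /mem_set.
Qed.

Let continuous_elapsed : {within `[0, 1], continuous elapsed}.
Proof. exact: parameterized_integral_continuous. Qed.

(** The lower bound on f gives elapsed y - elapsed x >= c (y - x). *)
Let elapsed_lt : {in `[0, 1] &, {homo elapsed : x y / x < y}}.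
Proof.
move=> x y; rewrite !in_itv/= => /andP[x0 x1] /andP[y0 y1] xy.
have iy : mu.-integrable `[0%R, y]%classic (EFin \o f).
  by apply: integrableS integr.
rewrite -subr_gt0 /elapsed (@Rintegral_itvB _ f (BLeft 0) (BRight y) x)//; last by rewrite bnd_simp ltW.
rewrite (@lt_le_trans _ _ (c * (y - x)))//; first by rewrite mulr_gt0// subr_gt0.
have -> : c * (y - x) = \int[mu]_(t in `]x, y]) c.
  rewrite Rintegral_cst//; congr (_ * _).
  rewrite [X in fine X](_ : _ = (y - x)%:E)//.
  by apply: etrans; [exact: lebesgue_measure_itv|rewrite /= lte_fin xy].
apply: le_Rintegral => //.
- apply/integrableP; split; first exact: measurable_cst.
  rewrite integral_cst//= lebesgue_measure_itv/= lte_fin xy.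
  by rewrite -EFinD -EFinM ltry.
- by apply: integrableS integr.
- move=> t; rewrite /= in_itv/= => /andP[xt ty]; apply: fc.
  by rewrite /= in_itv/= (le_trans x0 (ltW xt)) (le_trans ty y1).
Qed.

Let elapsed_le : {in `[0, 1] &, {mono elapsed : x y / x <= y}}.
Proof. exact: le_mono_in elapsed_lt. Qed.

Let elapsed01 t : I01 t -> I01 (elapsed t).
Proof.
move=> t01; have t01' : t \in `[0, 1] by [].
have e0 : 0 <= elapsed t by rewrite -[leLHS]elapsed0 elapsed_le ?bound_itvE// (itvP t01').
have e1 : elapsed t <= 1 by rewrite -[leRHS]elapsed1 elapsed_le ?bound_itvE// (itvP t01').
by rewrite /= in_itv/= e0 e1.
Qed.

Lemma elapsed_inverse : exists tau : R -> R,
  [/\ continuous tau, forall s, I01 (tau s), tau 0 = 0, tau 1 = 1 &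
   (forall s, I01 s -> elapsed (tau s) = s) /\
   forall t, I01 t -> I01 (elapsed t) /\ tau (elapsed t) = t].
Proof.
(* Clamping s makes the inverse constant on either side of [0, 1], hence defined on the whole
   line. *)
have /choice[tau tauP] : forall s, exists t, I01 t /\ elapsed t = clamp01 s.
  move=> s; have := clamp01_in s; rewrite /= in_itv/= => /andP[s0 s1].
  have [|t t01 ts] := @IVT _ elapsed 0 1 (clamp01 s) ler01 continuous_elapsed.
    by rewrite elapsed0 elapsed1 min_l// max_r// s0.
  by exists t.
have inj x y : I01 x -> I01 y -> elapsed x = elapsed y -> x = y.
  move=> x01 y01 xy; apply/eqP; rewrite eq_le.
  by rewrite -(elapsed_le x01 y01) -(elapsed_le y01 x01) xy lexx.
have tauK s : I01 s -> elapsed (tau s) = s.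
  by move=> s01; rewrite (tauP s).2 clamp01_id.
have tauE t : I01 t -> tau (elapsed t) = t.
  move=> t01; apply: inj => //; first exact: (tauP _).1.
  by rewrite tauK//; exact: elapsed01.
have tau_clamp : tau = tau \o clamp01.
  apply/funext => s; apply: inj; [exact: (tauP _).1|exact: (tauP _).1|].
  by rewrite !(tauP _).2 (clamp01_id (clamp01_in s)).
have I0 : I01 0 by rewrite /= in_itv/= lexx ler01.
have I1 : I01 1 by rewrite /= in_itv/= lexx ler01.
have tau0 : tau 0 = 0 by rewrite -[X in tau X]elapsed0 tauE.
have tau1 : tau 1 = 1 by rewrite -[X in tau X]elapsed1 tauE.
exists tau; split => //.
- rewrite tau_clamp; apply: continuous_comp_clamp01.
  apply: segment_inc_surj_continuous.
    move=> x y x01 y01; rewrite -elapsed_le ?tauK//; exact: (tauP _).1.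
  move=> t; rewrite tau0 tau1 => t01; exists (elapsed t); last exact: tauE.
  exact: elapsed01.
- by move=> s; exact: (tauP s).1.
- by split => // t t01; split; [exact: elapsed01|exact: tauE].
Qed.

Lemma continuous_elapsed_clamp01 : continuous (elapsed \o clamp01).
Proof. exact: continuous_comp_clamp01 continuous_elapsed. Qed.

(** The image of Lebesgue measure on [0, 1] under tau is f dt. It suffices to compare these finite
    measures on rays: for a in ]0, 1], the ray below a pulls back to [0, elapsed a[ within [0, 1].
    Nothing is differentiated. *)
Lemma ge0_integral_reparametrised (tau : R -> R) (h : R -> \bar R) :
  continuous tau -> (forall s, I01 (tau s)) ->
  (forall s, I01 s -> elapsed (tau s) = s) ->
  measurable_fun (setT : set (measurableTypeR R)) h -> (forall t, 0 <= h t)%E ->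
  (\int[mu]_(s in I01) h (tau s) = \int[mu]_t (h t * (f t)%:E))%E.
Proof.
move=> ctau tau01 tauK mh h0.
have mtau : measurable_fun (setT : set (measurableTypeR R))
    (tau : measurableTypeR R -> measurableTypeR R) by exact: continuous_measurable_fun.
have mI : measurable_fun setT (\1_I01 : R -> R) by exact: measurable_indic.
have I0 t : 0 <= (\1_I01 t : R) by [].
rewrite -(@ge0_integral_density _ _ _ mu f mf f0 h)//.
have -> : (\int[mu]_(s in I01) h (tau s) = \int[mu]_s ((h \o tau) s * (\1_I01 s)%:E))%E.
  rewrite integral_mkcond; apply: eq_integral => s _; rewrite patchE indicE.
  by case: ifP => _; rewrite ?mule1// mule0.
rewrite -(@ge0_integral_density _ _ _ mu (\1_I01) mI I0 (h \o tau)); last 2 first.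
- exact: measurableT_comp.
- by move=> s; exact: h0.
rewrite -(@ge0_integral_pushforward _ _ (measurableTypeR R) (measurableTypeR R) R
  tau mtau (density mu mI I0) setT h)//.
apply: eq_measure_integral => A mA _.
apply: eq_measure_ray mA => [|a].
  rewrite -[X in (X < _)%E]/(\int[mu]_(x in tau @^-1` setT) (\1_I01 x)%:E)%E.
  rewrite preimage_setT integral_indic// setIT.
  apply: le_lt_trans (ltry 1); rewrite le_eqVlt; apply/orP; left; apply/eqP.
  exact: lebesgue_measure01.
rewrite -[LHS]/(\int[mu]_(x in tau @^-1` `]-oo, a[%classic) (\1_I01 x)%:E)%E.
rewrite -[RHS]/(\int[mu]_(x in `]-oo, a[%classic) (f x)%:E)%E integral_indic//; last first.
  by rewrite -[X in measurable X]setTI; apply: mtau.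
have [a0|a0] := leP a 0.
  rewrite (_ : _ `&` _ = set0) ?measure0; last first.
    apply/seteqP; split => // s [_]; rewrite /= in_itv/=.
    by have := tau01 s; rewrite /= in_itv/= => /andP[/(le_trans a0)]; rewrite leNgt => /negbTE->.
  apply/esym; apply: integral0_eq => t; rewrite /= in_itv/= => ta.
  rewrite fout//= in_itv/= => /andP[t0 _].
  by move: (lt_le_trans ta a0); rewrite ltNge t0.
have [a1|a1] := ltP 1 a.
  rewrite setIidl; last first.
    move=> s _; rewrite /= in_itv/=.
    by have := tau01 s; rewrite /= in_itv/= => /andP[_ /le_lt_trans]; apply.
  apply: etrans; first exact: lebesgue_measure01.
  rewrite -f1 [RHS]integral_mkcond; apply: eq_integral => t _; rewrite patchE.
  case: ifPn => // /negP tI; rewrite fout// => t01; apply: tI.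
  rewrite inE /= in_itv/=.
  by move: t01; rewrite /= in_itv/= => /andP[_ /le_lt_trans]; apply.
have a01 : I01 a by rewrite /= in_itv/= ltW// a1.
have -> : I01 `&` tau @^-1` `]-oo, a[%classic = `[0, elapsed a[%classic.
  have := elapsed01 a01; rewrite /= in_itv/= => /andP[ea0 ea1].
  apply/seteqP; split => s /=; rewrite !in_itv/=.
    move=> [s01 ta]; have := s01 => /andP[-> _] /=.
    by rewrite -[ltLHS]tauK//; apply: elapsed_lt => //; exact: tau01.
  move=> /andP[s0 sa]; have s01 : I01 s.
    by rewrite /= in_itv/= s0 (le_trans (ltW sa)).
  split; first by move: s01; rewrite /= in_itv.
  rewrite ltNge; apply/negP => ta; move: sa; rewrite ltNge => /negP; apply.
  by rewrite -[leRHS]tauK// elapsed_le//; exact: tau01.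
apply: etrans; first exact: lebesgue_measure_itv.
rewrite /= lte_fin.
have ea0 : 0 < elapsed a.
  by rewrite -[ltLHS]elapsed0; apply: elapsed_lt => //; rewrite bound_itvE.
rewrite ea0 oppr0 adde0 /elapsed /Rintegral fineK; last first.
  apply: integrable_fin_num => //; apply: integrableS integr => //.
rewrite -integral_itv_bndo_bndc; last by apply: measurable_funTS; exact/measurable_EFinP.
rewrite [LHS]integral_mkcond [RHS]integral_mkcond; apply: eq_integral => t _.
rewrite !patchE; case: ifPn => [|/negP tI].
  rewrite inE /= in_itv/= => /andP[_ ta].
  by rewrite mem_set//= in_itv.
case: ifPn => //; rewrite inE /= in_itv/= => ta; rewrite fout// => /= t01.
by apply: tI; rewrite inE /= in_itv/= ta; move: t01; rewrite in_itv/= => /andP[->].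
Qed.

End reparametrisation.

(** * Measures swept by a curve *)

Section carried_measure.
Context {R : realType} {n : nat}.
Local Notation E := ('rV[R]_n).
Variables (Omega : set E) (rho : probability E R).
Hypotheses (mO : measurable Omega) (rO : prob_on Omega rho).

(** The complement of Omega is null, so any measurable h that agrees with g on Omega may be
    integrated over the whole space; g can be arbitrary elsewhere. *)
Lemma integral_prob_on (g h : E -> \bar R) : measurable_fun setT h ->
  (forall x, Omega x -> g x = h x) ->
  (\int[rho]_(x in Omega) g x = \int[rho]_x h x)%E.
Proof.
move=> mh gh; rewrite (eq_integral h); last by move=> x /set_mem Ox; exact: gh.
have rC : rho (~` Omega) = 0%E by rewrite probability_setC// [X in (1 - X)%E]rO subee.
have aux (k : E -> \bar R) : measurable_fun setT k -> (forall x, 0 <= k x)%E ->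
    (\int[rho]_(x in Omega) k x = \int[rho]_x k x)%E.
  move=> mk k0; rewrite [RHS](@ge0_negligible_integral _ _ _ _ _ (~` Omega))//.
    by rewrite setTD setCK.
  exact: measurableC.
rewrite integralE [RHS]integralE; congr (_ - _)%E; apply: aux => //.
  exact: measurable_funepos.
exact: measurable_funeneg.
Qed.

Lemma Rintegral_prob_on (g h : E -> R) : measurable_fun setT h ->
  (forall x, Omega x -> g x = h x) ->
  \int[rho]_(x in Omega) g x = \int[rho]_x h x.
Proof.
move=> mh gh; congr fine; apply: integral_prob_on; first exact/measurable_EFinP.
by move=> x Ox; rewrite gh.
Qed.

End carried_measure.

Section curve_fibration.
Context {R : realType} {n : nat}.
Local Notation E := ('rV[R]_n).
Local Notation mu := (@lebesgue_measure R).
Local Notation I01 := (`[0%R, 1%R]%classic : set R).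
Variables (Omega : set E) (rho : R -> probability E R).
Hypotheses (mO : measurable Omega) (crho : curve Omega rho).
Variable f : measurableTypeR R -> R.
Hypotheses (mf : measurable_fun setT f) (f0 : forall t, 0 <= f t)
  (fout : forall t, ~ I01 t -> f t = 0) (f1 : (\int[mu]_t (f t)%:E = 1)%E).

(** The measure f(t) dt rho_t(dx); clamping alters the curve only off [0, 1], where [fout] makes f
    vanish. *)
Definition curve_measure : {finite_measure set (measurableTypeR R * E)%type -> \bar R} :=
  fibered (prob_density mf f0 f1) (curve_measurable crho).

Let section_measurable d (Y : measurableType d) (h : measurableTypeR R * E -> Y) t :
  measurable_fun setT h -> measurable_fun setT (fun x => h (t, x)).
Proof. by move=> mh; apply: (measurableT_comp mh); exact: pair1_measurable. Qed.

Let fE (F G : R -> \bar R) : (forall t, I01 t -> F t = G t) ->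
  (\int[mu]_(t in I01) (F t * (f t)%:E) = \int[mu]_t (G t * (f t)%:E))%E.
Proof.
move=> FG; rewrite integral_mkcond; apply: eq_integral => t _; rewrite patchE.
case: ifPn => [/set_mem tI|/negP tI]; first by rewrite FG.
by rewrite fout ?mule0// => tI'; apply: tI; rewrite inE.
Qed.

Lemma ge0_integral_curve (h : measurableTypeR R * E -> \bar R) (g : R -> E -> \bar R) :
  measurable_fun setT h -> (forall z, 0 <= h z)%E ->
  (forall t x, I01 t -> Omega x -> g t x = h (t, x)) ->
  (\int[mu]_(t in I01) ((\int[rho t]_(x in Omega) g t x) * (f t)%:E) =
   \int[curve_measure]_z h z)%E.
Proof.
move=> mh h0 gh; rewrite [RHS](@ge0_integral_weighted_fibered _ _ _ _ _ mu f mf f0 f1)//.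
apply: fE => t tI; rewrite clamp01_id//.
apply: integral_prob_on => //; [exact: crho.1|exact: section_measurable|].
by move=> x; exact: gh.
Qed.

Lemma integral_curve (h : measurableTypeR R * E -> R) (g : R -> E -> R) :
  curve_measure.-integrable setT (EFin \o h) ->
  (forall t x, I01 t -> Omega x -> g t x = h (t, x)) ->
  [/\ mu.-integrable I01 (fun t => (f t * \int[rho t]_(x in Omega) g t x)%:E),
    (\int[mu]_(t in I01) (f t * \int[rho t]_(x in Omega) g t x)%:E =
     \int[curve_measure]_z (h z)%:E)%E &
    (\int[mu]_(t in I01) ((\int[rho t]_(x in Omega) (g t x)%:E) * (f t)%:E) =
     \int[curve_measure]_z (h z)%:E)%E].
Proof.
move=> ih gh; have mh : measurable_fun setT h by apply/measurable_EFinP; exact: measurable_int ih.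
have gE t : I01 t -> \int[rho t]_(x in Omega) g t x = \int[rho (clamp01 t)]_x h (t, x).
  move=> tI; rewrite clamp01_id//.
  apply: Rintegral_prob_on => //; [exact: crho.1|exact: section_measurable|].
  by move=> x; exact: gh.
have [i1 i2 i3] := @integral_weighted_fibered _ _ _ _ _ mu f mf f0 f1 _ (curve_measurable crho) h ih.
split.
- apply: (@eq_integrable _ _ _ _ _ _ (EFin \o (fun t => f t * \int[rho (clamp01 t)]_x h (t, x)))) => //.
    by move=> t /set_mem tI; rewrite gE.
  exact: integrableS i1.
- rewrite -(@fineK _ (\int[curve_measure]_z _)%E); last exact: integrable_fin_num.
  rewrite [X in _ = X%:E]i2 [in RHS]/Rintegral fineK; last exact: integrable_fin_num.
  rewrite [LHS]integral_mkcond; apply: eq_integral => t _; rewrite patchE.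
  case: ifPn => [/set_mem tI|/negP tI]; first by rewrite gE.
  by rewrite fout ?mul0r// => tI'; apply: tI; rewrite inE.
- rewrite [RHS]i3; apply: fE => t tI; rewrite clamp01_id//.
  apply: integral_prob_on => //; first exact: crho.1.
    by apply/measurable_EFinP; exact: section_measurable.
  by move=> x Ox; rewrite gh.
Qed.

End curve_fibration.

Section unit_interval.
Context {R : realType} {n : nat}.
Local Notation E := ('rV[R]_n).
Local Notation mu := (@lebesgue_measure R).
Local Notation I01 := (`[0%R, 1%R]%classic : set R).

Definition indic01 : measurableTypeR R -> R := \1_I01.

Lemma measurable_indic01 : measurable_fun setT indic01.
Proof. exact: measurable_indic. Qed.

Lemma indic01_ge0 t : 0 <= indic01 t.
Proof. by []. Qed.

Lemma indic01_out t : ~ I01 t -> indic01 t = 0.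
Proof. by move=> tI; rewrite /indic01 indicE memNset. Qed.

Lemma indic01_in t : I01 t -> indic01 t = 1.
Proof. by move=> tI; rewrite /indic01 indicE mem_set. Qed.

Lemma integral_indic01 : (\int[mu]_t (indic01 t)%:E = 1)%E.
Proof.
rewrite integral_indic// setIT; exact: lebesgue_measure01.
Qed.

Variables (Omega : set E) (rho : R -> probability E R).
Hypotheses (mO : measurable Omega) (crho : curve Omega rho).

Definition unit_curve_measure :=
  curve_measure crho measurable_indic01 indic01_ge0 integral_indic01.

Lemma ge0_integral_unit_curve (h : measurableTypeR R * E -> \bar R) (g : R -> E -> \bar R) :
  measurable_fun setT h -> (forall z, 0 <= h z)%E ->
  (forall t x, I01 t -> Omega x -> g t x = h (t, x)) ->
  (\int[mu]_(t in I01) \int[rho t]_(x in Omega) g t x =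
   \int[unit_curve_measure]_z h z)%E.
Proof.
move=> mh h0 gh; rewrite /unit_curve_measure.
rewrite -(ge0_integral_curve mO crho measurable_indic01 indic01_ge0 indic01_out
  integral_indic01 mh h0 gh).
by apply: eq_integral => t /set_mem tI; rewrite indic01_in// mule1.
Qed.

Lemma integral_unit_curve (h : measurableTypeR R * E -> R) (g : R -> E -> R) :
  unit_curve_measure.-integrable setT (EFin \o h) ->
  (forall t x, I01 t -> Omega x -> g t x = h (t, x)) ->
  [/\ mu.-integrable I01 (fun t => (\int[rho t]_(x in Omega) g t x)%:E),
    (\int[mu]_(t in I01) (\int[rho t]_(x in Omega) g t x)%:E =
     \int[unit_curve_measure]_z (h z)%:E)%E &
    (\int[mu]_(t in I01) (\int[rho t]_(x in Omega) (g t x)%:E) =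
     \int[unit_curve_measure]_z (h z)%:E)%E].
Proof.
move=> ih gh.
have [i1 i2 i3] := integral_curve mO indic01_out ih gh.
split.
- apply: eq_integrable i1 => // t /set_mem tI; by rewrite indic01_in// mul1r.
- rewrite -i2; apply: eq_integral => t /set_mem tI; by rewrite indic01_in// mul1r.
- rewrite -i3; apply: eq_integral => t /set_mem tI; by rewrite indic01_in// mule1.
Qed.

End unit_interval.

(** * From velocity fields to tangent vectors *)

Section nonnegativity.
Context {R : realType} {n : nat}.
Local Notation E := ('rV[R]_n).
Variables (Omega : set E) (p : E -> R).
Local Open Scope ereal_scope.

Lemma lux_norm_ge0 (rho : probability E R) (v : E -> E) : 0 <= lux_norm Omega p rho v.
Proof. by apply: le_ereal_inf_tmp => _ [l [l0 _] <-]; rewrite lee_fin ltW. Qed.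

Lemma lux_norm_time_ge0 (rho : R -> probability E R) (v : R -> E -> E) :
  0 <= lux_norm_time Omega p rho v.
Proof. by apply: le_ereal_inf_tmp => _ [l [l0 _] <-]; rewrite lee_fin ltW. Qed.

Lemma finsler_ge0 (rho : probability E R) (nu : functional R n) :
  0 <= finsler Omega p rho nu.
Proof.
apply: le_ereal_inf_tmp => _ [v _ <-]; apply: le_ereal_inf_tmp => _ [w _ <-].
exact: lux_norm_ge0.
Qed.

Lemma wasserstein_ge0 (rho0 rho1 : probability E R) :
  0 <= wasserstein Omega p rho0 rho1.
Proof. by apply: le_ereal_inf_tmp => _ [c _ <-]; exact: lux_norm_time_ge0. Qed.

End nonnegativity.

Section fields.
Context {R : realType} {n : nat}.
Local Notation E := ('rV[R]_n).

Lemma measurable_fun_field d (T : measurableType d) (D : set T) (f : T -> E) :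
  measurable D -> measurable_fun D f -> measurable_field D f.
Proof.
move=> mD mf i; apply: (measurableT_comp (f := fun v : E => v 0 i)) => //.
by apply: continuous_measurable_rV => v; exact: coord_continuous.
Qed.

Lemma measurable_field_patch d (T : measurableType d) (D : set T) (f : T -> E) :
  measurable D -> measurable_field D f ->
  measurable_field setT (fun x => if x \in D then f x else 0).
Proof.
move=> mD mf i; have /(measurable_restrictT _ mD) := mf i.
congr (measurable_fun _ _); apply/funext => x; rewrite patchE.
by case: ifP => // _; rewrite mxE.
Qed.

Lemma measurable_patch d (T : measurableType d) (D : set T) (f : T -> R) (c : R) :
  measurable D -> measurable_fun D f ->
  measurable_fun setT (fun x => if x \in D then f x else c).
Proof.
move=> mD mf; have -> : (fun x => if x \in D then f x else c) =
    (fun x => ((fun x => f x - c) \_ D) x + c).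
  by apply/funext => x; rewrite patchE; case: ifP => _; rewrite ?subrK// add0r.
apply: measurable_funD => //; apply/(measurable_restrictT _ mD).
exact: measurable_funB.
Qed.

End fields.

(** For a = e / l this is a <= 1 + a^s, clear for a <= 1 and for a > 1. It makes a field of finite
    modular integrable. *)
Lemma le_modular (R : realType) (e l s : R) : 0 <= e -> 0 < l -> 1 <= s ->
  e <= l * (1 + (e / l) `^ s).
Proof.
move=> e0 l0 s1; have el : 0 <= e / l by rewrite divr_ge0// ltW.
have -> : e = l * (e / l) by rewrite mulrC divfK ?gt_eqF.
rewrite mulrC mulfK ?gt_eqF// mulrC ler_pM2l//.
have [a1|a1] := leP (e / l) 1.
  by rewrite (le_trans a1)// lerDl powR_ge0.
rewrite ler_wpDl// -[leLHS]powRr1//.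
by rewrite ler_powR// ltW.
Qed.

Section velocity_to_tangent.
Context {R : realType} {n : nat}.
Local Notation E := ('rV[R]_n).
Local Notation mu := (@lebesgue_measure R).
Local Notation I01 := (`[0%R, 1%R]%classic : set R).
Variables (Omega : set E) (p q : E -> R).
Hypotheses (mO : measurable Omega) (mq : measurable_fun setT q)
  (qp : forall x, Omega x -> p x = q x) (q1 : forall x, 1 <= q x).

Lemma powR_shrink (a m s : R) : 0 <= a -> 0 <= m -> 1 <= s ->
  (a / (1 + m)) `^ s <= (1 + m)^-1 * a `^ s.
Proof.
move=> a0 m0 s1; have m1 : 0 < 1 + m by rewrite ltr_wpDr.
rewrite powRM ?invr_ge0 ?(ltW m1)// mulrC ler_wpM2r ?powR_ge0//.
rewrite -{2}[(1 + m)^-1]powRr1 ?invr_ge0 ?(ltW m1)//.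
by rewrite ger_powR// invr_gt0 m1 invf_le1// lerDl.
Qed.

(** For exponents at least 1, dividing a field by 1 + m divides its modular by at least 1 + m. So
    the level l (1 + m) has modular at most m / (1 + m) <= 1. *)
Lemma lux_norm_le_modular (rho : probability E R) (v : E -> E) (l m : R) :
  prob_on Omega rho -> measurable_field Omega v -> 0 < l ->
  (\int[rho]_(x in Omega) ((enorm (v x) / l) `^ p x)%:E = m%:E)%E ->
  (lux_norm Omega p rho v <= (l * (1 + m))%:E)%E.
Proof.
move=> rO mv l0 mE; have m0 : 0 <= m.
  by rewrite -lee_fin -mE; apply: integral_ge0 => x _; rewrite lee_fin powR_ge0.
have m1 : 0 < 1 + m by rewrite ltr_wpDr.
apply: ereal_inf_lbound; exists (l * (1 + m)) => //; split; first exact: mulr_gt0.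
apply: (@le_trans _ _ (\int[rho]_(x in Omega) (((1 + m)^-1)%:E * ((enorm (v x) / l) `^ p x)%:E))%E).
  apply: le_ge0_integral => x Ox; first by rewrite lee_fin powR_ge0.
  rewrite -EFinM lee_fin invfM mulrA; apply: powR_shrink => //.
    by rewrite divr_ge0 ?enorm_ge0// ltW.
  by rewrite qp.
rewrite ge0_integralZl_EFin//.
- by rewrite mE -EFinM lee_fin mulrC ler_pdivrMr// mul1r lerDr.
- by move=> x _; rewrite lee_fin powR_ge0.
- apply/measurable_EFinP; apply: measurable_fun_powR => //.
    by apply: measurable_funM => //; exact: measurable_enorm.
  by apply: eq_measurable_fun (measurable_funTS mq) => x /set_mem Ox; rewrite qp.
- by rewrite invr_ge0 ltW.
Qed.

Lemma lux_norm0 (rho : probability E R) : (lux_norm Omega p rho (fun=> 0%R) <= 1)%E.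
Proof.
apply: ereal_inf_lbound; exists 1 => //; split => //.
rewrite integral0_eq// => x Ox; rewrite enorm0 mul0r powR0// qp//.
by rewrite gt_eqF// (lt_le_trans ltr01).
Qed.

Lemma quotient_norm_le (rho : probability E R) (v : E -> E) :
  (quotient_norm Omega p rho v <= lux_norm Omega p rho v)%E.
Proof.
apply: ereal_inf_lbound; exists (fun=> 0).
  split; first split; first exact: measurable_cst.
    by rewrite (le_lt_trans (lux_norm0 rho))// ltry.
  move=> phi _; rewrite /neg_div /Rintegral integral0_eq// => x _.
  by rewrite dot0r.
by congr lux_norm; apply/funext => x; rewrite addr0.
Qed.

Lemma finsler_distance_le_admissible (rho0 rho1 : probability E R)
    (rho : R -> probability E R) (v : R -> E -> E) (l : R) :
  curve_between Omega rho0 rho1 rho ->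
  measurable_fun (I01 `*` Omega) (fun z : measurableTypeR R * E => v z.1 z.2) ->
  continuity_equation Omega rho v -> 0 < l ->
  (\int[mu]_(t in I01) \int[rho t]_(x in Omega)
       ((enorm (v t x) / l) `^ p x)%:E <= 1)%E ->
  (finsler_distance Omega p rho0 rho1 <= (2 * l)%:E)%E.
Proof.
move=> [crho rho0E rho1E] mv cont l0 adm.
pose D : set (measurableTypeR R * E) := I01 `*` Omega.
have mD : measurable D by apply: measurableX => //; exact: measurable_itv.
(* v is measurable only over [0, 1] x Omega; its extension by 0 can be integrated against [M]. *)
pose w (z : measurableTypeR R * E) := if z \in D then v z.1 z.2 else 0.
have mw : measurable_field setT w.
  by apply: measurable_field_patch => //; exact: measurable_fun_field.
have wE t x : I01 t -> Omega x -> v t x = w (t, x).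
  by move=> tI Ox; rewrite /w mem_set.
pose M := unit_curve_measure crho.
pose k (z : measurableTypeR R * E) : R := (enorm (w z) / l) `^ q z.2.
have mk : measurable_fun setT k.
  apply: measurable_fun_powR => //; last exact: measurableT_comp.
  by apply: measurable_funM => //; exact: measurable_enorm.
have k0 z : 0 <= k z by exact: powR_ge0.
pose m t := (\int[rho t]_(x in Omega) ((enorm (v t x) / l) `^ p x)%:E)%E.
have m0 t : (0 <= m t)%E by apply: integral_ge0 => x _; rewrite lee_fin powR_ge0.
have kE t x : I01 t -> Omega x -> ((enorm (v t x) / l) `^ p x)%:E = (k (t, x))%:E.
  by move=> tI Ox; rewrite /k -wE// qp.
have mkE : measurable_fun setT (EFin \o k) by exact/measurable_EFinP.
have ik1 : (\int[M]_z (k z)%:E <= 1)%E.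
  by rewrite -(ge0_integral_unit_curve mO crho mkE _ kE).
have ik : M.-integrable setT (EFin \o k).
  apply/integrableP; split => //; under eq_integral do rewrite gee0_abs ?lee_fin//.
  exact: le_lt_trans (ltry 1).
have mE t : I01 t -> m t = (\int[rho (clamp01 t)]_x (k (t, x))%:E)%E.
  move=> tI; rewrite (clamp01_id tI).
  apply: (@integral_prob_on _ _ Omega (rho t) mO (crho.1 t tI) _ (fun x => (k (t, x))%:E)).
    by apply: (measurableT_comp mkE); exact: pair1_measurable.
  by move=> x; exact: kE.
have mm : measurable_fun I01 m.
  apply: (eq_measurable_fun (fun t => \int[rho (clamp01 t)]_x (k (t, x))%:E)%E).
    by move=> t /set_mem tI; rewrite mE.
  apply: measurable_funTS.
  by apply: (measurable_fibered (curve_measurable crho) mkE) => z; rewrite lee_fin.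
have mv_ t : I01 t -> measurable_fun Omega (v t).
  move=> tI; apply: (eq_measurable_fun (fun x => w (t, x))).
    by move=> x /set_mem Ox; rewrite wE.
  apply: measurable_funTS; apply: measurable_fun_row => i.
  by apply: (measurableT_comp (mw i)); exact: pair1_measurable.
have rep t : I01 t -> (m t < +oo)%E ->
    (lux_norm Omega p (rho t) (v t) <= l%:E * (1 + m t))%E /\
    represents Omega p (rho t) (neg_div Omega (rho t) (v t)) (v t).
  move=> tI mt; have mf : m t = (fine (m t))%:E by rewrite fineK// ge0_fin_numE.
  have lx : (lux_norm Omega p (rho t) (v t) <= l%:E * (1 + m t))%E.
    rewrite mf -EFinD -EFinM; apply: lux_norm_le_modular => //; first exact: crho.1.
    by apply: measurable_fun_field => //; exact: mv_.
  split => //; split=> //; split; first exact: mv_.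
  by rewrite (le_lt_trans lx)// mf -EFinD -EFinM ltry.
have im1 : (\int[mu]_(t in I01) m t <= 1)%E by [].
apply: (@le_trans _ _ (finsler_length Omega p rho (fun t => neg_div Omega (rho t) (v t)))); last first.
  apply: (@le_trans _ _ (\int[mu]_(t in I01) (l%:E * (1 + m t)))%E).
    apply: le_ge0_integral => t tI; first exact: finsler_ge0.
    (* An infinite modular makes the bound trivial; otherwise v t itself represents the tangent
       vector. *)
    have [mt|] := ltP (m t) +oo%E; last first.
      by rewrite leye_eq => /eqP ->; rewrite addey// gt0_muley ?lte_fin// leey.
    apply: (le_trans _ (rep t tI mt).1); apply: le_trans (quotient_norm_le _ _).
    by apply: ereal_inf_lbound; exists (v t) => //; exact: (rep t tI mt).2.
  rewrite ge0_integralZl_EFin//; last 3 first.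
  - by move=> t _; rewrite adde_ge0.
  - by apply: emeasurable_funD => //; exact: measurable_cst.
  - exact: ltW.
  (* The constant 2 is the length of [0, 1] plus the modular, each at most 1. *)
  rewrite ge0_integralD//.
  rewrite mulrC EFinM lee_pmul2l//.
  rewrite [X in (X + _)%E](_ : _ = 1%E).
    by rewrite (_ : 2%:E = 1 + 1)%E// leeD2l.
  apply: etrans; first exact: integral_cst.
  rewrite mul1e; exact: lebesgue_measure01.
apply: ereal_inf_lbound; exists (rho, fun t => neg_div Omega (rho t) (v t)) => //; split => //=.
- move=> phi phiT; have sphi : smooth phi by case: phiT.
  pose h0 (z : measurableTypeR R * E) := dt phi z.1 z.2.
  pose h1 (z : measurableTypeR R * E) := dot (gradient (fun y => phi (z.1, y)) z.2) (w z).
  have i0 : M.-integrable setT (EFin \o h0).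
    have [B BP] := dt_bounded phiT.
    apply: bounded_integrable; first exact: measurable_dt.
    by move=> z; exact: BP.
  have mh1 : measurable_fun setT h1.
    by apply: measurable_field_dot => //; exact: measurable_gradient.
  have i1 : M.-integrable setT (EFin \o h1).
    have [B BP] := gradient_bounded phiT.
    have B0 : 0 <= B by apply: le_trans (BP 0 0); exact: enorm_ge0.
    apply: (le_integrable_EFin (g := fun z => B * l * (1 + k z))) => //.
      move=> z; rewrite (le_trans (normr_dot_le _ _))// -mulrA.
      apply: ler_pM; rewrite ?enorm_ge0//.
      exact: (le_modular (enorm_ge0 _) l0 (q1 _)).
    apply: integrableZ_EFin; apply: integrableD_EFin => //.
    by apply: (@bounded_integrable _ _ _ _ _ 1) => // z; rewrite normr1.
  have g0E t x : I01 t -> Omega x -> dt phi t x = h0 (t, x) by [].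
  have g1E t x : I01 t -> Omega x ->
      dot (gradient (fun y => phi (t, y)) x) (v t x) = h1 (t, x).
    by move=> tI Ox; rewrite /h1 -wE.
  have [i1I e1 _] := integral_unit_curve mO i1 g1E.
  have [_ _ e0] := integral_unit_curve mO i0 g0E.
  split; first exact: i1I.
  rewrite [X in (_ = - X)%E]e1 e0.
  (* As both terms are integrable on their own, the continuity equation splits into the two sides of
     [time_derivative]. *)
  have i01 : M.-integrable setT (EFin \o (fun z => h0 z + h1 z)) by exact: integrableD_EFin.
  have g01E t x : I01 t -> Omega x -> dt phi t x +
      dot (gradient (fun y => phi (t, y)) x) (v t x) = h0 (t, x) + h1 (t, x).
    by move=> tI Ox; rewrite g1E.
  have [_ _ e01] := integral_unit_curve mO i01 g01E.
  have := cont _ phiT; rewrite e01.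
  under eq_integral do rewrite EFinD.
  rewrite integralD//; move=> /eqP.
  rewrite -(fineK (integrable_fin_num measurableT i0)) -(fineK (integrable_fin_num measurableT i1)).
  by rewrite -EFinD eqe addr_eq0 => /eqP ->.
- have im : mu.-integrable I01 m.
    apply/integrableP; split => //; under eq_integral do rewrite gee0_abs//.
    exact: le_lt_trans (ltry 1).
  have mI : measurable (I01 : set (measurableTypeR R)) by exact: measurable_itv.
  have := integrable_ae mI im; apply: filterS => t mt tI.
  exists (v t); apply: (rep t tI _).2.
  by rewrite -ge0_fin_numE//; exact: mt.
Qed.

Lemma finsler_distance_le_wasserstein (rho0 rho1 : probability E R) :
  (finsler_distance Omega p rho0 rho1 <= 2%:E * wasserstein Omega p rho0 rho1)%E.
Proof.
rewrite -lee_pdivrMl//; apply: le_ereal_inf_tmp => _ [[rho v] /= [cb mv ce] <-].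
apply: le_ereal_inf_tmp => _ [l [l0 adm] <-]; rewrite lee_pdivrMl// -EFinM.
exact: finsler_distance_le_admissible cb mv ce l0 adm.
Qed.

End velocity_to_tangent.

(** * The diameter bound *)

Section image_probability.
Context d1 d2 (X : measurableType d1) (Y : measurableType d2) (R : realType).
Variables (P : probability X R) (f : X -> Y).

Definition image_prob (mf : measurable_fun setT f) : set Y -> \bar R := pushforward P f.

HB.instance Definition _ (mf : measurable_fun setT f) :=
  Measure.copy (image_prob mf)
    (measure_function_pushforward__canonical__measure_function_Measure P mf).

Let image_probT (mf : measurable_fun setT f) : image_prob mf setT = 1%E.
Proof. by rewrite /image_prob /pushforward preimage_setT probability_setT. Qed.

HB.instance Definition _ (mf : measurable_fun setT f) :=
  Measure_isProbability.Build _ _ R (image_prob mf) (image_probT mf).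

Lemma integral_image_prob (mf : measurable_fun setT f) (g : Y -> \bar R) :
  measurable_fun setT g ->
  (\int[image_prob mf]_y g y = \int[P]_x g (f x))%E.
Proof.
move=> mg; have aux (h : Y -> \bar R) : measurable_fun setT h -> (forall y, 0 <= h y)%E ->
    (\int[image_prob mf]_y h y = \int[P]_x h (f x))%E.
  move=> mh h0; rewrite -[LHS]/(\int[pushforward P f]_(y in setT) h y)%E.
  by rewrite (ge0_integral_pushforward mf)// preimage_setT.
rewrite integralE [RHS]integralE; congr (_ - _)%E.
  rewrite aux; first by apply: eq_integral => x _; rewrite !funeposE.
    exact: measurable_funepos.
  by move=> y; exact: funepos_ge0.
rewrite aux; first by apply: eq_integral => x _; rewrite !funenegE.
  exact: measurable_funeneg.
by move=> y; exact: funeneg_ge0.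
Qed.

End image_probability.

Section homothety.
Context {R : realType} {n : nat}.
Local Notation E := ('rV[R]_n).
Local Notation mu := (@lebesgue_measure R).
Local Notation I01 := (`[0%R, 1%R]%classic : set R).
Variables (x0 : E).

Definition homothety (c : R) (z : E) : E := x0 + c *: (z - x0).

Lemma homothetyB c z : homothety c z - x0 = c *: (z - x0).
Proof. by rewrite /homothety addrAC subrr add0r. Qed.

Lemma homothety0 z : homothety 0 z = x0.
Proof. by rewrite /homothety scale0r addr0. Qed.

Lemma homothety1 z : homothety 1 z = z.
Proof. by rewrite /homothety scale1r addrCA subrr addr0. Qed.

Lemma continuous_homothety c : continuous (homothety c).
Proof.
apply: continuous_row => j; under eq_fun do rewrite !mxE.
move=> z; apply: (cvg_comp (fun y : E => y 0 j) (fun r : R => x0 0 j + c * (r - x0 0 j))).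
  exact: coord_continuous.
have h : continuous (fun r : R => x0 0 j + c * (r - x0 0 j)).
  move=> r; apply: cvgD; first exact: cvg_cst.
  apply: cvgM; first exact: cvg_cst.
  by apply: cvgB; [exact: cvg_id|exact: cvg_cst].
exact: h.
Qed.

Lemma continuous_homothety_scale z : continuous (homothety ^~ z).
Proof.
apply: continuous_row => j; under eq_fun do rewrite !mxE.
move=> c; apply: cvgD; first exact: cvg_cst.
by apply: cvgM; [exact: cvg_id|exact: cvg_cst].
Qed.

Lemma measurable_homothety c : measurable_fun setT (homothety c).
Proof.
apply: measurable_fun_row => i; apply: continuous_measurable_rV => z.
apply: (cvg_comp (homothety c) (fun y : E => y 0 i)); first exact: continuous_homothety.
exact: coord_continuous.
Qed.

Variables (Omega : set E).
Hypotheses (mO : measurable Omega) (convO : convex_set Omega) (Ox0 : Omega x0).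

Lemma homothety_in c z : 0 <= c <= 1 -> Omega z -> Omega (homothety c z).
Proof.
move=> /andP[c0 c1] Oz.
have := convO (Itv01 c0 c1) (mem_set Oz) (mem_set Ox0).
rewrite inE; congr Omega; rewrite /homothety.
rewrite -[LHS]/(c *: z + (1 - c) *: x0) scalerBl scale1r scalerBr.
by rewrite addrCA.
Qed.

Variables (Dm : R).
Hypotheses (Dm0 : 0 < Dm) (ODm : forall z, Omega z -> enorm (z - x0) <= Dm).

Section ray.
Variables (phi : R * E -> R) (phiT : spacetime_test phi) (a b : R).

Let sphi : smooth phi. Proof. by case: phiT. Qed.

Let Y (z : R * E) : R * E := (z.1, homothety (a + b * z.1) z.2).

Let cY : continuous Y.
Proof.
apply: continuous_pairing; first by move=> z; exact: cvg_fst.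
apply: continuous_row => j; under eq_fun do rewrite !mxE.
move=> z; apply: cvgD; first exact: cvg_cst.
apply: cvgM.
  apply: cvgD; first exact: cvg_cst.
  by apply: cvgM; [exact: cvg_cst|exact: cvg_fst].
apply: cvgB; last exact: cvg_cst.
by apply: (cvg_comp snd (fun y : E => y 0 j)); [exact: cvg_snd|exact: coord_continuous].
Qed.

(** Derivative in t of phi at the point x0 + (a + b t) (z - x0), which moves uniformly on the line
    through x0 and z. *)
Definition ray_derivative (z : R * E) : R :=
  dt phi z.1 (homothety (a + b * z.1) z.2) +
  dot (gradient (fun y => phi (z.1, y)) (homothety (a + b * z.1) z.2)) (b *: (z.2 - x0)).

Lemma continuous_ray_derivative : continuous ray_derivative.
Proof.
have cD v : continuous ('D_v phi \o Y).
  move=> z; apply: (cvg_comp Y ('D_v phi)); first exact: cY.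
  exact: smooth_continuous_derive.
move=> z; apply: cvgD; first exact: (cD ((1 : R), 0 : E)).
apply: cvg_dot; last first.
  have c : continuous (fun z : R * E => b *: (z.2 - x0)).
    apply: continuous_row => j; under eq_fun do rewrite !mxE.
    move=> {}z; apply: cvgM; first exact: cvg_cst.
    apply: cvgB; last exact: cvg_cst.
    by apply: (cvg_comp snd (fun y : E => y 0 j)); [exact: cvg_snd|exact: coord_continuous].
  exact: c.
have c : continuous (fun z : R * E => gradient (fun y => phi (z.1, y)) (homothety (a + b * z.1) z.2)).
  by apply: continuous_row => j; under eq_fun do rewrite gradient_section; exact: cD.
exact: c.
Qed.

Lemma bounded_ray_derivative : exists2 B, 0 <= B &
  forall t z, Omega z -> `|ray_derivative (t, z)| <= B.
Proof.
have [B0 B0P] := dt_bounded phiT; have [B1 B1P] := gradient_bounded phiT.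
have B00 : 0 <= B0 by exact: le_trans (B0P 0 0).
have B10 : 0 <= B1 by apply: le_trans (B1P 0 0); exact: enorm_ge0.
exists (B0 + B1 * (`|b| * Dm)).
  by rewrite addr_ge0// mulr_ge0// mulr_ge0// ltW.
move=> t z Oz; rewrite (le_trans (ler_normD _ _))// lerD//.
rewrite (le_trans (normr_dot_le _ _))// ler_pM ?enorm_ge0//.
by rewrite enormZ ler_wpM2l// ODm.
Qed.

Lemma integral_ray (t0 t1 : R) z : t0 < t1 ->
  (\int[mu]_(t in `[t0, t1]%classic) (ray_derivative (t, z))%:E =
   (phi (t1, homothety (a + b * t1) z) - phi (t0, homothety (a + b * t0) z))%:E)%E.
Proof.
move=> t01; pose y : R * E := (0, homothety a z); pose v : R * E := (1, b *: (z - x0)).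
have yv (r : R) : y + r *: v = (r, homothety (a + b * r) z).
  rewrite -[LHS]/(0 + r * 1, homothety a z + r *: (b *: (z - x0))).
  by rewrite add0r mulr1 /homothety scalerA mulrC scalerDl addrA.
have E1 r : ray_derivative (r, z) = 'D_v phi (y + r *: v).
  by rewrite yv derive_spacetime// mul1r.
have cl r : {for r, continuous (fun r : R => y + r *: v)}.
  by apply: cvgD; [exact: cvg_cst|apply: cvgZr_tmp; exact: cvg_id].
have dl r : is_derive r (1 : R) (fun s : R => phi (y + s *: v)) ('D_v phi (y + r *: v)).
  by apply: is_derive_line; exact: smooth_derivable.
have cp : continuous (fun s : R => phi (y + s *: v)).
  by move=> r; apply: (cvg_comp _ phi (cl r)); exact: (smooth_continuous sphi).
rewrite (@continuous_FTC2 _ _ (fun s : R => phi (y + s *: v)))//.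
- by rewrite !yv.
- apply: continuous_subspaceT => r; rewrite /continuous_at E1; under eq_cvg do rewrite E1.
  by apply: (cvg_comp _ ('D_v phi) (cl r)); exact: smooth_continuous_derive.
- split.
  + by move=> r _; case: (dl r).
  + by apply: cvg_at_right_filter; exact: cp.
  + by apply: cvg_at_left_filter; exact: cp.
- by move=> r _; rewrite derive1E E1; apply: derive_val.
Qed.

Lemma integral_rays (P : probability E R) (t0 t1 : R) : t0 < t1 ->
  (\int[mu]_(t in `[t0, t1]%classic) \int[P]_(z in Omega) (ray_derivative (t, z))%:E =
   \int[P]_(z in Omega)
     (phi (t1, homothety (a + b * t1) z) - phi (t0, homothety (a + b * t0) z))%:E)%E.
Proof.
move=> t01; pose J := `[t0, t1]%classic : set (measurableTypeR R).
have mJ : measurable J by exact: measurable_itv.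
(* The ray derivative is bounded only for z in Omega, so the indicators enter the integrand before
   Fubini's theorem is applied. *)
pose F (z : measurableTypeR R * E) : R := \1_J z.1 * (\1_Omega z.2 * ray_derivative z).
have mF : measurable_fun setT F.
  apply: measurable_funM.
    by apply: (measurableT_comp (f := (\1_J : measurableTypeR R -> R))) => //.
  apply: measurable_funM.
    by apply: (measurableT_comp (f := (\1_Omega : E -> R))) => //.
  by apply: continuous_measurable_spacetime; exact: continuous_ray_derivative.
have [B B0 BP] := bounded_ray_derivative.
have Fle t z : `|F (t, z)| <= B * \1_J t.
  rewrite /F normrM [leRHS]mulrC ger0_norm//= ler_wpM2l// normrM ger0_norm//.
  rewrite indicE; have [zO|zO] := boolP (z \in Omega); last by rewrite mul0r.
  by rewrite mul1r; apply: BP; exact/set_mem.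
have iF : (mu \x P)%E.-integrable setT (EFin \o F).
  apply/integrable12ltyP; first exact/measurable_EFinP.
  apply: (@le_lt_trans _ _ (\int[mu]_t (B%:E * (\1_J t)%:E))%E).
    apply: le_ge0_integral => t _; first exact: integral_ge0.
    apply: (@le_trans _ _ (\int[P]_z (B * \1_J t)%:E)%E).
      by apply: le_ge0_integral => z _ //=; rewrite lee_fin.
    by rewrite integral_cst// [X in (_ * X)%E]probability_setT mule1 EFinM.
  rewrite ge0_integralZl_EFin//.
    rewrite integral_indic// setIT; apply: (@le_lt_trans _ _ (B%:E * (t1 - t0)%:E)%E); last first.
      by rewrite -EFinM ltry.
    apply: lee_wpmul2l; first by rewrite lee_fin.
    rewrite le_eqVlt; apply/orP; left; apply/eqP.
    by apply: etrans; [exact: lebesgue_measure_itv|rewrite /= lte_fin t01].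
  by apply/measurable_EFinP; exact: measurable_indic.
have FE : (\int[mu]_(t in `[t0, t1]%classic) \int[P]_(z in Omega) (ray_derivative (t, z))%:E =
    \int[mu]_t \int[P]_z (F (t, z))%:E)%E.
  rewrite [LHS]integral_mkcond; apply: eq_integral => t _; rewrite patchE.
  case: ifPn => [tJ|tJ].
    rewrite [LHS]integral_mkcond; apply: eq_integral => z _; rewrite patchE /F/=.
    rewrite !indicE tJ mul1r; case: ifPn => _; first by rewrite mul1r.
    by rewrite mul0r.
  rewrite integral0_eq// => z _; rewrite /F/= [\1_J t]indicE (negbTE tJ) mul0r//.
rewrite FE (Fubini iF) [RHS]integral_mkcond; apply: eq_integral => z _; rewrite patchE.
case: ifPn => [zO|zO]; last first.
  rewrite integral0_eq// => t _; rewrite /F/= [\1_Omega z]indicE (negbTE zO) mul0r mulr0//.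
rewrite -integral_ray// [RHS]integral_mkcond; apply: eq_integral => t _; rewrite patchE /F/=.
rewrite !indicE zO mul1r; case: ifPn => _; first by rewrite mul1r.
by rewrite mul0r.
Qed.

End ray.

End homothety.

(** * The cone over two measures with apex x0 *)

Section cone.
Context {R : realType} {n : nat}.
Local Notation E := ('rV[R]_n).
Local Notation mu := (@lebesgue_measure R).
Local Notation I01 := (`[0%R, 1%R]%classic : set R).
Variables (Omega : set E) (p q : E -> R) (x0 : E) (Dm : R).
Hypotheses (mO : measurable Omega) (convO : convex_set Omega) (Ox0 : Omega x0)
  (Dm0 : 0 < Dm) (ODm : forall z, Omega z -> enorm (z - x0) <= Dm)
  (mq : measurable_fun setT q) (qp : forall x, Omega x -> p x = q x)
  (q1 : forall x, 1 <= q x).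
Variables (rho0 rho1 : probability E R).
Hypotheses (r0 : prob_on Omega rho0) (r1 : prob_on Omega rho1).

Let side (t : R) : probability E R := if t <= 2^-1 then rho0 else rho1.

Definition opening (t : R) : R := `|2 * t - 1|.

(* rho0 is contracted onto x0 during [0, 1/2], then x0 is expanded into rho1 *)
Definition cone (t : R) : probability E R :=
  image_prob (side t) (measurable_homothety x0 (opening t)).

(* division by zero makes this vanish at the apex t = 1/2 *)
Definition cone_velocity (t : R) (y : E) : E := (2 / (2 * t - 1)) *: (y - x0).

Let side_on t : prob_on Omega (side t).
Proof. by rewrite /side; case: ifP. Qed.

Let opening_in t : I01 t -> 0 <= opening t <= 1.
Proof.
rewrite /= in_itv/= /opening normr_ge0/= => /andP[t0 t1].
by rewrite ler_norml; apply/andP; split; lra.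
Qed.

Let cone_on t : I01 t -> prob_on Omega (cone t).
Proof.
move=> tI; apply/eqP; rewrite eq_le probability_le1//= -[leLHS](side_on t).
rewrite -[leRHS]/(side t (homothety x0 (opening t) @^-1` Omega)).
apply: le_measure; rewrite ?inE//.
  by rewrite -[X in measurable X]setTI; exact: measurable_homothety.
by move=> z Oz; apply: homothety_in => //; exact: opening_in.
Qed.

Let integral_cone t (g : E -> \bar R) : I01 t -> measurable_fun setT g ->
  (\int[cone t]_(x in Omega) g x =
   \int[side t]_(z in Omega) g (homothety x0 (opening t) z))%E.
Proof.
move=> tI mg; rewrite (integral_prob_on mO (cone_on tI) mg)// /cone integral_image_prob//.
apply/esym; apply: (integral_prob_on mO (side_on t)) => //.
by apply: (measurableT_comp mg); exact: measurable_homothety.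
Qed.

Let integral_cone_le t (g : E -> \bar R) (B : R) : I01 t -> measurable_fun setT g ->
  (forall x, 0 <= g x)%E ->
  (forall z, Omega z -> (g (homothety x0 (opening t) z) <= B%:E)%E) ->
  (\int[cone t]_(x in Omega) g x <= B%:E)%E.
Proof.
move=> tI mg g0 gB; rewrite integral_cone//.
apply: (@le_trans _ _ (\int[side t]_(z in Omega) B%:E)%E).
  by apply: le_ge0_integral.
by rewrite integral_cst// [X in (_ * X)%E](side_on t) mule1.
Qed.

(** The factor 2 / (2t - 1) blows up at the apex, but the homothety contracts at the same rate.
    Along the path of z the velocity is therefore -2 (z - x0), then 2 (z - x0), of norm at most 2
    Dm. *)
Let cone_velocity_homothety t z : t != 2^-1 ->
  cone_velocity t (homothety x0 (opening t) z) =
  (if t <= 2^-1 then -2 else 2) *: (z - x0).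
Proof.
move=> t2; rewrite /cone_velocity homothetyB scalerA; congr (_ *: _).
have t20 : 2 * t - 1 != 0 by apply: contra t2 => /eqP t0; apply/eqP; lra.
rewrite /opening; case: ifPn => [t12|].
  by rewrite ler0_norm; [field|lra].
by rewrite -ltNge => t12; rewrite gtr0_norm; [field|lra].
Qed.

Let enorm_cone_velocity t z : Omega z ->
  enorm (cone_velocity t (homothety x0 (opening t) z)) <= 2 * Dm.
Proof.
move=> Oz; have [->|t2] := eqVneq t 2^-1.
  rewrite /cone_velocity divff ?pnatr_eq0// subrr invr0 mulr0 scale0r enorm0.
  by rewrite mulr_ge0// ltW.
rewrite cone_velocity_homothety// enormZ.
have -> : `|if t <= 2^-1 then -2 else 2 : R| = 2.
  by case: ifP => _; rewrite ?normrN ger0_norm.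
by rewrite ler_wpM2l// ODm.
Qed.

Let measurable_cone_velocity :
  measurable_field setT (fun z : measurableTypeR R * E => cone_velocity z.1 z.2).
Proof.
apply: measurable_fieldZ.
  (* The inverse of y is written as y times the inverse of y^2, a power with nonnegative base; the
     identity also holds at y = 0. *)
  have -> : (fun z : measurableTypeR R * E => 2 / (2 * z.1 - 1)) =
      (fun z => 2 * ((2 * z.1 - 1) * (((2 * z.1 - 1) ^+ 2) `^ (-1)))).
    apply/funext => -[t x] /=; congr (_ * _).
    have [->|t0] := eqVneq (2 * t - 1) 0; first by rewrite invr0 mul0r.
    by rewrite powR_inv1 ?sqr_ge0//; field.
  have mz : measurable_fun setT (fun z : measurableTypeR R * E => 2 * z.1 - 1 : R).
    by apply: measurable_funB => //; apply: measurable_funM => //; exact: measurable_fst.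
  apply: measurable_funM => //; apply: measurable_funM => //.
  by apply: measurable_fun_powR => //; exact: measurable_funX.
move=> i; under eq_fun do rewrite !mxE; apply: measurable_funD => //.
apply: (measurableT_comp (f := fun y : E => y 0 i)) => //.
by apply: continuous_measurable_rV => v; exact: coord_continuous.
Qed.

Let measurable_cone_velocity_at t : measurable_field setT (cone_velocity t).
Proof.
apply: measurable_fieldZ => // i; under eq_fun do rewrite !mxE.
apply: measurable_funD => //.
by apply: continuous_measurable_rV => v; exact: coord_continuous.
Qed.

Let cone_curve : curve Omega cone.
Proof.
split => [t tI|f cf [M fM]]; first exact: cone_on.
pose U (P : probability E R) c := \int[P]_x f (homothety x0 c x).
have mfh c : measurable_fun setT (fun x => f (homothety x0 c x)).
  apply: (measurableT_comp (continuous_measurable_rV cf)); exact: measurable_homothety.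
have cU P : continuous (U P).
  move=> a; pose u := a - 1; pose v := a + 1.
  have aI : a \in (`]u, v[%classic : set R).
    by rewrite inE /= in_itv/= /u /v ltrBlDr !ltrDl ltr01.
  apply: (@continuity_under_integral _ _ _ P (fun c x => f (homothety x0 c x))
    setT measurableT u v _ _ (fun=> M) _ _ a aI) => //.
  - by move=> c _; exact: (@bounded_integrable _ _ _ P _ M).
  - apply: aeW => x _ c _; apply: (cvg_comp (homothety x0 ^~ x) f); last exact: cf.
    exact: continuous_homothety_scale.
  - apply: (@bounded_integrable _ _ _ _ _ `|M|) => //.
  - by move=> c _; apply: aeW => x _; exact: fM.
have U0 P : U P 0 = f x0.
  rewrite /U; under eq_Rintegral do rewrite homothety0.
  by rewrite Rintegral_cst// [X in fine X]probability_setT mulr1.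
(* At every t at least one truncation is 0 and its term equals f x0. Subtracting f x0 gives a single
   formula for both halves, continuous across the apex. *)
have UE t : \int[cone t]_x f x =
    U rho0 (Num.max 0 (1 - 2 * t)) + U rho1 (Num.max 0 (2 * t - 1)) - f x0.
  transitivity (U (side t) (opening t)).
    rewrite /U /Rintegral /cone integral_image_prob//.
    by apply/measurable_EFinP; exact: continuous_measurable_rV.
  rewrite /side /opening; case: ifPn => [t2|].
    rewrite max_r; last by lra.
    rewrite max_l; last by lra.
    by rewrite U0 addrK distrC ger0_norm//; lra.
  rewrite -ltNge => t2; rewrite max_l; last by lra.
  rewrite max_r; last by lra.
  by rewrite U0 addrAC subrr add0r ger0_norm//; lra.
apply: continuous_subspaceT => t; rewrite /continuous_at UE; under eq_cvg do rewrite UE.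
have cl (g : R -> R) : continuous g -> continuous (fun t => Num.max 0 (g t)).
  move=> cg s; have h : {for s, continuous ((cst 0 : R -> R^o) \max g)}.
    by apply: continuous_max; [exact: cst_continuous|exact: cg].
  exact: h.
apply: cvgB; last exact: cvg_cst.
have l1 : continuous (fun t : R => 1 - 2 * t).
  by move=> s; apply: cvgB; [exact: cvg_cst|apply: cvgM; [exact: cvg_cst|exact: cvg_id]].
have l2 : continuous (fun t : R => 2 * t - 1).
  by move=> s; apply: cvgB; [apply: cvgM; [exact: cvg_cst|exact: cvg_id]|exact: cvg_cst].
apply: cvgD.
  by apply: (cvg_comp _ (U rho0) (cl _ l1 t)); exact: cU.
by apply: (cvg_comp _ (U rho1) (cl _ l2 t)); exact: cU.
Qed.

Let cone_between : curve_between Omega rho0 rho1 cone.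
Proof.
have h1 (P : probability E R) t A : opening t = 1 -> side t = P ->
    measurable A -> cone t A = P A.
  move=> t1 tP mA; rewrite -[LHS]/(side t (homothety x0 (opening t) @^-1` A)) tP t1.
  by congr (P _); apply/seteqP; split => z /=; rewrite homothety1.
split=> [|A mA|A mA]; first exact: cone_curve.
  apply: h1 => //; first by rewrite /opening mulr0 sub0r normrN normr1.
  by rewrite /side invr_ge0 ler0n.
apply: h1 => //; first by rewrite /opening mulr1 ger0_norm; lra.
by rewrite /side ifF//; apply/negbTE; rewrite -ltNge invf_lt1// ltr1n.
Qed.

Let cone_admissible :
  (\int[mu]_(t in I01) \int[cone t]_(x in Omega)
       ((enorm (cone_velocity t x) / (2 * Dm)) `^ p x)%:E <= 1)%E.
Proof.
have D2 : 0 < 2 * Dm by rewrite mulr_gt0.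
apply: (@le_trans _ _ (\int[mu]_(t in I01) 1)%E); last first.
  rewrite integral_cst// mul1e le_eqVlt; apply/orP; left; apply/eqP.
  exact: lebesgue_measure01.
apply: le_ge0_integral => t tI; first by apply: integral_ge0 => x _; rewrite lee_fin powR_ge0.
pose g x := ((enorm (cone_velocity t x) / (2 * Dm)) `^ q x)%:E.
rewrite (eq_integral g); last by move=> x /set_mem Ox; rewrite /g qp.
apply: integral_cone_le => //.
- apply/measurable_EFinP; apply: measurable_fun_powR => //.
  by apply: measurable_funM => //; exact: measurable_enorm.
- by move=> x; rewrite lee_fin powR_ge0.
- move=> z Oz; rewrite lee_fin.
  apply: (@le_trans _ _ (1 `^ q (homothety x0 (opening t) z))); last by rewrite powR1.
  rewrite ge0_ler_powR ?nnegrE//; first exact: le_trans (q1 _).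
    by rewrite divr_ge0 ?enorm_ge0// ltW.
  by rewrite ler_pdivrMr// mul1r enorm_cone_velocity.
Qed.

(** On the two halves of [0, 1] the integrand is a ray derivative, with (a, b) = (1, -2) and (-1,
    2), so it integrates to boundary values. The test function vanishes at t = 0 and t = 1, and the
    two values at the apex are opposite. *)
Let cone_continuity : continuity_equation Omega cone cone_velocity.
Proof.
move=> phi phiT; have sphi : smooth phi by case: phiT.
pose M := unit_curve_measure cone_curve.
pose w (z : measurableTypeR R * E) := cone_velocity z.1 z.2.
pose h (z : measurableTypeR R * E) := dt phi z.1 z.2 +
  dot (gradient (fun y => phi (z.1, y)) z.2) (w z).
have mh : measurable_fun setT h.
  apply: measurable_funD; first exact: measurable_dt.
  by apply: measurable_field_dot => //; exact: measurable_gradient.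
have mw : measurable_fun setT (fun z => enorm (w z)) by exact: measurable_enorm.
have iw : M.-integrable setT (EFin \o (fun z => enorm (w z))).
  apply/integrableP; split; first exact/measurable_EFinP.
  under eq_integral do rewrite gee0_abs ?lee_fin ?enorm_ge0//.
  rewrite -(@ge0_integral_unit_curve _ _ _ _ mO cone_curve (EFin \o (fun z => enorm (w z)))
    (fun t x => (enorm (cone_velocity t x))%:E))//; last 2 first.
  - exact/measurable_EFinP.
  - by move=> z; rewrite lee_fin enorm_ge0.
  apply: (@le_lt_trans _ _ (\int[mu]_(t in I01) (2 * Dm)%:E)%E).
    apply: le_ge0_integral => t tI; first by apply: integral_ge0 => x _; rewrite lee_fin enorm_ge0.
    apply: integral_cone_le => //.
    + by apply/measurable_EFinP; exact: measurable_enorm.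
    + by move=> x; rewrite lee_fin enorm_ge0.
    + by move=> z Oz; rewrite lee_fin enorm_cone_velocity.
  rewrite integral_cst//; apply: (@le_lt_trans _ _ ((2 * Dm)%:E * 1)%E); last first.
    by rewrite mule1 ltry.
  rewrite le_eqVlt; apply/orP; left; apply/eqP; congr (_ * _)%E.
  exact: lebesgue_measure01.
have ih : M.-integrable setT (EFin \o h).
  have [B0 B0P] := dt_bounded phiT; have [B1 B1P] := gradient_bounded phiT.
  apply: (le_integrable_EFin (g := fun z => B1 * enorm (w z) + B0)) => //.
    move=> z; rewrite (le_trans (ler_normD _ _))// addrC lerD//.
    by rewrite (le_trans (normr_dot_le _ _))// ler_wpM2r ?enorm_ge0.
  apply: integrableD_EFin; first exact: integrableZ_EFin.
  by apply: (@bounded_integrable _ _ _ _ _ `|B0|).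
have gE t x : I01 t -> Omega x -> dt phi t x +
   dot (gradient (fun y => phi (t, y)) x) (cone_velocity t x) = h (t, x) by [].
have [iR e1 e2] := integral_unit_curve mO ih gE.
rewrite e2 -e1; pose G t := (\int[cone t]_(x in Omega) (dt phi t x +
  dot (gradient (fun y => phi (t, y)) x) (cone_velocity t x)))%:E.
rewrite -/G in iR *.
have rayfin (P : probability E R) a b t :
    (\int[P]_(z in Omega) (ray_derivative x0 phi a b (t, z))%:E)%E \is a fin_num.
  have [B _ BP] := bounded_ray_derivative Dm0 ODm phiT a b.
  apply: integrable_fin_num => //; apply: measurable_bounded_integrable => //.
  - by rewrite (le_lt_trans (probability_le1 _ _))// ltry.
  - apply: measurable_funTS; apply: continuous_measurable_rV.
    by apply: continuous_section; exact: continuous_ray_derivative.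
  - exists B; split; first exact: num_real.
    by move=> y By z Oz /=; rewrite (le_trans (BP t z Oz))// ltW.
have Gray t (a b : R) : I01 t -> t != 2^-1 -> a + b * t = opening t ->
    (if t <= 2^-1 then -2 else 2 : R) = b ->
    G t = (\int[side t]_(z in Omega) (ray_derivative x0 phi a b (t, z))%:E)%E.
  move=> tI t2 abt bt; rewrite -[RHS]fineK//; congr (fine _)%:E.
  rewrite (eq_integral (fun x => (h (t, x))%:E))// integral_cone//; last first.
    by apply/measurable_EFinP; apply: (measurableT_comp mh); exact: pair1_measurable.
  apply: eq_integral => z _; congr (_%:E).
  by rewrite /h /w /ray_derivative /= cone_velocity_homothety// bt abt.
have mG : measurable_fun I01 G by exact: measurable_int iR.
have h0 : 0 < 2^-1 :> R by rewrite invr_gt0.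
have h1 : 2^-1 < 1 :> R by rewrite invf_lt1// ltr1n.
(* The apex is left out: there the velocity is 0 by convention and need not match the ray
   derivative. A single time is a null set. *)
pose A0 := `[0%R, 2^-1[%classic : set (measurableTypeR R).
pose A := `[0%R, 2^-1]%classic : set (measurableTypeR R).
pose B := `]2^-1, 1%R]%classic : set (measurableTypeR R).
have A0I t : A0 t -> I01 t.
  by rewrite /A0 /= !in_itv/= => /andP[-> /ltW/le_trans]; apply; exact: ltW.
have BI t : B t -> I01 t.
  by rewrite /B /= !in_itv/= => /andP[/ltW t2 ->]; rewrite (le_trans _ t2)// ltW.
have AI t : A t -> I01 t.
  by rewrite /A /= !in_itv/= => /andP[-> /le_trans]; apply; exact: ltW.
have IAB : I01 = A `|` B.
  apply/seteqP; split => [t|t [/AI|/BI]//].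
  rewrite /A /B /= !in_itv/= => /andP[t0 t1]; have [t2|t2] := leP t 2^-1; [left|right].
    by rewrite t0.
  by [].
have mA0 : measurable A0 by exact: measurable_itv.
have mA : measurable A by exact: measurable_itv.
have mB : measurable B by exact: measurable_itv.
pose k0 t := (\int[rho0]_(z in Omega) (ray_derivative x0 phi 1 (-2) (t, z))%:E)%E.
pose k1 t := (\int[rho1]_(z in Omega) (ray_derivative x0 phi (-1) 2 (t, z))%:E)%E.
have G0 t : A0 t -> G t = k0 t.
  move=> tA; have := tA; rewrite /A0 /= in_itv/= => /andP[t0 t2].
  rewrite (Gray t 1 (-2)) ?(ltW t2)//.
  - by rewrite /side ltW.
  - exact: A0I.
  - by rewrite lt_eqF.
  - by rewrite /opening ler0_norm; lra.
have G1 t : B t -> G t = k1 t.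
  move=> tB; have := tB; rewrite /B /= in_itv/= => /andP[t2 t1].
  have t2F : (t <= 2^-1) = false by apply/negbTE; rewrite -ltNge.
  rewrite (Gray t (-1) 2) ?t2F//.
  - by rewrite /side t2F.
  - exact: BI.
  - by rewrite gt_eqF.
  - by rewrite /opening ger0_norm; lra.
have mk0 : measurable_fun A0 k0.
  apply: (eq_measurable_fun G); first by move=> t /set_mem; exact: G0.
  exact: measurable_funS mG.
have mk1 : measurable_fun B k1.
  apply: (eq_measurable_fun G); first by move=> t /set_mem; exact: G1.
  exact: measurable_funS mG.
have -> : (\int[mu]_(t in I01) G t = \int[mu]_(t in A) G t + \int[mu]_(t in B) G t)%E.
  rewrite IAB integral_setU//; first by rewrite -IAB.
  rewrite disj_set2E; apply/eqP/seteqP; split => // t [].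
  by rewrite /A /B /= !in_itv/= => /andP[_ t2] /andP[]; rewrite ltNge t2.
have -> : (\int[mu]_(t in A) G t = (phi (2^-1, x0))%:E)%E.
  transitivity (\int[mu]_(t in A0) G t)%E.
    by apply/esym; apply: integral_itv_bndo_bndc; exact: measurable_funS mG.
  transitivity (\int[mu]_(t in A0) k0 t)%E.
    by apply: eq_integral => t /set_mem; exact: G0.
  transitivity (\int[mu]_(t in A) k0 t)%E; first exact: integral_itv_bndo_bndc.
  rewrite [LHS](integral_rays mO Dm0 ODm phiT 1 (-2) rho0 h0).
  rewrite (eq_integral (fun=> (phi (2^-1, x0))%:E)); last first.
    move=> z _; congr (_%:E).
    rewrite (_ : 1 + -2 * 2^-1 = 0); last by field.
    rewrite homothety0 (spacetime_test_eq0 (t := 0) _ phiT) ?ltxx// subr0//.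
  by rewrite integral_cst// [X in (_ * X)%E]r0 mule1.
have -> : (\int[mu]_(t in B) G t = (- phi (2^-1, x0))%:E)%E.
  transitivity (\int[mu]_(t in B) k1 t)%E.
    by apply: eq_integral => t /set_mem; exact: G1.
  transitivity (\int[mu]_(t in `[2^-1%R, 1%R]%classic) k1 t)%E.
    exact: integral_itv_obnd_cbnd.
  rewrite [LHS](integral_rays mO Dm0 ODm phiT (-1) 2 rho1 h1).
  rewrite (eq_integral (fun=> (- phi (2^-1, x0))%:E)); last first.
    move=> z _; congr (_%:E).
    rewrite (_ : -1 + 2 * 2^-1 = 0); last by field.
    rewrite homothety0 (spacetime_test_eq0 (t := 1) _ phiT) ?ltxx ?andbF// sub0r//.
  by rewrite integral_cst// [X in (_ * X)%E]r1 mule1.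
by rewrite EFinN subee.
Qed.

Lemma wasserstein_le_diameter : (wasserstein Omega p rho0 rho1 <= (2 * Dm)%:E)%E.
Proof.
apply: (@le_trans _ _ (lux_norm_time Omega p cone cone_velocity)).
  apply: ereal_inf_lbound; exists (cone, cone_velocity) => //; split; last exact: cone_continuity.
    exact: cone_between.
  by apply: measurable_funTS; exact: measurable_fun_row.
apply: ereal_inf_lbound; exists (2 * Dm) => //; split; first by rewrite mulr_gt0.
exact: cone_admissible.
Qed.

End cone.

(** * Lower bound for the Finsler metric *)

Section finsler_lower_bound.
Context {R : realType} {n : nat}.
Local Notation E := ('rV[R]_n).
Variables (Omega : set E) (p q : E -> R) (pm pp : R).
Hypotheses (mO : measurable Omega) (mq : measurable_fun setT q)
  (qp : forall x, Omega x -> p x = q x) (pm1 : 1 < pm) (q_bnd : forall x, pm <= q x <= pp).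

Let q1 x : 1 < q x.
Proof. by have /andP[+ _] := q_bnd x; exact: lt_le_trans. Qed.

Variable rho : probability E R.
Hypothesis rO : prob_on Omega rho.

Let integrable_modular (l : R) (v w : E -> E) : 0 < l -> measurable_field setT w ->
  (forall x, Omega x -> v x = w x) ->
  (\int[rho]_(x in Omega) ((enorm (v x) / l) `^ p x)%:E <= 1)%E ->
  rho.-integrable setT (EFin \o (fun x => (enorm (w x) / l) `^ q x)) /\
  \int[rho]_x ((enorm (w x) / l) `^ q x) <= 1.
Proof.
move=> l0 mw vw adm.
have mk : measurable_fun setT (EFin \o (fun x => (enorm (w x) / l) `^ q x)).
  apply/measurable_EFinP; apply: measurable_fun_powR => //.
  by apply: measurable_funM => //; exact: measurable_enorm.
have le1 : (\int[rho]_x ((enorm (w x) / l) `^ q x)%:E <= 1)%E.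
  rewrite -(integral_prob_on (g := fun x => ((enorm (v x) / l) `^ p x)%:E) mO rO mk)//.
  by move=> x Ox; rewrite vw// qp.
have i0 : rho.-integrable setT (EFin \o (fun x => (enorm (w x) / l) `^ q x)).
  apply/integrableP; split => //.
  under eq_integral do rewrite gee0_abs ?lee_fin ?powR_ge0//.
  exact: le_lt_trans (ltry 1).
split => //; rewrite -lee_fin /Rintegral fineK//.
exact: integrable_fin_num.
Qed.

Lemma lp_field_extension (v : E -> E) : lp_field Omega p rho v ->
  exists w : E -> E, [/\ measurable_field setT w, forall x, Omega x -> v x = w x &
    rho.-integrable setT (EFin \o (fun x => enorm (w x)))].
Proof.
move=> [mv /ereal_inf_lt[_ [l [l0 adm] <-] _]].
exists (fun x => if x \in Omega then v x else 0).
have mw : measurable_field setT (fun x => if x \in Omega then v x else 0).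
  by apply: measurable_field_patch => //; exact: measurable_fun_field.
have vw x : Omega x -> v x = if x \in Omega then v x else 0.
  by move=> Ox; rewrite mem_set.
split => //; have [ik _] := integrable_modular l0 mw vw adm.
apply: le_integrable_EFin; first exact: measurable_enorm.
  move=> x; rewrite ger0_norm ?enorm_ge0//.
  exact: (@le_modular _ _ _ (q x) (enorm_ge0 _) l0 (ltW (q1 x))).
apply: integrableZ_EFin; apply: integrableD_EFin => //.
by apply: (@bounded_integrable _ _ _ rho _ 1) => // z; rewrite normr1.
Qed.

Lemma gradient_test (phi : E -> R) : test_function [set: E] phi ->
  measurable_field setT (gradient phi) /\ exists B, forall x, enorm (gradient phi x) <= B.
Proof.
move=> [sphi cphi _]; split.
  move=> i; under eq_fun do rewrite mxE; apply: continuous_measurable_rV.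
  exact: smooth_continuous_derive.
have /choice[B BP] : forall i : 'I_n, exists B, forall z, `|'D_(delta_mx 0 i) phi z| <= B.
  by move=> i; exact: derive_bounded.
exists (\sum_i B i) => x; apply: (le_trans (enorm_le_sum _)).
by apply: ler_sum => i _; rewrite mxE.
Qed.

Let integrable_dot_gradient (phi : E -> R) (w : E -> E) : test_function [set: E] phi ->
  measurable_field setT w -> rho.-integrable setT (EFin \o (fun x => enorm (w x))) ->
  rho.-integrable setT (EFin \o (fun x => dot (gradient phi x) (w x))).
Proof.
move=> /gradient_test[mg [B BP]] mw iw.
apply: (@le_integrable_EFin _ _ _ rho _ (fun x => B * enorm (w x))).
- exact: measurable_field_dot.
- by move=> x; rewrite (le_trans (normr_dot_le _ _))// ler_wpM2r ?enorm_ge0.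
- exact: integrableZ_EFin.
Qed.

Lemma finsler_lower_bound (nu : functional R n) (phi : E -> R) :
  test_function [set: E] phi ->
  ((nu phi / (1 + \int[rho]_x conj_power (q x) (gradient phi x)))%:E <=
    finsler Omega p rho nu)%E.
Proof.
move=> tphi; set A := \int[rho]_x _.
have A0 : 0 <= A by apply: Rintegral_ge0 => x _; exact: conj_power_ge0.
have A1 : 0 < 1 + A by rewrite ltr_wpDr.
have [mg bg] := gradient_test tphi.
have iA : rho.-integrable setT (EFin \o (fun x => conj_power (q x) (gradient phi x))).
  exact: (integrable_conj_power rho pm1 mq q_bnd (fun _ : unit => mg) (fun _ => bg) tt).
apply: le_ereal_inf_tmp => _ [v [lpv nuv] <-].
apply: le_ereal_inf_tmp => _ [w [lpw dw] <-].
apply: le_ereal_inf_tmp => _ [l [l0 adm] <-]; rewrite lee_fin ler_pdivrMr//.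
have l_neq0 : l != 0 by rewrite gt_eqF.
have [v' [mv' vv' iv']] := lp_field_extension lpv.
have [w' [mw' ww' iw']] := lp_field_extension lpw.
have ig u : measurable_field setT u -> measurable_fun setT (fun x => dot (gradient phi x) (u x)).
  by move=> mu; exact: measurable_field_dot.
have i1 := integrable_dot_gradient tphi mv' iv'.
have i2 := integrable_dot_gradient tphi mw' iw'.
have nuE : nu phi = \int[rho]_x dot (gradient phi x) (v' x).
  rewrite nuv//; apply: (Rintegral_prob_on mO rO); first exact: ig.
  by move=> x Ox; rewrite vv'.
have w0 : \int[rho]_x dot (gradient phi x) (w' x) = 0.
  rewrite -(dw phi tphi); apply/esym; apply: (Rintegral_prob_on mO rO); first exact: ig.
  by move=> x Ox; rewrite ww'.
have mu' : measurable_field setT (fun x => v' x + w' x) by exact: measurable_fieldD.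
have vwE x : Omega x -> v x + w x = v' x + w' x by move=> Ox; rewrite vv'// ww'.
have [ik k1] := integrable_modular l0 mu' vwE adm.
have -> : nu phi = \int[rho]_x (dot (gradient phi x) (v' x) + dot (gradient phi x) (w' x)).
  by rewrite (RintegralD measurableT i1 i2) w0 addr0.
apply: (@le_trans _ _ (\int[rho]_x (l * ((enorm (v' x + w' x) / l) `^ q x +
    conj_power (q x) (gradient phi x))))).
  apply: le_Rintegral => //; first exact: (integrableD_EFin i1 i2).
    by apply: integrableZ_EFin; exact: integrableD_EFin.
  move=> x _; rewrite -dotDr -[v' x + w' x](scalerKV l_neq0) dotZr ler_pM2l//.
  rewrite dotC enormZ (ger0_norm (ltW l0)) [l * _]mulrC mulfK ?gt_eqF//.
  exact: fenchel_young.
rewrite (RintegralZl l measurableT); last exact: integrableD_EFin.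
rewrite (RintegralD measurableT ik iA) ler_pM2l// lerD2r//.
Qed.

End finsler_lower_bound.

Lemma ae_ge0_integral d (T : measurableType d) (R : realType)
    (mu : {measure set T -> \bar R}) (D : set T) (h : T -> \bar R) :
  measurable D -> measurable_fun D h -> {ae mu, forall x, D x -> (0 <= h x)%E} ->
  (0 <= \int[mu]_(x in D) h x)%E.
Proof.
move=> mD mh h0; rewrite integralE.
rewrite [X in (_ - X)%E](_ : _ = 0%E) ?sube0; first exact: integral_ge0.
transitivity (\int[mu]_(x in D) (cst 0%E x))%E; last exact: integral0.
apply: ge0_ae_eq_integral => //; first exact: measurable_funeneg.
apply: filterS h0 => x hx Dx; rewrite funenegE.
by apply/max_idPr; rewrite leeNl oppe0; exact: hx.
Qed.

(** * The continuity equation after reparametrisation *)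

Lemma normr_mulB_le (R : realDomainType) (u v w B : R) : `|w| <= B ->
  `|u * w - v * w| <= B * `|u - v|.
Proof. by move=> wB; rewrite -mulrBl normrM mulrC ler_wpM2r. Qed.

Section time_changed_tests.
Context {R : realType} {n : nat}.
Local Notation E := ('rV[R]_n).

Lemma measurable_at_time d (Y : measurableType d) (h : measurableTypeR R * E -> Y)
    (g : measurableTypeR R -> measurableTypeR R) :
  measurable_fun setT h -> measurable_fun setT g ->
  measurable_fun setT (fun z : measurableTypeR R * E => h (g z.1, z.2)).
Proof.
move=> mh mg; apply: (measurableT_comp mh (g := fun z : measurableTypeR R * E => (g z.1, z.2))).
by apply: measurable_fun_pair => //; exact: measurableT_comp.
Qed.

(** The support is compact in ]0, 1[ x R^n, so its times have a minimum above 0 and a maximum below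
    1. *)
Lemma spacetime_test_margin (psi : R * E -> R) : spacetime_test psi ->
  exists2 d : R, 0 < d & forall t x, supp psi (t, x) -> d <= t <= 1 - d.
Proof.
move=> [_ cpsi Upsi].
have [s0|/set0P/negP/negPn/eqP s0] := pselect (supp psi !=set0); last first.
  by exists 1 => // t x; rewrite s0.
have cf : {within supp psi, continuous (fst : R * E -> R)}.
  by apply: continuous_subspaceT => z; exact: cvg_fst.
have [[a xa]] := compact_EVT_min s0 cpsi cf.
rewrite inE => /Upsi/= /andP[a0 _] mina.
have [[b xb]] := compact_EVT_max s0 cpsi cf.
rewrite inE => /Upsi/= /andP[_ b1] maxb.
exists (Num.min a (1 - b)); first by rewrite lt_min a0 subr_gt0.
move=> t x tx; have := mina _ (mem_set tx); have := maxb _ (mem_set tx).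
move=> /= tb ta; rewrite ge_min ta/= lerBrDr -lerBrDl ge_min.
by apply/orP; right; rewrite lerD2l lerN2.
Qed.

(** S need not map [0, 1] to itself. Being nondecreasing with S(0) < d and S(1) > 1 - d, it puts all
    times with d <= S(t) <= 1 - d inside ]0, 1[, where they form a compact set. *)
Lemma spacetime_test_time_change (psi : R * E -> R) (S : {poly R}) (d : R) :
  spacetime_test psi -> (forall t x, supp psi (t, x) -> d <= t <= 1 - d) ->
  {homo horner S : x y / x <= y} -> S.[0] < d -> 1 - d < S.[1] ->
  spacetime_test (fun z => psi (S.[z.1], z.2)).
Proof.
move=> [spsi cpsi Upsi] dP ndS S0 S1.
pose K := [set t : R | d <= S.[t] <= 1 - d].
have K01 t : K t -> 0 < t < 1.
  move=> /andP[dS Sd]; rewrite !ltNge; apply/andP; split; apply/negP => /ndS.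
    by rewrite leNgt (lt_le_trans S0).
  by rewrite leNgt (le_lt_trans Sd).
have clK : closed K.
  have -> : K = horner S @^-1` [set y | d <= y] `&` horner S @^-1` [set y | y <= 1 - d].
    by apply/seteqP; split => t /= => [/andP[]|[h1 h2]]//; apply/andP.
  apply: closedI; apply: preimage_closed.
  - by move=> t _; exact: continuous_horner.
  - exact: closed_ge.
  - by move=> t _; exact: continuous_horner.
  - exact: closed_le.
have cK : compact K.
  apply: (subclosed_compact clK (@segment_compact _ 0 1)) => t /K01/andP[t0 t1].
  by rewrite /= in_itv/= !ltW.
have c2 : compact (snd @` supp psi).
  by apply: continuous_compact => //; apply: continuous_subspaceT => z; exact: cvg_snd.
have cKK := compact_setX cK c2.
have sub : supp (fun z : R * E => psi (S.[z.1], z.2)) `<=` K `*` (snd @` supp psi).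
  have clKK : closed (K `*` (snd @` supp psi)) by apply: compact_closed.
  rewrite [X in _ `<=` X](proj1 (closure_id _) clKK).
  apply: closureS => -[t x] /= px.
  have sx : supp psi (S.[t], x) by exact: subset_closure.
  by split => /=; [exact: dP sx|exists (S.[t], x)].
split; first exact: smooth_time_change.
  by apply: (subclosed_compact _ cKK sub); exact: closed_closure.
by move=> z /sub[/K01].
Qed.

Lemma dt_time_change (psi : R * E -> R) (S : {poly R}) t x : smooth psi ->
  dt (fun z => psi (S.[z.1], z.2)) t x = S^`().[t] * dt psi S.[t] x.
Proof.
move=> spsi; have [_] := @is_derive_time_change _ _ psi S t x 1 0 spsi.
rewrite /dt => ->; rewrite mul1r.
have -> : ((0 : R), 0 : E) = (0 : R) *: ((0 : R), 0 : E) by rewrite scale0r.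
rewrite deriveZdir ?mul0r ?addr0//; first exact: smooth_derivable.
exact: smooth_continuous_derive.
Qed.

Lemma integrable_dt (N : {finite_measure set (measurableTypeR R * E)%type -> \bar R})
    (psi : R * E -> R) : spacetime_test psi ->
  N.-integrable setT (EFin \o (fun z => dt psi z.1 z.2)).
Proof.
move=> psiT; have [B BP] := dt_bounded psiT.
apply: (@bounded_integrable _ _ _ N _ B); last by move=> z; exact: BP.
by apply: measurable_dt; case: psiT.
Qed.

End time_changed_tests.

Section reparametrised_curve.
Context {R : realType} {n : nat}.
Local Notation E := ('rV[R]_n).
Local Notation mu := (@lebesgue_measure R).
Local Notation I01 := (`[0%R, 1%R]%classic : set R).
Variables (Omega : set E) (rho : R -> probability E R).
Hypotheses (mO : measurable Omega) (crho : curve Omega rho).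
Variables (f : measurableTypeR R -> R) (c : R).
Hypotheses (mf : measurable_fun setT f) (f0 : forall t, 0 <= f t)
  (c0 : 0 < c) (fc : forall t, I01 t -> c <= f t)
  (fout : forall t, ~ I01 t -> f t = 0) (f1 : (\int[mu]_t (f t)%:E = 1)%E).
Variable tau : R -> R.
Hypotheses (ctau : continuous tau) (tau01 : forall s, I01 (tau s))
  (tauK : forall s, I01 s -> elapsed f (tau s) = s)
  (elapsedK : forall t, I01 t -> I01 (elapsed f t) /\ tau (elapsed f t) = t).

Lemma curve_reparametrised : curve Omega (rho \o tau).
Proof.
split => [t _|g cg bg]; first exact: (crho.1 _ (tau01 t)).
have -> : (fun t => \int[(rho \o tau) t]_x g x) =
    ((fun t => \int[rho t]_x g x) \o clamp01) \o tau.
  by apply/funext => t /=; rewrite (clamp01_id (tau01 t)).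
apply: continuous_subspaceT => t; apply: (cvg_comp tau); first exact: ctau.
exact: (continuous_comp_clamp01 (crho.2 g cg bg)).
Qed.

Let M := curve_measure crho mf f0 f1.
Let M1 := unit_curve_measure crho.
Let M' := unit_curve_measure curve_reparametrised.

Lemma ge0_integral_reparametrised_curve (k k' : measurableTypeR R * E -> \bar R) :
  measurable_fun setT k -> measurable_fun setT k' ->
  (forall z, 0 <= k z)%E -> (forall z, 0 <= k' z)%E ->
  (forall t x, I01 t -> k' (t, x) = k (elapsed f t, x)) ->
  (\int[M']_z k z = \int[M]_z k' z)%E.
Proof.
move=> mk mk' k0 k'0 kk'.
rewrite [RHS](@ge0_integral_weighted_fibered _ _ _ _ _ mu f mf f0 f1)//.
pose K t := (\int[rho (clamp01 t)]_x k' (t, x))%E.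
rewrite -(ge0_integral_reparametrised (h := K) mf f0 c0 fc fout f1 ctau tau01 tauK)//; last 2 first.
- exact: (measurable_fibered (curve_measurable crho) mk' k'0).
- by move=> t; exact: integral_ge0.
rewrite -(@ge0_integral_unit_curve _ _ _ _ mO curve_reparametrised k (fun s x => k (s, x)))//.
apply: eq_integral => s /set_mem sI; rewrite /K (clamp01_id (tau01 s)).
apply: (integral_prob_on mO (crho.1 _ (tau01 s))).
  by apply: (measurableT_comp mk'); exact: pair1_measurable.
by move=> x _; rewrite kk'// tauK.
Qed.

Lemma integral_reparametrised_curve (h h' : measurableTypeR R * E -> R) :
  measurable_fun setT h -> M.-integrable setT (EFin \o h') ->
  (forall t x, I01 t -> h' (t, x) = h (elapsed f t, x)) ->
  M'.-integrable setT (EFin \o h) /\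
  (\int[M']_z (h z)%:E = \int[M]_z (h' z)%:E)%E.
Proof.
move=> mh ih' hh'; have mh' := measurable_int _ ih'.
have mhE : measurable_fun setT (EFin \o h) by exact/measurable_EFinP.
split.
  apply/integrableP; split => //.
  rewrite (@ge0_integral_reparametrised_curve _ (fun z => `|(h' z)%:E|%E))//.
  - by have /integrableP[] := ih'.
  - exact: measurableT_comp.
  - exact: measurableT_comp.
  - by move=> t x tI; rewrite hh'.
have ep : (\int[M']_z (EFin \o h)^\+ z = \int[M]_z (EFin \o h')^\+ z)%E.
  apply: ge0_integral_reparametrised_curve.
  - exact: measurable_funepos.
  - exact: measurable_funepos.
  - by move=> z; exact: funepos_ge0.
  - by move=> z; exact: funepos_ge0.
  - by move=> t x tI; rewrite !funeposE/= hh'.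
have em : (\int[M']_z (EFin \o h)^\- z = \int[M]_z (EFin \o h')^\- z)%E.
  apply: ge0_integral_reparametrised_curve.
  - exact: measurable_funeneg.
  - exact: measurable_funeneg.
  - by move=> z; exact: funeneg_ge0.
  - by move=> z; exact: funeneg_ge0.
  - by move=> t x tI; rewrite !funenegE/= hh'.
have E1 := integralE M' setT (EFin \o h); have E2 := integralE M setT (EFin \o h').
by apply: (etrans E1); rewrite ep em; exact/esym.
Qed.

Let integr01 : mu.-integrable I01 (EFin \o f).
Proof.
apply/integrableP; split; first by apply/measurable_EFinP; exact: measurable_funTS.
rewrite (@le_lt_trans _ _ (\int[mu]_t (f t)%:E)%E)//; last by rewrite f1 ltry.
rewrite integral_mkcond; apply: le_ge0_integral => t _; rewrite patchE; case: ifP => _ //.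
  by rewrite gee0_abs ?lee_fin.
by rewrite lee_fin.
Qed.

(** An L^1 bound on f - Q bounds the difference of the primitives uniformly. *)
Lemma elapsed_poly_dist (Q : {poly R}) (e t : R) : I01 t ->
  (\int[mu]_(x in I01) `|f x - Q.[x]|%:E <= e%:E)%E ->
  `|(primitive Q).[t] - elapsed f t| <= e.
Proof.
move=> tI le; have := tI; rewrite /= in_itv/= => /andP[t0 t1].
have mt : measurable (`[0%R, t]%classic : set (measurableTypeR R)) by exact: measurable_itv.
have sub : `[0%R, t]%classic `<=` I01.
  by move=> s; rewrite /= !in_itv/= => /andP[-> st]; exact: le_trans t1.
have iQ1 : mu.-integrable I01 (EFin \o horner Q).
  apply: continuous_compact_integrable; first exact: segment_compact.
  by apply: continuous_subspaceT; exact: continuous_horner.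
have iQ : mu.-integrable `[0%R, t]%classic (EFin \o horner Q).
  by apply: integrableS iQ1.
have jf : mu.-integrable `[0%R, t]%classic (EFin \o f) by apply: integrableS integr01.
have -> : (primitive Q).[t] = \int[mu]_(x in `[0, t]) Q.[x].
  by rewrite /Rintegral integral_horner.
rewrite /elapsed distrC -(RintegralB mt jf iQ).
have iB : mu.-integrable `[0%R, t]%classic (EFin \o (fun x => f x - Q.[x])).
  exact: (integrableB mt jf iQ).
rewrite (le_trans (le_normr_Rintegral mt iB))// -lee_fin (le_trans _ le)//.
have iA := integrable_abse iB.
rewrite /Rintegral fineK; last exact: integrable_fin_num iA.
rewrite [leLHS]integral_mkcond [leRHS]integral_mkcond; apply: le_ge0_integral => s _.
  by rewrite patchE; case: ifP => _ //; rewrite lee_fin.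
rewrite !patchE; case: ifPn => [/set_mem st|_]; first by rewrite mem_set//; exact: sub.
by case: ifP => _ //; rewrite lee_fin.
Qed.

Lemma eq_integral_curve (h h' : measurableTypeR R * E -> R) :
  M.-integrable setT (EFin \o h) -> M.-integrable setT (EFin \o h') ->
  (forall t x, I01 t -> h (t, x) = h' (t, x)) -> \int[M]_z h z = \int[M]_z h' z.
Proof.
move=> ih ih' hh'; congr fine.
have [_ <- _] := integral_curve mO fout ih (g := fun t x => h (t, x)) (fun t x _ _ => erefl).
have [_ <- _] := integral_curve mO fout ih' (g := fun t x => h (t, x)) (fun t x tI _ => hh' t x tI).
by [].
Qed.

Variables (J : measurableTypeR R * E -> E) (L : R).
Hypotheses (mJ : measurable_field setT J)
  (iJ : M.-integrable setT (EFin \o (fun z => enorm (J z)))).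
Hypothesis dualJ : forall phi, spacetime_test phi ->
  \int[M1]_z dt phi z.1 z.2 +
  L * \int[M]_z dot (J z) (gradient (fun y => phi (z.1, y)) z.2) = 0.

Section limit.
Variables (psi : R * E -> R) (psiT : spacetime_test psi).

Let spsi : smooth psi. Proof. by case: psiT. Qed.

Let measurable_dt_at (g : measurableTypeR R -> R) : measurable_fun setT g ->
  measurable_fun setT (fun z : measurableTypeR R * E => dt psi (g z.1) z.2).
Proof. exact: measurable_at_time (measurable_dt spsi). Qed.

Let measurable_gradient_at (g : measurableTypeR R -> R) : measurable_fun setT g ->
  measurable_field setT
    (fun z : measurableTypeR R * E => gradient (fun y => psi (g z.1, y)) z.2).
Proof. by move=> mg i; exact: measurable_at_time (measurable_gradient spsi i) mg. Qed.

Let integrable_dt_at (N : {finite_measure set (measurableTypeR R * E)%type -> \bar R})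
    (g : measurableTypeR R -> R) : measurable_fun setT g ->
  N.-integrable setT (EFin \o (fun z => dt psi (g z.1) z.2)).
Proof.
move=> mg; have [B BP] := dt_bounded psiT.
by apply: (@bounded_integrable _ _ _ N _ B) => //; exact: measurable_dt_at.
Qed.

Let integrable_gradient_at (g : measurableTypeR R -> R) : measurable_fun setT g ->
  M.-integrable setT (EFin \o
    (fun z => dot (J z) (gradient (fun y => psi (g z.1, y)) z.2))).
Proof.
move=> mg; have [B BP] := gradient_bounded psiT.
apply: (@le_integrable_EFin _ _ _ M _ (fun z => B * enorm (J z))).
- by apply: measurable_field_dot => //; exact: measurable_gradient_at.
- move=> z; rewrite (le_trans (normr_dot_le _ _))// mulrC ler_wpM2r ?enorm_ge0//.
- exact: integrableZ_EFin.
Qed.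

Let measurable_elapsed_clamp01 :
  measurable_fun setT ((elapsed f \o clamp01) : measurableTypeR R -> R).
Proof.
apply: continuous_measurable_fun; exact: (continuous_elapsed_clamp01 mf f0 f1).
Qed.

Let measurable_poly_clamp01 (S : {poly R}) :
  measurable_fun setT ((horner S \o clamp01) : measurableTypeR R -> R).
Proof.
apply: continuous_measurable_fun => t; apply: (cvg_comp clamp01 (horner S)).
  exact: continuous_clamp01.
exact: continuous_horner.
Qed.

(** The test function psi(S(t), x) has time derivative Q(t) times that of psi at the changed time.
    Were Q equal to f, [dualJ] would be the exact balance; exchanging the two costs at most B times
    their L^1 distance. *)
Let balance_error (Q : {poly R}) (e d B : R) : (forall x, 0 <= Q.[x]) -> e < d ->
  (forall t x, supp psi (t, x) -> d <= t <= 1 - d) -> 0 < d -> 0 <= B ->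
  (forall t x, `|dt psi t x| <= B) ->
  (\int[mu]_(x in I01) `|f x - Q.[x]|%:E <= e%:E)%E ->
  `|\int[M]_z dt psi (primitive Q).[clamp01 z.1] z.2 +
    L * \int[M]_z dot (J z) (gradient (fun y => psi ((primitive Q).[clamp01 z.1], y)) z.2)|
  <= B * e.
Proof.
move=> Q0 kd dP d0 B0 BP Qe; pose S := primitive Q.
pose a (z : measurableTypeR R * E) := dt psi S.[clamp01 z.1] z.2.
pose b (z : measurableTypeR R * E) :=
  dot (J z) (gradient (fun y => psi (S.[clamp01 z.1], y)) z.2).
rewrite -/S -/(\int[M]_z a z) -/(\int[M]_z b z).
have SP t : I01 t -> `|S.[t] - elapsed f t| <= e by move=> tI; exact: elapsed_poly_dist.
pose phi (z : R * E) := psi (S.[z.1], z.2).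
have phiT : spacetime_test phi.
  apply: (spacetime_test_time_change psiT dP).
  - exact: primitive_nondecreasing Q0.
  - by rewrite primitive0.
  (* S(1) is within e < d of elapsed time at 1, which is 1. *)
  - have I1 : I01 1 by rewrite /= in_itv/= ler01 lexx.
    have := SP 1 I1; rewrite (elapsed1 fout f1) ler_norml lerBrDr => /andP[+ _].
    by apply: lt_le_trans; rewrite [ltRHS]addrC ltrD2l ltrN2.
have mS : measurable_fun setT (horner S : measurableTypeR R -> R).
  by apply: continuous_measurable_fun; exact: continuous_horner.
have bE : \int[M]_z dot (J z) (gradient (fun y => phi (z.1, y)) z.2) = \int[M]_z b z.
  apply: eq_integral_curve.
  - exact: (integrable_gradient_at mS).
  - exact: (integrable_gradient_at (measurable_poly_clamp01 S)).
  - by move=> t x tI; rewrite /b /= clamp01_id.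
have -> : L * \int[M]_z b z = - \int[M1]_z dt phi z.1 z.2.
  by apply/eqP; rewrite -addr_eq0 addrC -bE; apply/eqP; exact: dualJ.
pose al t := \int[rho t]_(x in Omega) a (t, x).
have iak : M.-integrable setT (EFin \o a).
  exact: (integrable_dt_at M (measurable_poly_clamp01 S)).
have iph : M1.-integrable setT (EFin \o (fun z => dt phi z.1 z.2)).
  exact: integrable_dt.
have iat t : (rho t).-integrable Omega (EFin \o (fun x => a (t, x))).
  apply: (integrableS measurableT mO (@subsetT _ Omega)).
  apply: (@bounded_integrable _ _ _ (rho t) _ B); last by move=> x; exact: BP.
  apply: (measurableT_comp (measurable_dt_at (measurable_poly_clamp01 S))).
  exact: pair1_measurable.
have phE t : I01 t -> \int[rho t]_(x in Omega) dt phi t x = Q.[t] * al t.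
  move=> tI; rewrite /al -(RintegralZl _ mO (iat t)); apply: eq_Rintegral => x _.
  by rewrite /a /phi (dt_time_change S t x spsi) deriv_primitive /= (clamp01_id tI).
have alB t : I01 t -> `|al t| <= B.
  move=> tI; apply: (le_trans (le_normr_Rintegral mO (iat t))).
  apply: (@le_trans _ _ (\int[rho t]_(x in Omega) B)).
    apply: (le_Rintegral mO (integrable_abse (iat t))); last by move=> x _; exact: BP.
    apply: (integrableS measurableT mO (@subsetT _ Omega)).
    by apply: (@bounded_integrable _ _ _ (rho t) _ `|B|).
  by rewrite (Rintegral_cst _ mO) [X in fine X](crho.1 t tI) mulr1.
have [ia1 ea1 _] := integral_curve mO fout iak (g := fun t x => a (t, x)) (fun t x _ _ => erefl).
have [ib1 eb1 _] := integral_unit_curve mO iph (g := dt phi) (fun t x _ _ => erefl).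
have mI : measurable (I01 : set (measurableTypeR R)) by exact: measurable_itv.
have jb1 : mu.-integrable I01 (EFin \o (fun t => Q.[t] * al t)).
  by apply: (eq_integrable mI _ _ _ ib1) => t /set_mem tI; rewrite /= phE.
have -> : \int[M]_z a z = \int[mu]_(t in I01) (f t * al t).
  by congr fine; rewrite -[LHS]ea1.
have -> : \int[M1]_z dt phi z.1 z.2 = \int[mu]_(t in I01) (Q.[t] * al t).
  congr fine; rewrite -[LHS]eb1; apply: eq_integral => t /set_mem tI.
  by rewrite phE.
rewrite -(RintegralB mI ia1 jb1).
have id1 := integrableB mI ia1 jb1.
have iQ1 : mu.-integrable I01 (EFin \o horner Q).
  apply: continuous_compact_integrable; first exact: segment_compact.
  by apply: continuous_subspaceT; exact: continuous_horner.
have iab := integrable_abse (integrableB mI integr01 iQ1).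
apply: (le_trans (le_normr_Rintegral mI id1)).
apply: (@le_trans _ _ (\int[mu]_(t in I01) (B * `|f t - Q.[t]|))).
  apply: (le_Rintegral mI (integrable_abse id1) (integrableZl mI B iab)).
  by move=> t tI; exact: (normr_mulB_le (f t) Q.[t] (alB t tI)).
rewrite (RintegralZl B mI iab); apply: (ler_wpM2l B0).
rewrite -lee_fin /Rintegral (fineK (integrable_fin_num mI iab)); exact: Qe.
Qed.

(** Let Q tend to f in L^1 at rate 1 / (k + 1): the changed times converge uniformly to elapsed
    time, both integrals converge by domination, and the error vanishes. [balance_error] applies as
    soon as 1 / (k + 1) < d. *)
Lemma reparametrised_balance :
  \int[M]_z dt psi (elapsed f (clamp01 z.1)) z.2 +
  L * \int[M]_z dot (J z) (gradient (fun y => psi (elapsed f (clamp01 z.1), y)) z.2) = 0.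
Proof.
have [d d0 dP] := spacetime_test_margin psiT.
have [B BP] := dt_bounded psiT.
have B0 : 0 <= B by exact: le_trans (BP 0 0).
have /choice[Q QP] : forall k : nat, exists Q : {poly R}, (forall x, 0 <= Q.[x]) /\
    (\int[mu]_(x in I01) `|f x - Q.[x]|%:E <= (k.+1%:R^-1)%:E)%E.
  move=> k; have k0 : 0 < k.+1%:R^-1 :> R by rewrite invr_gt0.
  by have [Q Q0 QP] := poly_sqr_approx k0 f0 integr01; exists Q.
pose S k := primitive (Q k).
have SP k t : I01 t -> `|(S k).[t] - elapsed f t| <= k.+1%:R^-1.
  by move=> tI; apply: elapsed_poly_dist => //; exact: (QP k).2.
pose a k (z : measurableTypeR R * E) := dt psi (S k).[clamp01 z.1] z.2.
pose b k (z : measurableTypeR R * E) :=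
  dot (J z) (gradient (fun y => psi ((S k).[clamp01 z.1], y)) z.2).
pose a' (z : measurableTypeR R * E) := dt psi (elapsed f (clamp01 z.1)) z.2.
pose b' (z : measurableTypeR R * E) :=
  dot (J z) (gradient (fun y => psi (elapsed f (clamp01 z.1), y)) z.2).
have inv0 : (fun k : nat => k.+1%:R^-1 : R) @ \oo --> 0 by exact: cvg_harmonic.
have Scv t : (S k).[clamp01 t] @[k --> \oo] --> elapsed f (clamp01 t).
  apply/cvgrPdist_le => e e0; move/cvgrPdist_le : inv0 => /(_ e e0).
  apply: filterS => k; rewrite sub0r normrN ger0_norm ?invr_ge0// => ke.
  by rewrite distrC (le_trans _ ke)//; apply: SP; exact: clamp01_in.
have cD v : continuous ('D_v psi) by exact: smooth_continuous_derive.
have pr v t x : 'D_v psi ((S k).[clamp01 t], x) @[k --> \oo] -->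
    'D_v psi (elapsed f (clamp01 t), x).
  have cx : continuous (fun s : R => (s, x : E)).
    apply: (@continuous_pairing _ _ _ id (cst x)); first by move=> s; exact: cvg_id.
    by move=> s; exact: cst_continuous.
  exact: (cvg_comp _ _ (cvg_comp _ _ (Scv t) (cx _)) (cD v _)).
have acv : \int[M]_z a k z @[k --> \oo] --> \int[M]_z a' z.
  apply: (dominated_Rintegral_cvg (g := fun=> B) _ _ _ _ _).2.
  - by move=> k; exact: (measurable_dt_at (measurable_poly_clamp01 (S k))).
  - exact: (measurable_dt_at measurable_elapsed_clamp01).
  - apply: aeW => -[t x]; rewrite /a /a' /=.
    exact: pr.
  - by apply: (@bounded_integrable _ _ _ M _ `|B|).
  - by apply: aeW => z k; exact: BP.
have [C CP] := gradient_bounded psiT.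
have bcv : \int[M]_z b k z @[k --> \oo] --> \int[M]_z b' z.
  apply: (dominated_Rintegral_cvg (g := fun z => C * enorm (J z)) _ _ _ _ _).2.
  - by move=> k; exact: measurable_field_dot (measurable_gradient_at (measurable_poly_clamp01 (S k))).
  - exact: measurable_field_dot (measurable_gradient_at measurable_elapsed_clamp01).
  - apply: aeW => -[t x]; rewrite /b /b' /=; apply: cvg_dot; first exact: cvg_cst.
    apply: cvg_row => i; rewrite gradient_section; under eq_cvg do rewrite gradient_section.
    exact: pr.
  - exact: integrableZ_EFin.
  - apply: aeW => z k; rewrite (le_trans (normr_dot_le _ _))// mulrC ler_wpM2r ?enorm_ge0//.
have near0 : \forall k \near \oo, `|\int[M]_z a k z + L * \int[M]_z b k z| <= B * k.+1%:R^-1.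
  move/cvgrPdist_lt : inv0 => /(_ d d0); apply: filterS => k.
  have k0 : 0 <= k.+1%:R^-1 :> R by rewrite invr_ge0.
  rewrite sub0r normrN (ger0_norm k0) => kd.
  exact: (balance_error (QP k).1 kd dP d0 B0 BP (QP k).2).
have lim0 : \int[M]_z a k z + L * \int[M]_z b k z @[k --> \oo] --> 0.
  apply: norm_cvg0; apply: (@squeeze_cvgr _ _ _ _ (cst 0) (fun k => B * k.+1%:R^-1)).
  - by apply: filterS near0 => k ->; rewrite normr_ge0.
  - exact: cvg_cst.
  - rewrite -[X in _ --> X](mulr0 B); apply: cvgMl_tmp; exact: inv0.
have lim1 : \int[M]_z a k z + L * \int[M]_z b k z @[k --> \oo] -->
    \int[M]_z a' z + L * \int[M]_z b' z.
  by apply: cvgD => //; exact: cvgMl_tmp.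
exact: (cvg_unique _ lim1 lim0).
Qed.

Lemma reparametrised_equation :
  (\int[mu]_(s in I01) \int[(rho \o tau) s]_(x in Omega)
    (dt psi s x + dot (gradient (fun y => psi (s, y)) x) (L *: J (tau s, x)))%:E = 0)%E.
Proof.
pose h (z : measurableTypeR R * E) := dt psi z.1 z.2 +
  dot (gradient (fun y => psi (z.1, y)) z.2) (L *: J (tau z.1, z.2)).
pose a' (z : measurableTypeR R * E) := dt psi (elapsed f (clamp01 z.1)) z.2.
pose b' (z : measurableTypeR R * E) :=
  dot (J z) (gradient (fun y => psi (elapsed f (clamp01 z.1), y)) z.2).
have mtau : measurable_fun (setT : set (measurableTypeR R))
    (tau : measurableTypeR R -> measurableTypeR R) by exact: continuous_measurable_fun.
have mh : measurable_fun setT h.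
  apply: measurable_funD; first exact: (measurable_dt spsi).
  apply: measurable_field_dot; first exact: (measurable_gradient spsi).
  by apply: measurable_fieldZ => // i; exact: measurable_at_time (mJ i) mtau.
have ia : M.-integrable setT (EFin \o a').
  exact: (integrable_dt_at M measurable_elapsed_clamp01).
have ib : M.-integrable setT (EFin \o b').
  exact: (integrable_gradient_at measurable_elapsed_clamp01).
have ib2 : M.-integrable setT (EFin \o (fun z => L * b' z)) by exact: integrableZ_EFin.
have iab : M.-integrable setT (EFin \o (fun z => a' z + L * b' z)).
  exact: integrableD_EFin.
have hE t x : I01 t -> a' (t, x) + L * b' (t, x) = h (elapsed f t, x).
  move=> tI; rewrite /h /a' /b' /= clamp01_id// (elapsedK tI).2; congr (_ + _).
  by rewrite dotZr dotC.
have [ih eh] := integral_reparametrised_curve mh iab hE.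
have gE s x : I01 s -> Omega x -> dt psi s x +
  dot (gradient (fun y => psi (s, y)) x) (L *: J (tau s, x)) = h (s, x) by [].
have [_ _ e2] := integral_unit_curve mO ih gE.
apply: (etrans e2); apply: (etrans eh).
rewrite -(fineK (integrable_fin_num measurableT iab)); congr (_%:E).
transitivity (\int[M]_z (a' z + L * b' z)); first by [].
rewrite (RintegralD measurableT ia ib2) (RintegralZl L measurableT ib).
exact: reparametrised_balance.
Qed.

End limit.

Lemma continuity_equation_reparametrised :
  continuity_equation Omega (rho \o tau) (fun s x => L *: J (tau s, x)).
Proof. by move=> psi psiT; exact: reparametrised_equation. Qed.

End reparametrised_curve.

(** * Comparison of the distances *)

Section length_bound.
Context {R : realType} {n : nat}.
Local Notation E := ('rV[R]_n).
Local Notation mu := (@lebesgue_measure R).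
Local Notation I01 := (`[0%R, 1%R]%classic : set R).
Local Notation T := (measurableTypeR R * E)%type.
Variables (Omega : set E) (p q : E -> R) (pm pp : R).
Hypotheses (mO : measurable Omega) (mq : measurable_fun setT q)
  (qp : forall x, Omega x -> p x = q x) (pm1 : 1 < pm) (q_bnd : forall x, pm <= q x <= pp).

Let q1 x : 1 < q x.
Proof. by have /andP[+ _] := q_bnd x; exact: lt_le_trans. Qed.

Let mI : measurable (I01 : set (measurableTypeR R)).
Proof. exact: measurable_itv. Qed.

Let q2 (z : T) := q z.2.

Let mq2 : measurable_fun setT q2.
Proof. by apply: measurableT_comp. Qed.

Variables (rho : R -> probability E R) (nu : R -> functional R n).
Hypotheses (crho : curve Omega rho) (td : time_derivative Omega rho nu)
  (finite_length : (finsler_length Omega p rho nu < +oo)%E).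

(** Test functions as an index type, shared by the essential supremum and the duality. *)
Let test := {phi : R * E -> R | spacetime_test phi}.

Let G (i : test) (z : T) := gradient (fun y => sval i (z.1, y)) z.2.

Let mG i : measurable_field setT (G i).
Proof. by apply: measurable_gradient; case: (svalP i). Qed.

Let bG i : exists B, forall z, enorm (G i z) <= B.
Proof. by have [B BP] := gradient_bounded (svalP i); exists B => z; exact: BP. Qed.

Let phi_star i (z : T) := conj_power (q2 z) (G i z).

Let mphi_star i : measurable_fun setT (phi_star i).
Proof. by apply: measurable_conj_power => // z _; exact: q1. Qed.

Let A i (t : R) := \int[rho (clamp01 t)]_x phi_star i (t, x).

Let A0 i t : 0 <= A i t.
Proof. by apply: Rintegral_ge0 => x _; apply: conj_power_ge0; exact: q1. Qed.

Let mA i : measurable_fun (setT : set (measurableTypeR R)) (A i).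
Proof.
apply: (measurableT_comp (f := fine)) => //.
apply: (measurable_fibered (curve_measurable crho) (h := EFin \o phi_star i)).
  exact/measurable_EFinP.
by move=> z; rewrite lee_fin conj_power_ge0//; exact: q1.
Qed.

Let N (i : test) t := nu t (fun x => sval i (t, x)).

Let iN i : mu.-integrable I01 (EFin \o N i).
Proof. exact: (td (svalP i)).1. Qed.

(** Lower bound on the Finsler norm at time t given by one test function, extended by 0 off [0, 1],
    where [N i] is not known to be measurable. *)
Let slope i t := if t \in I01 then Num.max 0 (N i t / (1 + A i t)) else 0.

Let mslope i : measurable_fun (setT : set (measurableTypeR R)) (slope i).
Proof.
apply: (measurable_patch (T := measurableTypeR R)) => //.
apply: measurable_maxr => //; apply: measurable_funM.
  by apply/measurable_EFinP; exact: measurable_int (iN i).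
apply: measurable_funTS; apply: measurable_fun_inv => //.
  by move=> t _; rewrite ltr_wpDr// A0.
exact: measurable_funD.
Qed.

Let F t := ((fun t => finsler Omega p (rho t) (nu t)) \_ I01) t.

Let slope_le i t : ((slope i t)%:E <= F t)%E.
Proof.
rewrite /slope /F patchE; case: ifPn => // /set_mem tI.
rewrite /Num.max; case: ifP => _; last exact: finsler_ge0.
have -> : A i t = \int[rho t]_x conj_power (q x) (gradient (fun y => sval i (t, y)) x).
  by rewrite /A clamp01_id.
exact: (finsler_lower_bound mO mq qp pm1 q_bnd (crho.1 t tI) (nu t) (test_section t (svalP i))).
Qed.

Let F0 t : (0 <= F t)%E.
Proof. by rewrite /F patchE; case: ifP => _ //; exact: finsler_ge0. Qed.

Let F_length : (\int[mu]_t F t = finsler_length Omega p rho nu)%E.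
Proof. by rewrite /finsler_length [RHS]integral_mkcond. Qed.

Lemma slope_majorant : exists lam : measurableTypeR R -> R,
  [/\ measurable_fun setT lam, forall t, 0 <= lam t,
    (\int[mu]_t (lam t)%:E <= finsler_length Omega p rho nu)%E &
    forall i, {ae mu, forall t, slope i t <= lam t}].
Proof.
have Foo : (\int[mu]_t F t < +oo)%E by rewrite F_length.
have [lam [h1 h2 h3 h4]] :=
  @essential_upper_bound _ (measurableTypeR R) R mu test slope F mslope slope_le F0 Foo.
by exists lam; split => //; rewrite -F_length.
Qed.

Variables (lam : measurableTypeR R -> R) (e : R).
Hypotheses (e0 : 0 < e) (mlam : measurable_fun setT lam) (lam0 : forall t, 0 <= lam t)
  (ilam : (\int[mu]_t (lam t)%:E <= finsler_length Omega p rho nu)%E)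
  (slope_lam : forall i, {ae mu, forall t, slope i t <= lam t}).

Let ilam01 : (\int[mu]_(t in I01) (lam t)%:E <= finsler_length Omega p rho nu)%E.
Proof.
apply: le_trans ilam; rewrite [leLHS]integral_mkcond; apply: le_ge0_integral => t _.
  by rewrite patchE; case: ifP => _ //; rewrite lee_fin.
by rewrite patchE; case: ifP => _ //; rewrite lee_fin.
Qed.

Let lam_fin : (\int[mu]_(t in I01) (lam t)%:E)%E \is a fin_num.
Proof.
rewrite ge0_fin_numE; first exact: le_lt_trans finite_length.
by apply: integral_ge0 => t _; rewrite lee_fin.
Qed.

Let Lam := fine (\int[mu]_(t in I01) (lam t)%:E)%E + e.

Let Lam0 : 0 < Lam.
Proof. by rewrite ltr_wpDl// fine_ge0// integral_ge0// => t _; rewrite lee_fin. Qed.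

Let Lam_le : (Lam%:E <= finsler_length Omega p rho nu + e%:E)%E.
Proof. by rewrite /Lam EFinD fineK// leeD2r. Qed.

Let f (t : measurableTypeR R) : R := indic01 t * ((lam t + e) / Lam).

Let mf : measurable_fun setT f.
Proof.
apply: measurable_funM; first exact: measurable_indic01.
by apply: measurable_funM => //; exact: measurable_funD.
Qed.

Let f0 t : 0 <= f t.
Proof.
apply: mulr_ge0; first exact: indic01_ge0.
by apply: divr_ge0; [apply: addr_ge0; [exact: lam0|exact: ltW]|exact: ltW].
Qed.

Let fout t : ~ I01 t -> f t = 0.
Proof. by move=> tI; rewrite /f indic01_out// mul0r. Qed.

Let fin t : I01 t -> f t = (lam t + e) / Lam.
Proof. by move=> tI; rewrite /f indic01_in// mul1r. Qed.

Let c := e / Lam.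

Let c0 : 0 < c. Proof. exact: divr_gt0. Qed.

Let fc t : I01 t -> c <= f t.
Proof. by move=> tI; rewrite fin// ler_pM2r ?invr_gt0// lerDr. Qed.

Let f1 : (\int[mu]_t (f t)%:E = 1)%E.
Proof.
transitivity (\int[mu]_(t in I01) (Lam^-1%:E * ((lam t)%:E + e%:E)))%E.
  rewrite [RHS]integral_mkcond; apply: eq_integral => t _; rewrite patchE.
  case: ifPn => [/set_mem tI|/negP tI].
    by rewrite fin// mulrC EFinM EFinD.
  by rewrite fout// => tI'; apply: tI; rewrite inE.
rewrite ge0_integralZl_EFin//; last 3 first.
- by move=> t _; rewrite adde_ge0// lee_fin// ltW.
- by apply: emeasurable_funD => //; apply/measurable_EFinP; exact: measurable_funTS.
- by rewrite invr_ge0 ltW.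
rewrite ge0_integralD//; last 3 first.
- by move=> t _; rewrite lee_fin.
- by apply/measurable_EFinP; exact: measurable_funTS.
- by move=> t _; rewrite lee_fin ltW.
rewrite integral_cst// [X in (_ * (_ + _ * X))%E]lebesgue_measure01 mule1.
rewrite -(fineK lam_fin) -EFinD -EFinM.
by rewrite mulVf// gt_eqF.
Qed.

Let M := curve_measure crho mf f0 f1.
Let M1 := unit_curve_measure crho.

(** With this value the constraint T i = int dot J (G i) dM says that Lam J solves the weak
    equation: - int dt phi dM1 = Lam int dot J (grad phi) dM. *)
Let Tf (i : test) := - (Lam^-1 * \int[M1]_z dt (sval i) z.1 z.2).

Let i_dt (i : test) : M1.-integrable setT (EFin \o (fun z => dt (sval i) z.1 z.2)).
Proof. exact: integrable_dt (svalP i). Qed.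

Let linG i j (a : R) : exists k, (forall x, G k x = a *: G i x + G j x) /\
  Tf k = a * Tf i + Tf j.
Proof.
pose k : test := exist _ _ (spacetime_test_lin a (svalP i) (svalP j)).
have si : smooth (sval i) by case: (svalP i).
have sj : smooth (sval j) by case: (svalP j).
exists k; split; first by move=> z; exact: gradient_lin.
have e1 : \int[M1]_z dt (sval k) z.1 z.2 =
    \int[M1]_z (a * dt (sval i) z.1 z.2 + dt (sval j) z.1 z.2).
  by apply: eq_Rintegral => z _; exact: dt_lin.
rewrite /Tf e1 (RintegralD measurableT (integrableZ_EFin a (i_dt i)) (i_dt j)).
rewrite (RintegralZl a measurableT (i_dt i)).
by rewrite mulrDr opprD mulrN mulrCA.
Qed.

Let TN i : Tf i = Lam^-1 * \int[mu]_(t in I01) N i t.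
Proof.
have [_ h] := td (svalP i).
have [_ _ h1] := integral_unit_curve mO (i_dt i) (g := dt (sval i)) (fun t x _ _ => erefl).
have h2 : (\int[M1]_z (dt (sval i) z.1 z.2)%:E = - \int[mu]_(t in I01) (N i t)%:E)%E.
  by rewrite -[LHS]h1.
rewrite /Tf -mulrN; congr (_ * _).
by rewrite [X in - X]/Rintegral [X in fine X]h2 fineN opprK.
Qed.

Let i_star i : M.-integrable setT (EFin \o phi_star i).
Proof. exact: (integrable_conj_power M pm1 mq2 (fun z => q_bnd z.2) mG bG i). Qed.

(** Lam f = lam + e on [0, 1], so the claim is N <= (lam + e) (1 + A), a consequence of slope <=
    lam. *)
Let slope_Lam i t : I01 t -> slope i t <= lam t ->
  (0 <= (Lam * (f t + f t * A i t) - N i t)%:E)%E.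
Proof.
move=> tI slt.
have A1 : 0 < 1 + A i t by rewrite ltr_wpDr// A0.
have E : Lam * (f t + f t * A i t) = (lam t + e) * (1 + A i t).
  by rewrite (fin tI); field; rewrite gt_eqF.
rewrite lee_fin E subr_ge0; apply: (@le_trans _ _ (lam t * (1 + A i t))).
  rewrite -ler_pdivrMr//; apply: le_trans slt; rewrite /slope mem_set//.
  by rewrite le_max lexx orbT.
by apply: ler_wpM2r; [exact: ltW|rewrite lerDl ltW].
Qed.

(** Integration of [slope_Lam] in time: the constant 1 is the mass of f, and Lam cancels against the
    factor in [Tf]. *)
Let Tf_le i : Tf i <= 1 + \int[M]_z phi_star i z.
Proof.
have gE t x : I01 t -> Omega x -> phi_star i (t, x) = phi_star i (t, x) by [].
have [iA eA _] := integral_curve mO fout (i_star i) (g := fun t x => phi_star i (t, x)) gE.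
have AE t : I01 t -> \int[rho t]_(x in Omega) phi_star i (t, x) = A i t.
  move=> tI; rewrite /A clamp01_id//.
  apply: (Rintegral_prob_on mO (crho.1 t tI)) => //.
  by apply: (measurableT_comp (mphi_star i)); exact: pair1_measurable.
have ifA : mu.-integrable I01 (EFin \o (fun t => f t * A i t)).
  by apply: (eq_integrable mI _ _ _ iA) => t /set_mem tI; rewrite /= AE.
have iF : mu.-integrable I01 (EFin \o f).
  apply: (integrableS (measurableT : measurable (setT : set (measurableTypeR R))) mI (@subsetT _ _)).
  apply/integrableP; split; first exact/measurable_EFinP.
  rewrite (eq_integral (EFin \o f)) => [|t _]; last by rewrite /= ger0_norm.
  by rewrite [X in (X < _)%E]f1 ltry.
have EA : \int[mu]_(t in I01) (f t * A i t) = \int[M]_z phi_star i z.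
  congr fine; rewrite -[RHS]eA; apply: eq_integral => t /set_mem tI.
  by rewrite AE.
have EF : \int[mu]_(t in I01) f t = 1.
  rewrite /Rintegral (_ : integral _ _ _ = 1%E)// -f1 integral_mkcond.
  apply: eq_integral => t _; rewrite patchE; case: ifPn => // /negP tI.
  by rewrite fout// => tI'; apply: tI; rewrite inE.
have iS : mu.-integrable I01 (EFin \o (fun t => f t + f t * A i t)).
  exact: (integrableD mI iF ifA).
have iH : mu.-integrable I01 (EFin \o (fun t => Lam * (f t + f t * A i t))).
  exact: (integrableZl mI Lam iS).
have := @ae_ge0_integral _ _ _ mu I01 (EFin \o (fun t => Lam * (f t + f t * A i t) - N i t)) mI.
have iD : mu.-integrable I01 (EFin \o (fun t => Lam * (f t + f t * A i t) - N i t)).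
  exact: (integrableB mI iH (iN i)).
move=> /(_ (measurable_int _ iD)) ge0.
have {}ge0 : 0 <= \int[mu]_(t in I01) (Lam * (f t + f t * A i t) - N i t).
  apply: fine_ge0; apply: ge0; have := slope_lam i.
  apply: (@filterS _ _ (ae_filter_ringOfSetsType mu)) => t slt tI.
  exact: (slope_Lam tI slt).
rewrite TN -(ler_pM2l Lam0) mulrA divff ?gt_eqF// mul1r -subr_ge0.
rewrite -EA -[X in Lam * (X + _)]EF -(RintegralD mI iF ifA) -(RintegralZl Lam mI iS).
by rewrite -(RintegralB mI iH (iN i)).
Qed.

Let test0 : test := exist _ _ (@spacetime_test0 R n).

Lemma wasserstein_le_of_majorant (rho0 rho1 : probability E R) :
  (forall B, measurable B -> rho 0 B = rho0 B) ->
  (forall B, measurable B -> rho 1 B = rho1 B) ->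
  (wasserstein Omega p rho0 rho1 <= finsler_length Omega p rho nu + e%:E)%E.
Proof.
move=> r0 r1.
have [J [mJ J1 JT]] := fenchel_duality pm1 mq2 (fun z => q_bnd z.2) test0 mG bG linG Tf_le.
have [tau [ctau tau01 tau0 tau1 [tauK elapsedK]]] := elapsed_inverse mf f0 c0 fc fout f1.
have mJq : measurable_fun setT (fun z => enorm (J z) `^ q2 z).
  by apply: measurable_fun_powR => //; exact: measurable_enorm.
have iJq : M.-integrable setT (EFin \o (fun z => enorm (J z) `^ q2 z)).
  apply/integrableP; split; first exact/measurable_EFinP.
  under eq_integral do rewrite gee0_abs ?lee_fin ?powR_ge0//.
  exact: le_lt_trans (ltry 1).
have iJ : M.-integrable setT (EFin \o (fun z => enorm (J z))).
  apply: (@le_integrable_EFin _ _ _ M _ (fun z => 1 + enorm (J z) `^ q2 z)).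
  - exact: measurable_enorm.
  - move=> z; rewrite ger0_norm ?enorm_ge0//.
    have := le_modular (enorm_ge0 (J z)) ltr01 (ltW (q1 z.2)).
    by rewrite mul1r divr1.
  - apply: integrableD_EFin => //.
    by apply: (@bounded_integrable _ _ _ M _ 1) => // z; rewrite normr1.
have dualJ phi : spacetime_test phi -> \int[M1]_z dt phi z.1 z.2 +
    Lam * \int[M]_z dot (J z) (gradient (fun y => phi (z.1, y)) z.2) = 0.
  move=> phiT; have [_ h] := JT (exist _ phi phiT).
  by rewrite -[X in _ * X]h /Tf mulrN mulrA divff ?gt_eqF// mul1r subrr.
have mtau : measurable_fun (setT : set (measurableTypeR R))
  (tau : measurableTypeR R -> measurableTypeR R) by exact: continuous_measurable_fun.
pose v s x := Lam *: J (tau s, x).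
have crho' := curve_reparametrised crho ctau tau01.
apply: (@le_trans _ _ (lux_norm_time Omega p (rho \o tau) v)).
  apply: ereal_inf_lbound; exists (rho \o tau, v) => //; split => /=.
  - split => [|B mB|B mB]; first exact: crho'.
      by rewrite /= tau0; exact: r0.
    by rewrite /= tau1; exact: r1.
  - apply: measurable_funTS; apply: measurable_fun_row; apply: measurable_fieldZ => // i.
    exact: measurable_at_time (mJ i) mtau.
  - exact: (continuity_equation_reparametrised mO c0 fc fout ctau tau01 tauK elapsedK mJ iJ dualJ).
(* The level Lam is admissible: after the change of time, the modular of v at this level is that of
   J, at most 1 by duality. *)
apply: le_trans Lam_le; apply: ereal_inf_lbound; exists Lam => //; split => //.
pose k (z : T) := (enorm (J (tau z.1, z.2)) `^ q2 z)%:E.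
have mk : measurable_fun setT k.
  apply/measurable_EFinP; apply: measurable_fun_powR => //; apply: measurable_enorm => // i.
  exact: measurable_at_time (mJ i) mtau.
have k0 z : (0 <= k z)%E by rewrite lee_fin powR_ge0.
have vk s x : I01 s -> Omega x -> ((enorm (v s x) / Lam) `^ p x)%:E = k (s, x).
  move=> sI Ox; rewrite /k /v enormZ (ger0_norm (ltW Lam0)) mulrC mulrA mulVf ?gt_eqF//.
  by rewrite mul1r qp.
rewrite [leLHS](ge0_integral_unit_curve mO crho' mk k0 vk).
have k'E t x : I01 t -> (enorm (J (t, x)) `^ q2 (t, x))%:E = k (elapsed f t, x).
  by move=> tI; rewrite /k /= (elapsedK t tI).2.
have mk' : measurable_fun setT (fun z => (enorm (J z) `^ q2 z)%:E) by exact/measurable_EFinP.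
have k'0 z : (0 <= (enorm (J z) `^ q2 z)%:E)%E by rewrite lee_fin powR_ge0.
rewrite [leLHS](ge0_integral_reparametrised_curve mO crho mf f0 c0 fc fout f1 ctau tau01 tauK
  mk mk' k0 k'0 k'E).
exact: J1.
Qed.

End length_bound.

(** Write w = w^(1-a) w^a and bound the first factor by (1 + D)^(1-a) <= 1 + D; adding 1 to D
    ensures a base at least 1. *)
Lemma le_powR_bounded (R : realType) (w D a : R) :
  0 <= w -> w <= D -> 0 < a -> a <= 1 -> w <= (1 + D) * w `^ a.
Proof.
rewrite le_eqVlt => /predU1P[<-|w0] wD a0 a1.
  by rewrite powR0 ?mulr0// gt_eqF.
rewrite -{1}(powRr1 (ltW w0)) -{1}(subrK a 1) powRD; last first.
  by rewrite (gt_eqF w0) implybT.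
apply: ler_wpM2r; first exact: powR_ge0.
have D1 : 1 <= 1 + D by rewrite lerDl (le_trans (ltW w0)).
apply: (@le_trans _ _ ((1 + D) `^ (1 - a))).
  apply: ge0_ler_powR; rewrite ?nnegrE ?subr_ge0//.
  - exact: ltW.
  - exact: le_trans D1.
  - by rewrite (le_trans wD)// lerDr.
rewrite -[leRHS]powRr1; last exact: le_trans D1.
by apply: ler_powR => //; rewrite gerBl ltW.
Qed.

Lemma bounded_set_enorm (R : realType) (n : nat) (Omega : set 'rV[R]_n) (x0 : 'rV[R]_n) :
  bounded_set Omega -> exists2 Dm : R, 0 < Dm & forall z, Omega z -> enorm (z - x0) <= Dm.
Proof.
move=> /ex_strict_bound_gt0[M M0 MP]; exists (n%:R * (M + `|x0|) + 1).
  by rewrite ltr_wpDl// mulr_ge0// addr_ge0// ltW.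
move=> z Oz; apply: (le_trans (enorm_le_mx_norm _)); rewrite -[leLHS]addr0 lerD//.
rewrite ler_wpM2l// (le_trans (ler_normB _ _))// lerD2r.
by rewrite ltW// MP.
Qed.

Lemma wasserstein_le_finsler_distance (R : realType) (n : nat) (Omega : set 'rV[R]_n)
    (p q : 'rV[R]_n -> R) (pm pp : R) (rho0 rho1 : probability 'rV[R]_n R) :
  measurable Omega -> measurable_fun setT q -> (forall x, Omega x -> p x = q x) ->
  1 < pm -> (forall x, pm <= q x <= pp) ->
  (wasserstein Omega p rho0 rho1 <= finsler_distance Omega p rho0 rho1)%E.
Proof.
move=> mO mq qp pm1 qb; apply: le_ereal_inf_tmp => _ [[rho nu] /= [[crho r0 r1] td _] <-].
have [->|] := eqVneq (finsler_length Omega p rho nu) +oo%E.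
  exact: leey.
rewrite -ltey => fin_len; apply/lee_addgt0Pr => e e0.
have [lam [mlam lam0 ilam slope_lam]] := slope_majorant mO mq qp pm1 qb crho td fin_len.
exact: (wasserstein_le_of_majorant mO mq qp pm1 qb crho td fin_len e0 mlam lam0 ilam slope_lam r0 r1).
Qed.

Lemma finsler_distance_le_powR (R : realType) (n : nat) (Omega : set 'rV[R]_n)
    (p q : 'rV[R]_n -> R) (x0 : 'rV[R]_n) (Dm a : R) (rho0 rho1 : probability 'rV[R]_n R) :
  measurable Omega -> convex_set Omega -> Omega x0 -> 0 < Dm ->
  (forall z, Omega z -> enorm (z - x0) <= Dm) ->
  measurable_fun setT q -> (forall x, Omega x -> p x = q x) -> (forall x, 1 <= q x) ->
  0 < a -> a <= 1 -> prob_on Omega rho0 -> prob_on Omega rho1 ->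
  (finsler_distance Omega p rho0 rho1 <=
    (2 * (1 + 2 * Dm))%:E * wasserstein Omega p rho0 rho1 `^ a)%E.
Proof.
move=> mO cO Ox0 Dm0 ODm mq qp q1 a0 a1 r0 r1.
apply: (le_trans (finsler_distance_le_wasserstein mO mq qp q1 rho0 rho1)).
have := wasserstein_le_diameter mO cO Ox0 Dm0 ODm mq qp q1 r0 r1.
have := wasserstein_ge0 Omega p rho0 rho1.
case: (wasserstein Omega p rho0 rho1) => [w| |]//.
move=> w0 wD; rewrite poweR_EFin -!EFinM lee_fin -mulrA ler_wpM2l//.
exact: le_powR_bounded.
Qed.

Theorem theorem4p1 (R : realType) (N : nat) (Omega : set 'rV[R]_N)
    (p : 'rV[R]_N -> R)
    (N_ge1 : (1 <= N)%N)
    (Omega_open : open Omega) (Omega_neq0 : Omega !=set0)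
    (Omega_bounded : bounded_set Omega) (Omega_convex : convex_set Omega)
    (Omega_smooth : smooth_boundary Omega)
    (p_measurable : measurable_fun Omega p)
    (p_minus_gt1 : (1 < p_minus Omega p)%E)
    (p_bounds : forall x, Omega x ->
       (p_minus Omega p <= (p x)%:E <= p_plus Omega p)%E)
    (p_plus_lty : (p_plus Omega p < +oo)%E) :
  let alpha : R := fine (p_minus Omega p) / fine (p_plus Omega p) in
  exists C : R, 0 < C /\
    forall rho0 rho1 : probability 'rV[R]_N R,
      prob_on Omega rho0 -> prob_on Omega rho1 ->
      (wasserstein Omega p rho0 rho1 <= finsler_distance Omega p rho0 rho1
         <= C%:E * wasserstein Omega p rho0 rho1 `^ alpha)%E.
Proof.
have [x0 Ox0] := Omega_neq0.
have mO : measurable Omega by exact: sub_sigma_algebra.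
move: p_minus_gt1 p_bounds p_plus_lty.
case: (p_minus Omega p) => [pm| |]; last 2 first.
- by move=> _ /(_ x0 Ox0) /andP[].
- by [].
case: (p_plus Omega p) => [pp| |]; last 2 first.
- by [].
- by move=> _ /(_ x0 Ox0) /andP[].
rewrite lte_fin => pm1 pb _ /=.
(* p is controlled on Omega only; its extension by pm is measurable on the whole space and keeps the
   bounds. *)
pose q x := if x \in Omega then p x else pm.
have mq : measurable_fun setT q by exact: measurable_patch.
have qp x : Omega x -> p x = q x by move=> Ox; rewrite /q mem_set.
have pmpp : pm <= pp.
  by have /andP[] := pb x0 Ox0; rewrite !lee_fin; exact: le_trans.
have qb x : pm <= q x <= pp.
  rewrite /q; case: ifPn => [/set_mem Ox|_]; last by rewrite lexx.
  by have := pb x Ox; rewrite !lee_fin.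
have q1 x : 1 <= q x by have /andP[+ _] := qb x; apply: le_trans; exact: ltW.
have pm0 : 0 < pm by exact: lt_trans pm1.
have pp0 : 0 < pp by exact: lt_le_trans pmpp.
have [Dm Dm0 ODm] := bounded_set_enorm x0 Omega_bounded.
(* The factor 2 is that of [finsler_distance_le_wasserstein]; 1 + 2 Dm comes from the diameter bound
   W <= 2 Dm. *)
exists (2 * (1 + 2 * Dm)); split; first by rewrite mulr_gt0// addr_gt0// mulr_gt0.
move=> rho0 rho1 r0 r1; apply/andP; split.
  exact: (wasserstein_le_finsler_distance rho0 rho1 mO mq qp pm1 qb).
apply: (finsler_distance_le_powR mO Omega_convex Ox0 Dm0 ODm mq qp q1) => //.
  exact: divr_gt0.
by rewrite ler_pdivrMr// mul1r.
Qed.
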